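(* Let $X$ be one of the following spaces of analytic functions on the unit disk $\mathbb{D}$: the Hardy space $H^p$ with $1\le p<\infty$; the mixed norm space $H(p,q,\alpha)$ with $1\le p\le\infty$, $1\le q<\infty$, $0<\alpha<\infty$; or $H_0(p,\infty,\alpha)$ with $1\le p\le\infty$, $0<\alpha<\infty$ (in particular, $X$ may be a weighted Bergman space $A^p_\alpha$, $1\le p<\infty$, $-1<\alpha<\infty$). Let $\{\varphi_t\}$ be a semigroup of analytic functions such that the weighted composition operators $T_tf=\varphi_t'\,(f\circ\varphi_t)$ are bounded on $X$ with $\sup_{0\le t\le 1}\|T_t\|<\infty$. Then $\{T_t\}$ is a strongly continuous semigroup on $X$, that is, $\lim_{t\to 0^+}\|T_tf-f\|_X=0$ for every $f\in X$.
   Context: A semigroup of analytic functions is a family $\{\varphi_t:t\ge 0\}$ of analytic self-maps of $\mathbb{D}$ such that $\varphi_0$ is the identity, $\varphi_{t+s}=\varphi_t\circ\varphi_s$ for all $t,s\ge0$, and $\varphi_t\to\varphi_0$ uniformly on compact subsets of $\mathbb{D}$ as $t\to0$; $\varphi_t'=\partial\varphi_t/\partial z$. For $f$ analytic in $\mathbb{D}$ and $0\le r<1$, $M_p(r,f)=\left(\int_0^{2\pi}|f(re^{i\theta})|^p\frac{d\theta}{2\pi}\right)^{1/p}$ for $p<\infty$ and $M_\infty(r,f)=\max_\theta|f(re^{i\theta})|$. $H^p$: $\|f\|_{H^p}=\sup_{0\leq r<1}M_p(r,f)<\infty$. $H(p,q,\alpha)$, $q<\infty$: $\|f\|_{p,q,\alpha}^q=\alpha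 q\int_0^1(1-r)^{\alpha q-1}M_p^q(r,f)\,dr<\infty$. $H(p,\infty,\alpha)$: $\|f\|_{p,\infty,\alpha}=\sup_{0\le r<1}(1-r)^\alpha M_p(r,f)<\infty$. $H_0(p,\infty,\alpha)$ is the subspace of $f\in H(p,\infty,\alpha)$ with $\lim_{r\to1^-}(1-r)^\alpha M_p(r,f)=0$. The weighted Bergman space $A^p_\alpha$ consists of analytic $f$ with $\int_{\mathbb{D}}|f(z)|^p(1-|z|^2)^\alpha\,dA(z)<\infty$ ($dA$ the normalized area measure); it is identified, with equivalent norms, with $H\left(p,p,\frac{\alpha+1}{p}\right)$. *)

(* Defs.v *)
From HB Require Import structures.
From mathcomp Require Import all_boot all_order all_algebra.
From mathcomp Require Import all_classical all_reals all_analysis.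
From mathcomp Require Import complex.
Set Implicit Arguments.
Unset Strict Implicit.
Unset Printing Implicit Defensive.
Import Order.TTheory GRing.Theory Num.Theory.
Import numFieldNormedType.Exports.
Local Open Scope classical_set_scope.
Local Open Scope ring_scope.

(* [R[i]^o] is [R[i]] seen as a one-dimensional normed space over itself, so  *)
(* that [derivable f z 1] and [derive1 f z] are complex differentiability and *)
(* the complex derivative.  Functions on the unit disk are total functions    *)
(* whose values outside the disk are irrelevant to every notion below.        *)

Section analytic_functions.
Context {R : realType}.
Implicit Types (f : R[i]^o -> R[i]^o) (phi : R -> R[i]^o -> R[i]^o).

(* The modulus as an element of [R] ([`|z|] lives in [R[i]]). *)
Definition modulus (z : R[i]) : R := complex.Re `|z|.

Definition unit_disk : set R[i]^o := [set z | modulus z < 1].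

Definition analytic_on_disk f : Prop :=
  forall z, unit_disk z -> derivable f z 1.

Record analytic_semigroup phi : Prop := AnalyticSemigroup {
  semigroup_analytic : forall t : R, 0 <= t -> analytic_on_disk (phi t) ;
  semigroup_self_map : forall (t : R) z, 0 <= t -> unit_disk z ->
    unit_disk (phi t z) ;
  semigroup_at0 : forall z, unit_disk z -> phi 0 z = z ;
  semigroup_comp : forall (t s : R) z, 0 <= t -> 0 <= s -> unit_disk z ->
    phi (t + s) z = phi t (phi s z) ;
  semigroup_cvg0 : forall K : set R[i]^o, compact K -> K `<=` unit_disk ->
    {uniform K, phi @ 0^'+ --> phi 0}
}.

Definition weighted_comp phi (t : R) f : R[i]^o -> R[i]^o :=
  fun z => derive1 (phi t) z * f (phi t z).

End analytic_functions.

Section spaces.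
Context {R : realType}.
Implicit Types (f : R[i]^o -> R[i]^o).

Local Notation mu := (@lebesgue_measure R).

Definition circle_point (r theta : R) : R[i]^o :=
  Complex (r * cos theta) (r * sin theta).

(* [-oo] is a junk exponent, excluded by [1 <= p] in [admissible]. *)
Definition integral_mean (p : \bar R) (r : R) f : \bar R :=
  match p with
  | p%:E =>
      (\int[mu]_(theta in `[0%R, (2 * pi)%R])
         (modulus (f (circle_point r theta)) `^ p / (2 * pi))%:E) `^ p^-1
  | +oo =>
      ereal_sup [set (modulus (f (circle_point r theta)))%:E
                | theta in `[0%R, (2 * pi)%R]]
  | -oo => 0
  end%E.

Inductive function_space : Type :=
  | Hardy of R                       (* H^p *)
  | MixedNorm of \bar R & R & R      (* H(p, q, alpha), q < oo *)
  | LittleMixedNorm of \bar R & R    (* H_0(p, oo, alpha) *)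
  | Bergman of R & R.                (* A^p_alpha *)

Definition admissible (X : function_space) : Prop :=
  match X with
  | Hardy p => 1 <= p
  | MixedNorm p q alpha => [/\ (1 <= p)%E, 1 <= q & 0 < alpha]
  | LittleMixedNorm p alpha => (1 <= p)%E /\ 0 < alpha
  | Bergman p alpha => 1 <= p /\ -1 < alpha
  end.

(* The [+oo]-valued norm; the factor [pi^-1] normalizes the area measure. *)
Definition space_norm (X : function_space) f : \bar R :=
  match X with
  | Hardy p =>
      ereal_sup [set integral_mean p%:E r f | r in `[0%R, 1%R[]
  | MixedNorm p q alpha =>
      ((alpha * q)%:E *
       \int[mu]_(r in `[0%R, 1%R[)
         (((1 - r) `^ (alpha * q - 1))%:E * integral_mean p r f `^ q)) `^ q^-1
  | LittleMixedNorm p alpha =>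
      ereal_sup [set ((1 - r) `^ alpha)%:E * integral_mean p r f
                | r in `[0%R, 1%R[]
  | Bergman p alpha =>
      (\int[mu \x mu]_(w in [set w : R * R | unit_disk (Complex w.1 w.2)])
         (modulus (f (Complex w.1 w.2)) `^ p *
          (1 - modulus (Complex w.1 w.2) ^+ 2) `^ alpha / pi)%:E) `^ p^-1
  end%E.

Definition in_space (X : function_space) f : Prop :=
  [/\ analytic_on_disk f, (space_norm X f < +oo)%E &
      if X is LittleMixedNorm p alpha then
        (((1 - r) `^ alpha)%:E * integral_mean p r f)%E @[r --> 1^'-]
          --> (0 : \bar R)
      else True].

Definition operator_norm (X : function_space)
    (T : (R[i]^o -> R[i]^o) -> R[i]^o -> R[i]^o) : \bar R :=
  ereal_sup [set space_norm X (T f)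
            | f in [set f | in_space X f /\ (space_norm X f <= 1)%E]].

Definition bounded_on (X : function_space)
    (T : (R[i]^o -> R[i]^o) -> R[i]^o -> R[i]^o) : Prop :=
  (forall f, in_space X f -> in_space X (T f)) /\ (operator_norm X T < +oo)%E.

(* Elements of [X] are identified when they agree on the disk. *)
Record strongly_continuous_semigroup (X : function_space)
    (T : R -> (R[i]^o -> R[i]^o) -> R[i]^o -> R[i]^o) : Prop :=
  StronglyContinuousSemigroup {
  operators_bounded : forall t : R, 0 <= t -> bounded_on X (T t) ;
  operators_at0 : forall f z, in_space X f -> unit_disk z -> T 0 f z = f z ;
  operators_comp : forall (t s : R) f z, 0 <= t -> 0 <= s -> in_space X f ->
    unit_disk z -> T (t + s) f z = T t (T s f) z ;
  operators_cvg0 : forall f, in_space X f ->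
    space_norm X (fun z => T t f z - f z) @[t --> 0^'+] --> (0 : \bar R)
}.

End spaces.

Arguments function_space : clear implicits.

(* Main.v *)
Require Import Defs.
From mathcomp Require Import all_boot all_order all_algebra.
From mathcomp Require Import all_classical all_reals all_analysis.
From mathcomp Require Import complex.
From mathcomp Require Import measurable_realfun.
From mathcomp Require Import ring lra.
Set Implicit Arguments.
Unset Strict Implicit.
Unset Printing Implicit Defensive.
Import Order.TTheory GRing.Theory Num.Theory.
Import numFieldNormedType.Exports.
Local Open Scope classical_set_scope.
Local Open Scope ring_scope.
Import Normc.

(* For the mixed norm, little mixed norm and Bergman spaces, the norm of [z ^ k f] tends to [0]
   with [k].  Since [|phi_t z| >= rho] for [z] near the circle and small [t], the functions
   [T_t f] and [f] are dominated there by [2 T_t (z ^ k f)] and [2 z ^ k f], while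
   [T_t f --> f] locally uniformly; hence boundedness of [T_t] already gives convergence.
   This fails for [H^p], where uniform convexity is used instead.  Analytic square roots [k_t]
   of [phi_t'] give a companion family [S_t F = k_t F(phi_t)] on [H^(2p)], with
   [(S_t F) ^ 2 = T_t (F ^ 2)] and [|S_t (S_s F)| = |S_(t + s) F|].  When [|S_s F|] nearly
   attains the upper limit of the norms of [S_t F] as [t --> 0], Clarkson's inequality shows
   that [S_t (S_s F)] stays close to [S_s F].  Convex combinations of such [S_s F] approximate
   [F] in norm, so [S_t F --> F] in [H^(2p)] and [T_t (F ^ 2) --> F ^ 2] in [H^p].  Bounded
   functions are differences of two such squares, and they are dense by dilation. *)

(** * The real-valued modulus and complex differentiability *)

Section modulus.
Context {R : realType}.
Local Notation C := (R[i]^o).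
Implicit Types z w c : C.

(** Multiplication by [z] is an isometry of H^p, so powers of [z] cannot make the norm small there:
    the norm is decided at the boundary, which locally uniform convergence does not reach. The
    substitute is monotonicity of circle means in the radius. A lower bound on one circle inside the
    disk, where locally uniform convergence applies, persists on all larger circles; hence the
    development of subharmonic functions from Goursat's theorem on, and the absence of boundary
    values.

    The exponent is doubled for two reasons: H^1 is not uniformly convex, and for exponents
    [2 p >= 2] Clarkson's inequality follows from the parallelogram law. The roots [k_t] exist
    because [phi_t'] has no zero. They are determined up to sign and chosen for each [t] separately,
    so [S_t] obeys the semigroup law only up to sign; norms do not see this.

    Constants never matter beyond being independent of [t], so triangle inequalities with crude
    factors are used in place of Minkowski's. *)

Lemma modulusE z : modulus z = normc z.
Proof. by rewrite /modulus normc_def; case: z. Qed.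

Lemma normC_modulus z : `|z| = (modulus z)%:C%C.
Proof. by rewrite modulusE normc_def; case: z. Qed.

Lemma modulus_ge0 z : 0 <= modulus z.
Proof. by rewrite modulusE; case: z => a b; exact: sqrtr_ge0. Qed.

Lemma modulus0 : modulus (0 : C) = 0.
Proof. by rewrite modulusE normc0. Qed.

Lemma modulus1 : modulus (1 : C) = 1.
Proof. by rewrite modulusE normc1. Qed.

Lemma modulusM z w : modulus (z * w) = modulus z * modulus w.
Proof. by rewrite !modulusE normcM. Qed.

Lemma modulusD z w : modulus (z + w) <= modulus z + modulus w.
Proof. by rewrite !modulusE le_normcD. Qed.

Lemma modulusN z : modulus (- z) = modulus z.
Proof. by rewrite !modulusE normcN. Qed.

Lemma modulusBC z w : modulus (z - w) = modulus (w - z).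
Proof. by rewrite -modulusN opprB. Qed.

Lemma modulusB z w : modulus (z - w) <= modulus z + modulus w.
Proof. by rewrite -(modulusN w) modulusD. Qed.

Lemma modulus_dist z w : `|modulus z - modulus w| <= modulus (z - w).
Proof.
rewrite ler_norml; apply/andP; split.
  have := modulusD (w - z) z; rewrite subrK modulusBC; lra.
by have := modulusD (z - w) w; rewrite subrK; lra.
Qed.

Lemma modulusV z : modulus z^-1 = (modulus z)^-1.
Proof. by rewrite !modulusE normcV. Qed.

Lemma modulusX z n : modulus (z ^+ n) = modulus z ^+ n.
Proof. by elim: n => [|n ih]; rewrite ?modulus1// !exprS modulusM ih. Qed.

Lemma modulus_eq0 z : (modulus z == 0) = (z == 0).
Proof.
apply/eqP/eqP => [|->]; last exact: modulus0.
by rewrite modulusE => /eq0_normc.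
Qed.

Lemma modulus_gt0 z : (0 < modulus z) = (z != 0).
Proof. by rewrite lt0r modulus_ge0 andbT modulus_eq0. Qed.

Lemma modulus_sqr z : modulus z ^+ 2 = complex.Re z ^+ 2 + complex.Im z ^+ 2.
Proof.
by rewrite modulusE; case: z => a b /=; rewrite sqr_sqrtr// addr_ge0// sqr_ge0.
Qed.

Lemma Re_le_modulus z : `|complex.Re z| <= modulus z.
Proof.
have := modulus_sqr z; have := modulus_ge0 z; have := sqr_ge0 (complex.Im z).
rewrite ler_norml; move: (modulus z) (complex.Re z) => m a; nra.
Qed.

Lemma Im_le_modulus z : `|complex.Im z| <= modulus z.
Proof.
have := modulus_sqr z; have := modulus_ge0 z; have := sqr_ge0 (complex.Re z).
rewrite ler_norml; move: (modulus z) (complex.Im z) => m a; nra.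
Qed.

Lemma modulus_le_ReIm z : modulus z <= `|complex.Re z| + `|complex.Im z|.
Proof.
have := modulus_sqr z; have := modulus_ge0 z.
rewrite -(real_normK (num_real (complex.Re z))) -(real_normK (num_real (complex.Im z))).
have := normr_ge0 (complex.Re z); have := normr_ge0 (complex.Im z).
move: (modulus z) `|complex.Re z| `|complex.Im z| => m a b; nra.
Qed.

Lemma modulusR (x : R) : modulus (x%:C%C : C) = `|x|.
Proof. by rewrite modulusE /= expr0n addr0 sqrtr_sqr. Qed.

Lemma gt0_realC (e : R[i]) : 0 < e -> e = (complex.Re e)%:C%C /\ 0 < complex.Re e.
Proof. by case: e => a b; rewrite ltcE /= => /andP[/eqP -> a0]. Qed.

Lemma near_modulus z (P : set C) : (\forall w \near z, P w) <->
  exists2 d : R, 0 < d & forall w, modulus (w - z) < d -> P w.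
Proof.
split=> [/nbhs_ballP[e /= /gt0_realC[-> e0] eP]|[d d0 dP]].
  exists (complex.Re e) => // w we; apply: eP.
  by rewrite -ball_normE /ball_/= normC_modulus ltcR modulusBC.
apply/nbhs_ballP; exists (d%:C%C) => /=; first by rewrite ltcR.
by move=> w; rewrite -ball_normE /ball_/= normC_modulus ltcR modulusBC; exact: dP.
Qed.

(** The epsilon-delta form with real [e] and [d], written without a quotient so that [w = z] is not
    a special case. *)
Definition cder (f : C -> C) z c := forall e : R, 0 < e -> exists2 d : R, 0 < d &
  forall w, modulus (w - z) < d -> modulus (f w - f z - c * (w - z)) <= e * modulus (w - z).

Lemma cder_derive f z c : cder f z c <-> (h^-1 *: (f (h *: (1 : C) + z) - f z) @[h --> (0 : C)^'] --> c).
Proof.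
split=> [fc|fc].
  apply/cvgrPdist_lt => e /gt0_realC[-> e0]; set r := complex.Re e in e0 *.
  have r2 : 0 < r / 2 by lra.
  have [d d0 H] := fc _ r2.
  rewrite /dnbhs /within /=; apply/near_modulus; exists d => // h; rewrite subr0 => hd h0.
  have {}H := H (h *: (1:C) + z); rewrite addrK in H.
  have hE : h *: (1 : C) = h by rewrite /GRing.scale/= mulr1.
  rewrite hE in H *; have {}H := H hd.
  have h0' : 0 < modulus h by rewrite modulus_gt0.
  rewrite normC_modulus modulusBC ltcR -(ltr_pM2r h0') -modulusM mulrBl.
  rewrite /GRing.scale/= mulrAC mulVf// mul1r; apply: le_lt_trans H _.
  by rewrite ltr_pM2r//; lra.
move=> e e0; have e0' : (0 : R[i]) < e%:C%C by rewrite ltcR.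
have fc' := (cvgrPdist_lt _ _).1 fc _ e0'.
have [d d0 H] := (near_modulus (0 : C) (fun t => t != 0 ->
  `|c - t^-1 *: (f (t *: (1 : C) + z) - f z)| < e%:C%C)).1 (fc' _); exists d => // w wd.
have [->|wz] := eqVneq w z; first by rewrite !subrr mulr0 subr0 modulus0 mulr0.
have {}H := H (w - z); rewrite subr0 in H; have {H} := H wd; rewrite subr_eq0 => /(_ wz).
have hE : (w - z) *: (1 : C) = w - z by rewrite /GRing.scale/= mulr1.
have h0' : 0 < modulus (w - z) by rewrite modulus_gt0 subr_eq0.
rewrite hE subrK normC_modulus ltcR -(ltr_pM2r h0') -modulusM mulrBl.
rewrite /GRing.scale/= mulrAC mulVf ?subr_eq0// mul1r (modulusBC (f w - f z)); exact: ltW.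
Qed.

Lemma cderP f z : derivable f z 1 <-> exists c, cder f z c.
Proof.
split => [/cvg_ex[c /= fc]|[c /cder_derive fc]]; first by exists c; apply/cder_derive.
by apply/cvg_ex; exists c.
Qed.

Lemma cder_derive1 f z c : cder f z c -> derive1 f z = c.
Proof.
move=> /cder_derive fc; rewrite derive1E /derive.
exact: (@cvg_lim _ _ _ _ _ _ _ fc).
Qed.

Lemma derivable_cder f z : derivable f z 1 -> cder f z (derive1 f z).
Proof. by move=> /cderP[c fc]; rewrite (cder_derive1 fc). Qed.

End modulus.

(** * Rules for complex derivatives, continuity, and the mean value inequality *)

Section complex_derivative.
Context {R : realType}.
Local Notation C := (R[i]^o).
Implicit Types (z w c : C) (f g : C -> C).

Lemma cder_is_derive f z c : cder f z c <-> is_derive z (1 : C) f c.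
Proof.
split=> [fc|[fd <-]]; last by rewrite -derive1E; exact: derivable_cder.
by apply: DeriveDef; [apply/cderP; exists c|rewrite -derive1E; exact: cder_derive1].
Qed.

Lemma cder_cst (a : C) z : cder (fun=> a) z 0.
Proof. apply/cder_is_derive; exact: is_derive_cst. Qed.

Lemma cder_id z : cder id z 1.
Proof. apply/cder_is_derive; exact: is_derive_id. Qed.

Lemma cderD f g z c c' : cder f z c -> cder g z c' -> cder (fun w => f w + g w) z (c + c').
Proof. by move=> /cder_is_derive fc /cder_is_derive gc; apply/cder_is_derive; exact: is_deriveD. Qed.

Lemma cderB f g z c c' : cder f z c -> cder g z c' -> cder (fun w => f w - g w) z (c - c').
Proof. by move=> /cder_is_derive fc /cder_is_derive gc; apply/cder_is_derive; exact: is_deriveB. Qed.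

Lemma cderM f g z c c' : cder f z c -> cder g z c' ->
  cder (fun w => f w * g w) z (f z * c' + g z * c).
Proof. by move=> /cder_is_derive fc /cder_is_derive gc; apply/cder_is_derive; exact: is_deriveM. Qed.

Lemma cder_near f g z c (d : R) : 0 < d -> (forall w, modulus (w - z) < d -> f w = g w) ->
  cder f z c -> cder g z c.
Proof.
move=> d0 fg fc e /fc[d' d'0 H]; exists (Num.min d d'); first by rewrite lt_min d0.
move=> w; rewrite lt_min => /andP[wd wd']; rewrite -!fg//; first exact: H.
by rewrite subrr modulus0.
Qed.

Lemma cder_lip f z c : cder f z c -> exists2 d : R, 0 < d &
  forall w, modulus (w - z) < d -> modulus (f w - f z) <= (modulus c + 1) * modulus (w - z).
Proof.
move=> /(_ 1 ltr01)[d d0 H]; exists d => // w /H; rewrite mul1r => {}H.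
have := modulusD (f w - f z - c * (w - z)) (c * (w - z)); rewrite subrK modulusM; lra.
Qed.

Lemma cder_comp f g z c c' : cder f z c -> cder g (f z) c' ->
  cder (fun w => g (f w)) z (c' * c).
Proof.
move=> fc gc e e0.
have [d1 d10 H1] := cder_lip fc.
have m0 := modulus_ge0 c; have m0' := modulus_ge0 c'.
have K0 : 0 < modulus c + 1 by lra.
have e1 : 0 < e / (2 * (modulus c + 1)) by rewrite divr_gt0//; lra.
have [d2 d20 H2] := gc _ e1.
have K'0 : 0 < modulus c' + 1 by lra.
have e2 : 0 < e / (2 * (modulus c' + 1)) by rewrite divr_gt0//; lra.
have [d3 d30 H3] := fc _ e2.
exists (Num.min d1 (Num.min (d2 / (modulus c + 1)) d3)).
  by rewrite !lt_min d10 d30 divr_gt0.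
move=> w; rewrite !lt_min ltr_pdivlMr// => /and3P[w1 w2 w3].
have L1 := H1 _ w1.
have {}H2 : modulus (g (f w) - g (f z) - c' * (f w - f z)) <=
    e / (2 * (modulus c + 1)) * modulus (f w - f z).
  by apply: H2; apply: le_lt_trans L1 _; rewrite mulrC.
have {}H3 := H3 _ w3.
have -> : g (f w) - g (f z) - c' * c * (w - z) =
  (g (f w) - g (f z) - c' * (f w - f z)) + c' * (f w - f z - c * (w - z)) by ring.
apply: le_trans (modulusD _ _) _; rewrite modulusM.
have -> : e * modulus (w - z) = e / 2 * modulus (w - z) + e / 2 * modulus (w - z) by lra.
apply: lerD.
  apply: le_trans H2 _.
  have -> : e / 2 * modulus (w - z) = e / (2 * (modulus c + 1)) * ((modulus c + 1) * modulus (w - z)).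
    by move: (modulus c) K0 => k K0; field; rewrite gt_eqF.
  by rewrite ler_wpM2l// ltW.
apply: le_trans (_ : _ <= (modulus c' + 1) * (e / (2 * (modulus c' + 1)) * modulus (w - z))) _.
  by apply: ler_pM => //; [exact: modulus_ge0|lra].
rewrite le_eqVlt; apply/orP; left; apply/eqP.
by move: (modulus c') K'0 => k K'0; field; rewrite gt_eqF.
Qed.

Lemma cvgCR_distP (g : C -> R) z (l : R) : (g w @[w --> z] --> l) <->
  forall e : R, 0 < e -> exists2 d : R, 0 < d &
    forall w, modulus (w - z) < d -> `|g w - l| < e.
Proof.
have FF : Filter (nbhs z) := nbhs_filter z.
split=> [/(@cvgrPdist_lt _ _ _ _ FF) gl e /gl /(near_modulus z (fun w => `|l - g w| < e))[d d0 H]|H].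
  by exists d => // w /H; rewrite distrC.
apply/(@cvgrPdist_lt _ _ _ _ FF) => e /H[d d0 {}H]; apply/near_modulus.
by exists d => // w /H; rewrite distrC.
Qed.

Lemma modulus_continuous : continuous (modulus : C -> R).
Proof.
move=> z; apply/cvgCR_distP => e e0; exists e => // w wz.
by  apply: le_lt_trans (modulus_dist _ _) wz.
Qed.

Lemma continuous_modulusP f z : {for z, continuous f} <->
  forall e : R, 0 < e -> exists2 d : R, 0 < d &
    forall w, modulus (w - z) < d -> modulus (f w - f z) < e.
Proof.
have FF : Filter (nbhs z) := nbhs_filter z.
split=> [/(@cvgrPdist_lt _ _ _ _ FF) fc e e0|H].
  have e0' : (0 : R[i]) < e%:C%C by rewrite ltcR.
  have fc' := fc _ e0'.
  have [d d0 {}H] := (near_modulus z (fun t => `|f z - f t| < e%:C%C)).1 fc'.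
  by exists d => // w /H; rewrite normC_modulus ltcR modulusBC.
apply/(@cvgrPdist_lt _ _ _ _ FF) => e /gt0_realC[-> e0].
by apply/near_modulus; have [d d0 {}H] := H _ e0; exists d => // w /H; rewrite normC_modulus ltcR modulusBC.
Qed.

Lemma cder_continuous f z c : cder f z c -> {for z, continuous f}.
Proof.
move=> fc; apply/continuous_modulusP => e e0.
have m0 := modulus_ge0 c; have K0 : 0 < modulus c + 1 by lra.
have [d d0 H] := cder_lip fc; exists (Num.min d (e / (modulus c + 1))).
  by rewrite lt_min d0 divr_gt0.
move=> w; rewrite lt_min ltr_pdivlMr// => /andP[/H wd we].
by apply: le_lt_trans wd _; rewrite mulrC.
Qed.

Lemma Complex_continuous : continuous (fun p : R * R => Complex p.1 p.2 : C).
Proof.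
move=> p; apply/cvgrPdist_lt => e /gt0_realC[-> e0].
have e2 : 0 < complex.Re e / 2 by lra.
have c1 : (fun q : R * R => q.1) q @[q --> p] --> p.1 by exact: cvg_fst.
have c2 : (fun q : R * R => q.2) q @[q --> p] --> p.2 by exact: cvg_snd.
near=> q; rewrite normC_modulus ltcR.
apply: le_lt_trans (modulus_le_ReIm _) _ => /=.
have : `|p.1 - q.1| < complex.Re e / 2.
  by near: q; exact: ((cvgrPdist_lt _ _).1 c1).
have : `|p.2 - q.2| < complex.Re e / 2.
  by near: q; exact: ((cvgrPdist_lt _ _).1 c2).
lra.
Unshelve. all: by end_near. Qed.

Lemma continuousRC (p : R -> C) (s : R) :
  (forall e : R, 0 < e -> exists2 d : R, 0 < d & forall x, `|x - s| < d -> modulus (p x - p s) < e) ->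
  {for s, continuous p}.
Proof.
move=> H; apply/cvgrPdist_lt => e /gt0_realC[-> /H[d d0 {}H]]; apply/nbhs_ballP; exists d => //= x.
by rewrite /ball/= distrC => /H; rewrite normC_modulus ltcR modulusBC.
Qed.

Lemma horizontal_continuous (y s : R) : {for s, continuous (fun s => Complex s y : C)}.
Proof.
apply: continuousRC => e e0; exists e => // x; apply: le_lt_trans.
by apply: le_trans (modulus_le_ReIm _) _; rewrite /= subrr normr0 addr0.
Qed.

Lemma vertical_continuous (x s : R) : {for s, continuous (fun s => Complex x s : C)}.
Proof.
apply: continuousRC => e e0; exists e => // y; apply: le_lt_trans.
by apply: le_trans (modulus_le_ReIm _) _; rewrite /= subrr normr0 add0r.
Qed.
Lemma Re_continuous : continuous (@complex.Re R : C -> R).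
Proof.
move=> z; apply/cvgCR_distP => e e0; exists e => // w wz.
have := Re_le_modulus (w - z); case: w z wz => a b [c d] /= ? ?; lra.
Qed.

Lemma Im_continuous : continuous (@complex.Im R : C -> R).
Proof.
move=> z; apply/cvgCR_distP => e e0; exists e => // w wz.
have := Im_le_modulus (w - z); case: w z wz => a b [c d] /= ? ?; lra.
Qed.

Lemma closed_disk_compact (r : R) : compact [set z : C | modulus z <= r].
Proof.
apply: (@subclosed_compact _ _ ((fun p : R * R => Complex p.1 p.2 : C) @` (`[-r, r] `*` `[-r, r]))).
- apply: (@preimage_closed _ _ (modulus : C -> R) [set x | x <= r]); first by move=> ? ?; exact: modulus_continuous.
  exact: closed_le.
- apply: continuous_compact; last by apply: compact_setX; exact: segment_compact.
  exact/continuous_subspaceT/Complex_continuous.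
- move=> z zr; exists (complex.Re z, complex.Im z); last by case: z {zr}.
  have := Re_le_modulus z; have := Im_le_modulus z; move: zr; rewrite /= => zr.
  rewrite !ler_norml !in_itv/= => /andP[? ?] /andP[? ?]; split; rewrite /=; apply/andP; split; lra.
Qed.

Lemma disk_max (r : R) (u : C -> R) : 0 <= r ->
  (forall z, modulus z <= r -> {for z, continuous u}) ->
  exists2 c, modulus c <= r & forall z, modulus z <= r -> u z <= u c.
Proof.
move=> r0 cu.
have [|||c] := @compact_EVT_max _ _ u [set z : C | modulus z <= r].
- by exists 0; rewrite /= modulus0.
- exact: closed_disk_compact.
- by apply/continuous_in_subspaceT => z; rewrite inE; exact: cu.
by rewrite inE => cr H; exists c => // z zr; apply: H; rewrite inE.
Qed.

Lemma real_is_derive (g : R -> R) (s l : R) :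
  (forall e : R, 0 < e -> exists2 d : R, 0 < d & forall x, `|x - s| < d ->
    `|g x - g s - l * (x - s)| <= e * `|x - s|) -> is_derive s 1 g l.
Proof.
move=> H.
have L : (h^-1 *: (g (h *: (1 : R) + s) - g s) @[h --> (0 : R)^'] --> l).
  apply/cvgrPdist_lt => e e0; have e2 : 0 < e / 2 by lra.
  have [d d0 {}H] := H _ e2.
  rewrite /dnbhs /within /=; apply/nbhs_ballP; exists d => //= h.
  rewrite /ball/= sub0r normrN => hd h0.
  have := H (h + s); rewrite addrK => /(_ hd).
  rewrite /GRing.scale/= mulr1 => {}H.
  have h0' : 0 < `|h| by rewrite normr_gt0.
  rewrite distrC -(ltr_pM2r h0') -normrM mulrBl mulrAC mulVf// mul1r.
  by apply: le_lt_trans H _; rewrite ltr_pM2r//; lra.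
apply: DeriveDef; first by apply/cvg_ex; exists l.
exact: (@cvg_lim _ _ _ _ _ _ _ L).
Qed.

(** The mean value theorem needs real values. It is applied along the segment to the real part of
    [conjc u * f] with [u = f w - f z], the direction in which the increment is [|u| ^ 2] and
    nothing is lost. *)
Lemma cder_segment_lip f f' z w (K : R) :
  (forall s : R, 0 <= s <= 1 -> cder f (z + s%:C%C * (w - z)) (f' (z + s%:C%C * (w - z))) /\
     modulus (f' (z + s%:C%C * (w - z))) <= K) ->
  modulus (f w - f z) <= K * modulus (w - z).
Proof.
move=> H; set u := f w - f z.
have [->|u0] := eqVneq u 0.
  rewrite modulus0 mulr_ge0 ?modulus_ge0//.
  by have [|_] := H 0; rewrite ?lexx ?ler01//; apply: le_trans; exact: modulus_ge0.
have mu0 : 0 < modulus u by rewrite modulus_gt0.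
pose p (s : R) : C := z + s%:C%C * (w - z).
pose g (s : R) := complex.Re ((conjc u : C) * f (p s)).
have pB (s t : R) : p s - p t = (s - t)%:C%C * (w - z) by rewrite /p rmorphB; ring.
have ReB (a b c : C) : complex.Re (c * a : C) - complex.Re (c * b : C) = complex.Re (c * (a - b)).
  by rewrite mulrBr; case: (c * a) (c * b) => ? ? [? ?].
have Rer (r : R) (a : C) : r * complex.Re a = complex.Re (r%:C%C * a).
  by case: a => a b /=; rewrite mul0r subr0.
have mconj : modulus (conjc u : C) = modulus u.
  by rewrite !modulusE; case: (u) => a b /=; rewrite sqrrN.
have gd (s : R) : 0 <= s <= 1 -> is_derive s 1 g (complex.Re ((conjc u : C) * (f' (p s) * (w - z)))).
  move=> s01; apply: real_is_derive => e e0.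
  have [fc _] := H _ s01.
  have W0 := modulus_ge0 (w - z).
  have e1 : 0 < e / (modulus u * (modulus (w - z) + 1)).
    by rewrite divr_gt0// mulr_gt0//; lra.
  have [d d0 Hd] := fc _ e1.
  exists (d / (modulus (w - z) + 1)); first by rewrite divr_gt0//; lra.
  move=> t; rewrite ltr_pdivlMr; last by lra.
  move=> td; rewrite /g ReB [_ * (t - s)]mulrC Rer.
  have -> : (t - s)%:C%C * ((conjc u : C) * (f' (p s) * (w - z))) =
    (conjc u : C) * (f' (p s) * (p t - p s)) by rewrite pB; ring.
  rewrite ReB; apply: le_trans (Re_le_modulus _) _; rewrite modulusM mconj.
  have ts : modulus (p t - p s) = `|t - s| * modulus (w - z) by rewrite pB modulusM modulusR.
  have {}Hd : modulus (f (p t) - f (p s) - f' (p s) * (p t - p s)) <=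
     e / (modulus u * (modulus (w - z) + 1)) * modulus (p t - p s).
    apply: Hd; rewrite -/(p s) ts; apply: le_lt_trans td.
    by rewrite ler_wpM2l//; lra.
  apply: le_trans (ler_wpM2l (ltW mu0) Hd) _; rewrite ts.
  have -> : modulus u * (e / (modulus u * (modulus (w - z) + 1)) * (`|t - s| * modulus (w - z))) =
    e * `|t - s| * (modulus (w - z) / (modulus (w - z) + 1)).
    move: (modulus u) (modulus (w - z)) mu0 W0 => a b a0 b0.
    by field; apply/andP; split; rewrite gt_eqF//; lra.
  by rewrite ler_piMr// ?mulr_ge0//; [exact: ltW|rewrite ler_pdivrMr; lra].
have [||c c01] := @MVT_segment R g (fun s => complex.Re ((conjc u : C) * (f' (p s) * (w - z)))) 0 1 ler01.
- by move=> x; rewrite in_itv/= => /andP[? ?]; apply: gd; apply/andP; split; lra.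
- apply: derivable_within_continuous => x; rewrite in_itv/= => x01.
  by have [] := gd _ x01.
move: c01; rewrite in_itv/= subr0 mulr1 /g ReB => c01.
have -> : p 1 = w by rewrite /p rmorph1 mul1r addrC subrK.
have -> : p 0 = z by rewrite /p rmorph0 mul0r addr0.
rewrite -/u.
have -> : complex.Re ((conjc u : C) * u) = modulus u ^+ 2.
  by rewrite modulus_sqr; case: (u) => a b /=; ring.
move=> E.
have [_ HK] := H _ c01.
have : modulus u ^+ 2 <= modulus u * (K * modulus (w - z)).
  rewrite E; apply: le_trans (ler_norm _) _; apply: le_trans (Re_le_modulus _) _.
  rewrite !modulusM mconj; apply: ler_wpM2l; first exact: ltW.
  by apply: ler_wpM2r; [exact: modulus_ge0|exact: HK].
by rewrite expr2 ler_pM2l.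
Qed.

End complex_derivative.

(** * Integrals of continuous functions over compact intervals *)

Section interval_integral.
Context {R : realType}.
Local Notation mu := (@lebesgue_measure R).
Implicit Types (a b m k : R) (f g : R -> R).

Definition iint a b g : R := \int[mu]_(t in `[a, b]) g t.

Lemma itv_integrable a b g : {within `[a, b], continuous g} -> mu.-integrable `[a, b] (EFin \o g).
Proof. by move=> cg; apply: continuous_compact_integrable => //; exact: segment_compact. Qed.

Lemma within_itvS a b a' b' g : a <= a' -> b' <= b ->
  {within `[a, b], continuous g} -> {within `[a', b'], continuous g}.
Proof.
move=> aa bb; apply: continuous_subspaceW => x /=; rewrite !in_itv/= => /andP[? ?].
by apply/andP; split; lra.
Qed.

Lemma cst_within (A : set R) k : {within A, continuous (fun=> k : R)}.
Proof. by apply: continuous_subspaceT => ?; exact: cst_continuous. Qed.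

Lemma iint_split a m b g : a <= m -> m <= b -> {within `[a, b], continuous g} ->
  iint a b g = iint a m g + iint m b g.
Proof.
move=> am mb cg; have ig := itv_integrable cg.
have := @Rintegral_itvB R g (BLeft a) (BRight b) m ig.
rewrite !bnd_simp => /(_ am mb).
have im : mu.-integrable `]m, b] (EFin \o g).
  by apply: integrableS ig => //; apply: subset_itvr; rewrite bnd_simp.
by rewrite Rintegral_itv_obnd_cbnd// => E; rewrite /iint -E addrC subrK.
Qed.

Lemma iint_le a b f g : {within `[a, b], continuous f} -> {within `[a, b], continuous g} ->
  (forall t, a <= t <= b -> f t <= g t) -> iint a b f <= iint a b g.
Proof.
move=> cf cg fg; apply: le_Rintegral => //; exact: itv_integrable.
Qed.

Lemma iint_cst a b k : a <= b -> iint a b (fun=> k) = k * (b - a).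
Proof.
move=> ab; rewrite /iint Rintegral_cst//; congr (_ * _).
have := @lebesgue_measure_itv R `[a, b]; rewrite /= lte_fin => ->.
by case: ltgtP ab => // -> _; rewrite subrr.
Qed.

Lemma eq_iint a b f g : (forall t, a <= t <= b -> f t = g t) -> iint a b f = iint a b g.
Proof. by move=> fg; apply: eq_Rintegral => x; rewrite inE/= in_itv/=; exact: fg. Qed.

Lemma iintD a b f g : {within `[a, b], continuous f} -> {within `[a, b], continuous g} ->
  iint a b (fun t => f t + g t) = iint a b f + iint a b g.
Proof. by move=> cf cg; apply: RintegralD => //; exact: itv_integrable. Qed.

Lemma iintB a b f g : {within `[a, b], continuous f} -> {within `[a, b], continuous g} ->
  iint a b (fun t => f t - g t) = iint a b f - iint a b g.
Proof. by move=> cf cg; apply: RintegralB => //; exact: itv_integrable. Qed.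

Lemma iintZ a b k f : {within `[a, b], continuous f} ->
  iint a b (fun t => k * f t) = k * iint a b f.
Proof. by move=> cf; apply: RintegralZl => //; exact: itv_integrable. Qed.

Lemma iint_near_cst a b g k (e : R) : a <= b -> {within `[a, b], continuous g} ->
  (forall t, a <= t <= b -> `|g t - k| <= e) -> `|iint a b g - k * (b - a)| <= e * (b - a).
Proof.
move=> ab cg H; rewrite -!iint_cst// -iintB//; last exact: cst_within.
have cgk : {within `[a, b], continuous (fun t => g t - k)}.
  by move=> x; apply: continuousB; [exact: cg|exact: cst_continuous].
rewrite ler_norml; apply/andP; split.
  have -> : - iint a b (fun=> e) = iint a b (fun=> - e) by rewrite !iint_cst// mulNr.
  apply: iint_le => //; first exact: cst_within.
  by move=> t /H; rewrite ler_norml => /andP[].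
apply: iint_le => //; first exact: cst_within.
by move=> t /H; rewrite ler_norml => /andP[].
Qed.

End interval_integral.

(** * Goursat's theorem for rectangles *)

Section goursat.
Context {R : realType}.
Local Notation C := (R[i]^o).

(* Repeated quartering of a rectangle closes in on a point. *)
Lemma rectangle_bisection (B : R -> R -> R -> R -> Prop) (x0 y0 w l : R) :
  0 <= w -> 0 <= l ->
  (forall x y w l, 0 <= w -> 0 <= l -> B x y w l -> exists i j : bool,
     B (x + i%:R * (w / 2)) (y + j%:R * (l / 2)) (w / 2) (l / 2)) ->
  B x0 y0 w l -> exists c1 c2 : R, [/\ x0 <= c1 <= x0 + w, y0 <= c2 <= y0 + l &
    forall d : R, 0 < d -> exists x y n, [/\ B x y (w / 2 ^+ n) (l / 2 ^+ n),
      x <= c1 <= x + w / 2 ^+ n, y <= c2 <= y + l / 2 ^+ n &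
      w / 2 ^+ n < d /\ l / 2 ^+ n < d]].
Proof.
move=> w0 l0 step B0.
pose wn n := w / 2 ^+ n; pose ln n := l / 2 ^+ n.
have p2 n : 0 < (2 : R) ^+ n by rewrite exprn_gt0.
have wn0 n : 0 <= wn n by rewrite divr_ge0// ltW.
have ln0 n : 0 <= ln n by rewrite divr_ge0// ltW.
have wnS n : wn n.+1 = wn n / 2 by rewrite /wn exprS invfM mulrA mulrAC.
have lnS n : ln n.+1 = ln n / 2 by rewrite /ln exprS invfM mulrA mulrAC.
(* Where [B] fails, [f] returns the corner it was given, so the nesting bounds hold without any
   knowledge of [B]. *)
have [f fP] : {f : nat * (R * R) -> R * R & forall q,
    (B q.2.1 q.2.2 (wn q.1) (ln q.1) -> B (f q).1 (f q).2 (wn q.1.+1) (ln q.1.+1)) /\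
    (q.2.1 <= (f q).1 <= q.2.1 + wn q.1.+1 /\ q.2.2 <= (f q).2 <= q.2.2 + ln q.1.+1)}.
  apply: (@choice _ _ (fun q r => (B q.2.1 q.2.2 (wn q.1) (ln q.1) ->
    B r.1 r.2 (wn q.1.+1) (ln q.1.+1)) /\
    (q.2.1 <= r.1 <= q.2.1 + wn q.1.+1 /\ q.2.2 <= r.2 <= q.2.2 + ln q.1.+1))).
  move=> [n [x y]] /=; have [Bn|nB] := pselect (B x y (wn n) (ln n)); last first.
    by exists (x, y); split => //=; have := wn0 n.+1; have := ln0 n.+1; rewrite !lexx/= !lerDl => -> ->.
  have [i [j Bij]] := step _ _ _ _ (wn0 n) (ln0 n) Bn.
  exists (x + i%:R * wn n.+1, y + j%:R * ln n.+1) => /=; rewrite !wnS !lnS; split => //.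
  have := wn0 n.+1; have := ln0 n.+1; rewrite wnS lnS.
  by clear Bij; case: i; case: j => /=; rewrite ?mul1r ?mul0r ?addr0; split; lra.
pose q := fix q n := if n is n'.+1 then f (n', q n') else (x0, y0).
have Bq n : B (q n).1 (q n).2 (wn n) (ln n).
  elim: n => [|n ih]; first by rewrite /wn /ln expr0 !divr1.
  by have [H _] := fP (n, q n); exact: H.
have xS n : (q n).1 <= (q n.+1).1 <= (q n).1 + wn n.+1 by have [_ []] := fP (n, q n).
have yS n : (q n).2 <= (q n.+1).2 <= (q n).2 + ln n.+1 by have [_ []] := fP (n, q n).
have xmn m n : (q m).1 <= (q (m + n)%N).1 /\ (q (m + n)%N).1 + wn (m + n)%N <= (q m).1 + wn m.
  elim: n => [|n [ih1 ih2]]; first by rewrite addn0; lra.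
  rewrite addnS; move: (xS (m + n)%N); have := wnS (m + n)%N => -> /andP[? ?].
  by split; lra.
have ymn m n : (q m).2 <= (q (m + n)%N).2 /\ (q (m + n)%N).2 + ln (m + n)%N <= (q m).2 + ln m.
  elim: n => [|n [ih1 ih2]]; first by rewrite addn0; lra.
  rewrite addnS; move: (yS (m + n)%N); have := lnS (m + n)%N => -> /andP[? ?].
  by split; lra.
have xub m n : (q m).1 <= (q n).1 + wn n.
  have [mn|/ltnW nm] := leqP m n.
    have [] := xmn m (n - m)%N; rewrite subnKC// => H _; have := wn0 n; lra.
  have [] := xmn n (m - n)%N; rewrite subnKC// => _; have := wn0 m; lra.
have yub m n : (q m).2 <= (q n).2 + ln n.
  have [mn|/ltnW nm] := leqP m n.
    have [] := ymn m (n - m)%N; rewrite subnKC// => H _; have := ln0 n; lra.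
  have [] := ymn n (m - n)%N; rewrite subnKC// => _; have := ln0 m; lra.
pose c1 := sup (range (fun n => (q n).1)); pose c2 := sup (range (fun n => (q n).2)).
have c1P n : (q n).1 <= c1 <= (q n).1 + wn n.
  apply/andP; split.
    apply: ub_le_sup; last by exists n.
    by exists ((q 0%N).1 + wn 0) => _ [m _ <-].
  apply: ge_sup; first by exists (q 0%N).1, 0%N.
  by move=> _ [m _ <-].
have c2P n : (q n).2 <= c2 <= (q n).2 + ln n.
  apply/andP; split.
    apply: ub_le_sup; last by exists n.
    by exists ((q 0%N).2 + ln 0) => _ [m _ <-].
  apply: ge_sup; first by exists (q 0%N).2, 0%N.
  by move=> _ [m _ <-].
exists c1, c2; split.
- by have := c1P 0%N; rewrite /wn expr0 divr1.
- by have := c2P 0%N; rewrite /ln expr0 divr1.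
move=> d d0.
have [n nd] : exists n : nat, (w + l) / d < 2 ^+ n.
  have [n Hn] : exists n : nat, (w + l) / d < n%:R.
    by exists (Num.bound ((w + l) / d)); apply: archi_boundP; apply: divr_ge0; [exact: addr_ge0|exact: ltW].
  exists n; apply: lt_trans Hn _; rewrite -natrX ltr_nat; exact: ltn_expl.
exists (q n).1, (q n).2, n; split; [exact: Bq|exact: c1P|exact: c2P|].
move: nd; rewrite ltr_pdivrMr// => nd.
by split; rewrite ltr_pdivrMr// mulrC; lra.
Qed.

Variable h : C -> C.
Local Notation H x1 x2 y := (iint x1 x2 (fun s => complex.Im (h (Complex s y)))).
Local Notation V y1 y2 x := (iint y1 y2 (fun t => complex.Re (h (Complex x t)))).
Local Notation J x1 x2 y1 y2 := (H x1 x2 y1 + V y1 y2 x2 - H x1 x2 y2 - V y1 y2 x1).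

(** [J] is the imaginary part of the integral of [h] counterclockwise around the rectangle, the part
    that carries means of [Re f] in exponential coordinates. Were it nonzero, quartering would lead
    to arbitrarily small rectangles on which [|J|] exceeds a fixed multiple of the squared half
    perimeter, against differentiability at the limit point. *)
Lemma goursat (x1 x2 y1 y2 : R) : x1 <= x2 -> y1 <= y2 ->
  (forall x y, x1 <= x <= x2 -> y1 <= y <= y2 -> exists c, cder h (Complex x y) c) ->
  J x1 x2 y1 y2 = 0.
Proof.
move=> x12 y12 dh.
have ch x y : x1 <= x <= x2 -> y1 <= y <= y2 -> {for (Complex x y : C), continuous h}.
  by move=> xx yy; have [c /cder_continuous] := dh _ _ xx yy.
have cH y : y1 <= y <= y2 -> {within `[x1, x2], continuous (fun s => complex.Im (h (Complex s y)))}.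
  move=> yy; apply/continuous_in_subspaceT => s; rewrite inE/= in_itv/= => ss.
  apply: (@continuous_comp _ _ _ (fun s => h (Complex s y)) (@complex.Im R : C -> R)); last exact: Im_continuous.
  apply: (@continuous_comp _ _ _ (fun s => Complex s y : C) h); last exact: ch.
  exact: horizontal_continuous.
have cV x : x1 <= x <= x2 -> {within `[y1, y2], continuous (fun t => complex.Re (h (Complex x t)))}.
  move=> xx; apply/continuous_in_subspaceT => t; rewrite inE/= in_itv/= => tt.
  apply: (@continuous_comp _ _ _ (fun s => h (Complex x s)) (@complex.Re R : C -> R)); last exact: Re_continuous.
  apply: (@continuous_comp _ _ _ (fun s => Complex x s : C) h); last exact: ch.
  exact: vertical_continuous.
apply/eqP/negPn/negP => J0.
pose j := `|J x1 x2 y1 y2|.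
have j0 : 0 < j by rewrite normr_gt0.
pose w := x2 - x1; pose l := y2 - y1.
have w0 : 0 <= w by rewrite subr_ge0.
have l0 : 0 <= l by rewrite subr_ge0.
(* The [+ 1] makes the bound in [B] strict on the initial rectangle and keeps the denominator
   nonzero for a degenerate one. *)
pose e := j / (w + l + 1) ^+ 2.
have s0 : 0 < (w + l + 1) ^+ 2 by rewrite exprn_gt0//; lra.
have e0 : 0 < e by rewrite divr_gt0.
(* The squared half perimeter drops to a quarter under halving, and [J] is the sum over the four
   quarters, so one quarter inherits the bound. *)
pose B x y w' l' := [/\ x1 <= x, x + w' <= x2, y1 <= y, y + l' <= y2 &
  e * (w' + l') ^+ 2 < `|J x (x + w') y (y + l')|].
have [||c1 [c2 [c1P c2P HB]]] := @rectangle_bisection B x1 y1 w l w0 l0.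
- move=> x y w' l' w'0 l'0 [a1 a2 a3 a4 HJ].
  apply: contrapT => Hn.
  have {}Hn (i k : bool) :
     `|J (x + i%:R * (w' / 2)) (x + i%:R * (w' / 2) + w' / 2) (y + k%:R * (l' / 2)) (y + k%:R * (l' / 2) + l' / 2)|
     <= e * ((w' + l') ^+ 2 / 4).
    rewrite leNgt; apply/negP => Hik; apply: Hn; exists i, k; split; rewrite -?addrA.
    + by clear -a1 a2 a3 a4 w'0 l'0; case: (i) => /=; rewrite ?mul1r ?mul0r; lra.
    + by clear -a1 a2 a3 a4 w'0 l'0; case: (i) => /=; rewrite ?mul1r ?mul0r; lra.
    + by clear -a1 a2 a3 a4 w'0 l'0; case: (k) => /=; rewrite ?mul1r ?mul0r; lra.
    + by clear -a1 a2 a3 a4 w'0 l'0; case: (k) => /=; rewrite ?mul1r ?mul0r; lra.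
    + rewrite !addrA; apply: le_lt_trans Hik; rewrite -mulrDl exprMn.
      by rewrite exprVn -natrX.
  have := Hn false false; have := Hn false true; have := Hn true false; have := Hn true true.
  rewrite /= !mul0r !mul1r !addr0.
  have -> : x + w' / 2 + w' / 2 = x + w' by lra.
  have -> : y + l' / 2 + l' / 2 = y + l' by lra.
  move=> n1 n2 n3 n4.
  have sH y' : y1 <= y' <= y2 -> H x (x + w') y' = H x (x + w' / 2) y' + H (x + w' / 2) (x + w') y'.
    move=> y'P; apply: iint_split; [clear -w'0; lra|clear -w'0; lra|].
    exact: within_itvS a1 a2 (cH _ y'P).
  have sV x' : x1 <= x' <= x2 -> V y (y + l') x' = V y (y + l' / 2) x' + V (y + l' / 2) (y + l') x'.
    move=> x'P; apply: iint_split; [clear -l'0; lra|clear -l'0; lra|].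
    exact: within_itvS a3 a4 (cV _ x'P).
  have : `|J x (x + w') y (y + l')| <= e * (w' + l') ^+ 2.
    rewrite sH; last by clear -a3 a4 l'0; lra.
    rewrite sH; last by clear -a3 a4 l'0; lra.
    rewrite sV; last by clear -a1 a2 w'0; lra.
    rewrite sV; last by clear -a1 a2 w'0; lra.
    move: n1 n2 n3 n4; rewrite mulrA.
    set A := e * _ ^+ 2; move=> n1 n2 n3 n4.
    set S := (X in `|X|).
    have -> : S = (H x (x + w' / 2) y + V y (y + l' / 2) (x + w' / 2) -
        H x (x + w' / 2) (y + l' / 2) - V y (y + l' / 2) x) +
      (H x (x + w' / 2) (y + l' / 2) + V (y + l' / 2) (y + l') (x + w' / 2) -
        H x (x + w' / 2) (y + l') - V (y + l' / 2) (y + l') x) +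
      (H (x + w' / 2) (x + w') y + V y (y + l' / 2) (x + w') -
        H (x + w' / 2) (x + w') (y + l' / 2) - V y (y + l' / 2) (x + w' / 2)) +
      (H (x + w' / 2) (x + w') (y + l' / 2) + V (y + l' / 2) (y + l') (x + w') -
        H (x + w' / 2) (x + w') (y + l') - V (y + l' / 2) (y + l') (x + w' / 2)).
      by rewrite /S; ring.
    apply: le_trans (ler_normD _ _) _; apply: le_trans (lerD (ler_normD _ _) n1) _.
    apply: le_trans (lerD (lerD (ler_normD _ _) n2) (lexx _)) _.
    apply: le_trans (lerD (lerD (lerD n4 n3) (lexx _)) (lexx _)) _.
    by clear; lra.
  by rewrite leNgt HJ.
- split; rewrite ?lexx//; try (rewrite /w /l; lra).
  have -> : x1 + w = x2 by rewrite /w; lra.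
  have -> : y1 + l = y2 by rewrite /l; lra.
  rewrite -/j /e mulrAC ltr_pdivrMr// ltr_pM2l//.
  by rewrite ltr_sqr ?nnegrE; lra.
have [c1x c2y] : x1 <= c1 <= x2 /\ y1 <= c2 <= y2.
  by move: c1P c2P; rewrite /w /l; clear; lra.
have [c hc] := dh _ _ c1x c2y.
have e2 : 0 < e / 8 by lra.
have [d d0 Hd] := hc _ e2.
have d2 : 0 < d / 2 by lra.
have [x [y [n []]]] := HB _ d2.
set w' := w / _; set l' := l / _ => -[a1 a2 a3 a4 HJ] c1n c2n [w'd l'd].
have w'0 : 0 <= w' by rewrite divr_ge0// exprn_ge0.
have l'0 : 0 <= l' by rewrite divr_ge0// exprn_ge0.
pose h0 := h (Complex c1 c2).
have near s t : x <= s <= x + w' -> y <= t <= y + l' ->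
    modulus (h (Complex s t) - h0 - c * Complex (s - c1) (t - c2)) <= e / 8 * (w' + l').
  move=> sP tP.
  have m : modulus (Complex s t - Complex c1 c2 : C) <= w' + l'.
    apply: le_trans (modulus_le_ReIm _) _ => /=; apply: lerD; rewrite ler_norml.
      by clear -sP c1n; lra.
    by clear -tP c2n; lra.
  have := Hd (Complex s t); rewrite -/h0 => /(_ _)/le_trans; apply; first by clear -m w'd l'd; lra.
  by apply: ler_wpM2l => //; exact: ltW.
case: c {hc} Hd near => cr ci Hd near.
(* The affine part of [h] at the limit point contributes [- (l' * cr) * w'] through the horizontal
   sides and [w' * cr * l'] through the vertical ones. These cancel, and the errors sum to at most
   [e / 4 * (w' + l') ^ 2]. *)
have near1 s : x <= s <= x + w' ->
   `|(complex.Im (h (Complex s y)) - complex.Im (h (Complex s (y + l')))) - (- (l' * cr))| <= e / 8 * (w' + l') * 2.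
  move=> sP; have /(_ _)/(le_trans (Im_le_modulus _)) := near s y sP.
  have /(_ _)/(le_trans (Im_le_modulus _)) := near s (y + l') sP.
  move: (h (Complex s y)) (h (Complex s (y + l'))) (h0) => [? ?] [? ?] [? ?] /=.
  rewrite !ler_norml => /(_ _)/andP A1 /(_ _)/andP A2.
  have [|q1 q2] := A1; first by clear -l'0; lra.
  have [|q3 q4] := A2; first by clear -l'0; lra.
  by clear -q1 q2 q3 q4; apply/andP; split; lra.
have near2 t : y <= t <= y + l' ->
   `|(complex.Re (h (Complex (x + w') t)) - complex.Re (h (Complex x t))) - (w' * cr)| <= e / 8 * (w' + l') * 2.
  move=> tP; have /(_ _ tP)/(le_trans (Re_le_modulus _)) := near x t.
  have /(_ _ tP)/(le_trans (Re_le_modulus _)) := near (x + w') t.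
  move: (h (Complex x t)) (h (Complex (x + w') t)) (h0) => [? ?] [? ?] [? ?] /=.
  rewrite !ler_norml => /(_ _)/andP A1 /(_ _)/andP A2.
  have [|q1 q2] := A1; first by clear -w'0; lra.
  have [|q3 q4] := A2; first by clear -w'0; lra.
  by clear -q1 q2 q3 q4; apply/andP; split; lra.
have cH' y' : y1 <= y' <= y2 -> {within `[x, x + w'], continuous (fun s => complex.Im (h (Complex s y')))}.
  by move=> /cH; exact: within_itvS.
have cV' x' : x1 <= x' <= x2 -> {within `[y, y + l'], continuous (fun t => complex.Re (h (Complex x' t)))}.
  by move=> /cV; exact: within_itvS.
have := @iint_near_cst _ x (x + w') (fun s => complex.Im (h (Complex s y)) - complex.Im (h (Complex s (y + l')))) _ _ _ _ near1.
have := @iint_near_cst _ y (y + l') (fun t => complex.Re (h (Complex (x + w') t)) - complex.Re (h (Complex x t))) _ _ _ _ near2.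
have cD (a b : R) (f g : R -> R) : {within `[a, b], continuous f} -> {within `[a, b], continuous g} ->
   {within `[a, b], continuous (fun t => f t - g t)}.
  by move=> cf cg z; apply: continuousB; [exact: cf|exact: cg].
have x'1 : x1 <= x <= x2 by clear -a1 a2 w'0; lra.
have x'2 : x1 <= x + w' <= x2 by clear -a1 a2 w'0; lra.
have y'1 : y1 <= y <= y2 by clear -a3 a4 l'0; lra.
have y'2 : y1 <= y + l' <= y2 by clear -a3 a4 l'0; lra.
rewrite iintB; [|exact: cV'|exact: cV'].
rewrite iintB; [|exact: cH'|exact: cH'].
have -> : y + l' - y = l' by rewrite addrAC subrr add0r.
have -> : x + w' - x = w' by rewrite addrAC subrr add0r.
rewrite !lerDl => B1 B2.
have {}B1 : `|V y (y + l') (x + w') - V y (y + l') x - w' * cr * l'| <= e / 8 * (w' + l') * 2 * l'.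
  by apply: B1 => //; apply: cD; exact: cV'.
have {}B2 : `|H x (x + w') y - H x (x + w') (y + l') - - (l' * cr) * w'| <= e / 8 * (w' + l') * 2 * w'.
  by apply: B2 => //; apply: cD; exact: cH'.
have : `|J x (x + w') y (y + l')| <= e * (w' + l') ^+ 2.
  move: B1 B2; move: (H _ _ _) (H _ _ _) (V _ _ _) (V _ _ _) => A1 A2 A3 A4.
  have E0 : 0 <= e * (w' + l') ^+ 2 by rewrite mulr_ge0 ?sqr_ge0// ltW.
  rewrite !ler_norml => /andP[b1 b2] /andP[b3 b4].
  by clear -E0 b1 b2 b3 b4; apply/andP; split; lra.
by rewrite leNgt HJ.
Qed.

End goursat.

(** * The complex exponential and points on circles *)

Section polar.
Context {R : realType}.
Local Notation C := (R[i]^o).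
Implicit Types (a z w : C) (f : C -> C) (r s t : R).

Lemma real_derive_dist (g : R -> R) s l : is_derive s 1 g l ->
  forall e : R, 0 < e -> exists2 d : R, 0 < d & forall x, `|x - s| < d ->
    `|g x - g s - l * (x - s)| <= e * `|x - s|.
Proof.
move=> [gd <-] e e0.
have gl : (h^-1 *: (g (h *: (1 : R) + s) - g s) @[h --> (0 : R)^'] --> 'D_1 g s) by exact: gd.
move/cvgrPdist_lt : gl => /(_ _ e0)/nbhs_ballP[d /= d0 H].
exists d => // x xd.
have [->|xs] := eqVneq x s; first by rewrite !subrr mulr0 subr0 normr0 mulr0.
have := H (x - s); rewrite /ball/= sub0r normrN => /(_ xd).
rewrite subr_eq0 => /(_ xs).
rewrite /GRing.scale/= mulr1 subrK => {}H.
have h0 : 0 < `|x - s| by rewrite normr_gt0 subr_eq0.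
move: H; rewrite distrC -(ltr_pM2r h0) -normrM mulrBl mulrAC mulVf ?subr_eq0// mul1r.
exact: ltW.
Qed.

Definition cexp z : C := Complex (expR (complex.Re z) * cos (complex.Im z))
  (expR (complex.Re z) * sin (complex.Im z)).

Lemma cexpD z w : cexp (z + w) = cexp z * cexp w.
Proof.
case: z w => [a b] [c d]; rewrite /cexp/= expRD cosD sinD.
by apply/eqP; rewrite eq_complex /=; apply/andP; split; apply/eqP; ring.
Qed.

Lemma cder_cexp0 : cder cexp 0 1.
Proof.
move=> e e0.
have e4 : 0 < Num.min (e / 8) 1 by rewrite lt_min; lra.
have [d1 d10 H1] := real_derive_dist (is_derive_expR (0 : R)) e4.
have [d2 d20 H2] := real_derive_dist (is_derive_cos (0 : R)) e4.
have [d3 d30 H3] := real_derive_dist (is_derive_sin (0 : R)) e4.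
exists (Num.min (Num.min d1 d2) (Num.min d3 (Num.min (e / 16) (1 / 4)))).
  by rewrite !lt_min d10 d20 d30/=; lra.
move=> [x y]; rewrite subr0 mul1r !lt_min => /and3P[/andP[m1 m2] m3 /andP[m4 m5]].
have := Re_le_modulus (Complex x y : C); have := Im_le_modulus (Complex x y : C); rewrite /= => my mx.
have {}H1 := H1 x; have {}H2 := H2 y; have {}H3 := H3 y.
rewrite subr0 in H1; rewrite subr0 in H2; rewrite subr0 in H3.
have {}H1 := H1 (le_lt_trans mx m1); have {}H2 := H2 (le_lt_trans my m2).
have {}H3 := H3 (le_lt_trans my m3).
rewrite expR0 mul1r in H1; rewrite cos0 sin0 oppr0 mul0r subr0 in H2.
rewrite cos0 sin0 mul1r subr0 in H3.
move: H1 H2 H3; set m := modulus _ in m1 m2 m3 m4 m5 mx my *.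
have m0 : 0 <= m by exact: modulus_ge0.
set k := Num.min _ _ => H1 H2 H3.
have k0 : 0 < k by [].
have k1 : k <= 1 by rewrite ge_min lexx orbT.
have ke : k <= e / 8 by rewrite ge_min lexx.
have {}H1 : `|expR x - 1 - x| <= k * m by apply: le_trans H1 _; rewrite ler_wpM2l// ltW.
have {}H2 : `|cos y - 1| <= k * m by apply: le_trans H2 _; rewrite ler_wpM2l// ltW.
have {}H3 : `|sin y - y| <= k * m by apply: le_trans H3 _; rewrite ler_wpM2l// ltW.
apply: le_trans (modulus_le_ReIm _) _; rewrite /= expR0 cos0 sin0 mulr1 mulr0 subr0.
have cy : `|cos y| <= 1 by rewrite ler_norml cos_geN1 cos_le1.
have km : k * m <= e / 8 * m by rewrite ler_wpM2r.
have km1 : k * m <= m by rewrite ler_piMl.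
have x1 : `|expR x - 1| <= 2 * m.
  have -> : expR x - 1 = (expR x - 1 - x) + x by lra.
  by apply: le_trans (ler_normD _ _) _; lra.
rewrite !mul1r !mul0r subr0 addr0.
have -> : expR x * cos y - 1 - x = (expR x - 1 - x) * cos y + (x * (cos y - 1) + (cos y - 1)) by ring.
have -> : expR x * sin y - y = (expR x - 1) * (sin y - y) + ((expR x - 1) * y + (sin y - y)) by ring.
have p1 : `|(expR x - 1 - x) * cos y| <= k * m.
  by rewrite normrM -[leRHS]mulr1 ler_pM.
have p2 : `|x * (cos y - 1)| <= k * m.
  by rewrite normrM -[leRHS]mul1r ler_pM// (le_trans mx)//; lra.
have p3 : `|(expR x - 1) * (sin y - y)| <= k * m.
  by rewrite normrM -[leRHS]mul1r ler_pM// (le_trans x1)//; lra.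
have p4 : `|(expR x - 1) * y| <= e / 8 * m.
  rewrite normrM; apply: le_trans (ler_pM _ _ x1 my) _ => //.
  by rewrite ler_wpM2r//; lra.
have q1 := ler_normD ((expR x - 1 - x) * cos y) (x * (cos y - 1) + (cos y - 1)).
have q2 := ler_normD (x * (cos y - 1)) (cos y - 1).
have q3 := ler_normD ((expR x - 1) * (sin y - y)) ((expR x - 1) * y + (sin y - y)).
have q4 := ler_normD ((expR x - 1) * y) (sin y - y).
have em := mulr_ge0 (ltW e0) m0.
clear -q1 q2 q3 q4 p1 p2 p3 p4 H1 H2 H3 km em; lra.
Qed.

Lemma cder_cexp z : cder cexp z (cexp z).
Proof.
have H : cder (fun w => cexp z * cexp (w - z)) z (cexp z * (1 * (1 - 0)) + cexp (z - z) * 0).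
  apply: cderM; first exact: cder_cst.
  apply: (@cder_comp _ (fun w => w - z) cexp z (1 - 0) 1).
    by apply: cderB; [exact: cder_id|exact: cder_cst].
  by rewrite subrr; exact: cder_cexp0.
rewrite subr0 mulr1 mulr1 mulr0 addr0 in H.
apply: (cder_near ltr01) H => w _.
by rewrite -cexpD addrC subrK.
Qed.

Lemma cexp_circle s t : cexp (Complex s t) = circle_point (expR s) t.
Proof. by []. Qed.

Lemma circle_point0 t : circle_point 0 t = 0 :> C.
Proof. by rewrite /circle_point !mul0r. Qed.

Lemma modulus_circle r t : modulus (circle_point r t : C) = `|r|.
Proof.
apply/eqP; rewrite -(eqrXn2 (n := 2))// ?modulus_ge0//; apply/eqP.
by rewrite modulus_sqr /= !exprMn -mulrDr cos2Dsin2 mulr1 real_normK ?num_real.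
Qed.

Lemma circle_point2pi r : circle_point r (2 * pi) = circle_point r 0 :> C.
Proof. by rewrite /circle_point mulr_natl cos2pi sin2pi cos0 sin0. Qed.

Lemma circle_pointD2pi r t : circle_point r (t + 2 * pi) = circle_point r t :> C.
Proof. by rewrite /circle_point mulr_natl cosD2pi sinD2pi. Qed.

Lemma circle_pointM r s t t' : circle_point r t * circle_point s t' = circle_point (r * s) (t + t') :> C.
Proof.
rewrite /circle_point cosD sinD; apply/eqP; rewrite eq_complex /=.
by apply/andP; split; apply/eqP; ring.
Qed.

Lemma circle_pointZ r s t : (s%:C%C : C) * circle_point r t = circle_point (s * r) t.
Proof.
rewrite /circle_point; apply/eqP; rewrite eq_complex /=.
by apply/andP; split; apply/eqP; ring.
Qed.

Lemma circle_continuous r t : {for t, continuous (circle_point r : R -> C)}.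
Proof.
have -> : circle_point r = (fun w => r%:C%C * cexp w) \o (fun t => Complex 0 t : C).
  by apply/funext => u; rewrite /= cexp_circle expR0 circle_pointZ mulr1.
apply: continuous_comp; first exact: vertical_continuous.
exact: (cder_continuous (cderM (cder_cst _ _) (cder_cexp _))).
Qed.

End polar.

(** * Circle averages: mean value property and Cauchy's estimate *)

Section circle_average.
Context {R : realType}.
Local Notation C := (R[i]^o).
Implicit Types (a z w c : C) (f : C -> C) (u v : C -> R) (r s t : R).

Definition cavg u a r := (2 * pi)^-1 * iint 0 (2 * pi) (fun t => u (a + circle_point r t)).

Definition circle_cts u a r := forall z, modulus (z - a) = `|r| -> {for z, continuous u}.

Lemma pi2_gt0 : 0 < 2 * pi :> R.
Proof. by rewrite mulr_gt0// pi_gt0. Qed.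

Lemma circle_cts_continuous u a r : circle_cts u a r ->
  continuous (fun t => u (a + circle_point r t)).
Proof.
move=> cu t; apply: (@continuous_comp _ _ _ (fun t => a + circle_point r t : C) u).
  have := @circle_continuous R r t; move=> ct.
  by apply: cvgD; [exact: cvg_cst|exact: ct].
by apply: cu; rewrite addrAC subrr add0r modulus_circle.
Qed.

Lemma circle_cts_within u a r : circle_cts u a r ->
  {within `[0, 2 * pi], continuous (fun t => u (a + circle_point r t))}.
Proof. by move=> cu; apply: continuous_subspaceT; exact: circle_cts_continuous. Qed.

Lemma cavg_le u v a r : circle_cts u a r -> circle_cts v a r ->
  (forall z, modulus (z - a) = `|r| -> u z <= v z) -> cavg u a r <= cavg v a r.
Proof.
move=> cu cv uv; rewrite ler_pM2l ?invr_gt0 ?pi2_gt0//.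
apply: iint_le => [||t _]; try exact: circle_cts_within.
by apply: uv; rewrite addrAC subrr add0r modulus_circle.
Qed.

Lemma eq_cavg u v a r : (forall z, modulus (z - a) = `|r| -> u z = v z) ->
  cavg u a r = cavg v a r.
Proof.
move=> uv; rewrite /cavg; congr (_ * _); apply: eq_iint => t _.
by apply: uv; rewrite addrAC subrr add0r modulus_circle.
Qed.

Lemma cavg_cst k a r : cavg (fun=> k) a r = k.
Proof.
rewrite /cavg iint_cst ?ltW ?pi2_gt0// subr0 mulrCA mulVf ?mulr1//.
by rewrite gt_eqF// pi2_gt0.
Qed.

Lemma cavgD u v a r : circle_cts u a r -> circle_cts v a r ->
  cavg (fun z => u z + v z) a r = cavg u a r + cavg v a r.
Proof. by move=> cu cv; rewrite /cavg (iintD (circle_cts_within cu) (circle_cts_within cv)) mulrDr. Qed.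

Lemma cavgB u v a r : circle_cts u a r -> circle_cts v a r ->
  cavg (fun z => u z - v z) a r = cavg u a r - cavg v a r.
Proof. by move=> cu cv; rewrite /cavg (iintB (circle_cts_within cu) (circle_cts_within cv)) mulrBr. Qed.

Lemma cavgZ k u a r : circle_cts u a r ->
  cavg (fun z => k * u z) a r = k * cavg u a r.
Proof. by move=> cu; rewrite /cavg (iintZ k (circle_cts_within cu)) mulrCA. Qed.

Lemma circle_cts_cst k a r : circle_cts (fun=> k) a r.
Proof. by move=> z _; exact: (@cst_continuous C R k z). Qed.

Lemma cavg_ge0 u a r : circle_cts u a r -> (forall z, modulus (z - a) = `|r| -> 0 <= u z) ->
  0 <= cavg u a r.
Proof.
by move=> cu u0; rewrite -(cavg_cst 0 a r); apply: cavg_le => //; exact: circle_cts_cst.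
Qed.

Lemma cavg_r0 u a : cavg u a 0 = u a.
Proof.
rewrite -[RHS](cavg_cst (u a) a 0); apply: eq_cavg => z.
by rewrite normr0 => /eqP; rewrite modulus_eq0 subr_eq0 => /eqP ->.
Qed.

Lemma cavg_near u a r k (e : R) : circle_cts u a r ->
  (forall z, modulus (z - a) = `|r| -> `|u z - k| <= e) -> `|cavg u a r - k| <= e.
Proof.
move=> cu H.
have A : cavg (fun=> k - e) a r <= cavg u a r.
  apply: cavg_le => //; first exact: circle_cts_cst.
  by move=> z /H; rewrite ler_norml => /andP[]; lra.
have B : cavg u a r <= cavg (fun=> k + e) a r.
  apply: cavg_le => //; first exact: circle_cts_cst.
  by move=> z /H; rewrite ler_norml => /andP[]; lra.
by move: A B; rewrite !cavg_cst ler_norml => ? ?; apply/andP; split; lra.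
Qed.

(** The substitution [z = a + cexp w] turns the annulus into a rectangle of height [2 * pi]. Its
    horizontal sides cancel by periodicity, so Goursat's theorem equates the vertical ones, which
    are the two circle averages. *)
Lemma polar_const f a (r0 r1 : R) : 0 < r0 -> r0 <= r1 ->
  (forall z, r0 <= modulus (z - a) <= r1 -> exists c, cder f z c) ->
  cavg (fun z => complex.Re (f z)) a r0 = cavg (fun z => complex.Re (f z)) a r1.
Proof.
move=> r00 r01 df; have r10 : 0 < r1 by apply: lt_le_trans r01.
have dh x y : ln r0 <= x <= ln r1 -> 0 <= y <= 2 * pi ->
    exists c, cder (fun z => f (a + cexp z)) (Complex x y) c.
  move=> /andP[x1 x2] _.
  have xr : r0 <= expR x <= r1.
    by rewrite -ler_ln ?posrE ?expR_gt0// expRK x1 -ler_ln ?posrE ?expR_gt0// expRK.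
  have [c fc] : exists c, cder f (a + cexp (Complex x y)) c.
    apply: df; rewrite addrAC subrr add0r cexp_circle modulus_circle ger0_norm//; exact: expR_ge0.
  exists (c * (0 + cexp (Complex x y))).
  apply: (cder_comp (f := fun z => a + cexp z)) fc.
  by apply: cderD; [exact: cder_cst|exact: cder_cexp].
have := goursat _ (ltW pi2_gt0) dh; rewrite ler_ln ?posrE// => /(_ r01).
have -> : iint (ln r0) (ln r1) (fun s => complex.Im (f (a + cexp (Complex s (2 * pi))))) =
    iint (ln r0) (ln r1) (fun s => complex.Im (f (a + cexp (Complex s 0)))).
  by apply: eq_iint => s _; rewrite !cexp_circle circle_point2pi.
have E (r : R) : 0 < r -> iint 0 (2 * pi) (fun t => complex.Re (f (a + cexp (Complex (ln r) t)))) =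
    iint 0 (2 * pi) (fun t => complex.Re (f (a + circle_point r t))).
  by move=> r0'; apply: eq_iint => t _; rewrite cexp_circle lnK.
rewrite !E// => H; rewrite /cavg; congr (_ * _).
by move: H; set A := iint _ (ln r1) _; move: (iint _ _ _) (iint _ _ _) A => x y A; lra.
Qed.

(** The inner radius in [polar_const] is shrunk to [0]. At the centre only continuity is asked, so
    that the result covers difference quotients at [a]. *)
Lemma mean_value f a r : 0 <= r -> {for a, continuous f} ->
  (forall z, 0 < modulus (z - a) <= r -> exists c, cder f z c) ->
  cavg (fun z => complex.Re (f z)) a r = complex.Re (f a).
Proof.
rewrite le_eqVlt => /orP[/eqP <- _ _|r0 cf df]; first by rewrite cavg_r0.
apply/eqP; rewrite -subr_eq0 -normr_le0; apply/ler_addgt0Pl => e e0; rewrite addr0.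
have [d d0 H] := (continuous_modulusP f a).1 cf _ e0.
pose s := Num.min r (d / 2).
have s0 : 0 < s by rewrite lt_min r0; lra.
have sr : s <= r by rewrite ge_min lexx.
have sd : s < d by rewrite gt_min; apply/orP; right; lra.
rewrite -(@polar_const f a s r s0 sr); last first.
  by move=> z /andP[sz zr]; apply: df; rewrite zr (lt_le_trans s0).
apply: cavg_near => z.
  rewrite (gtr0_norm s0) => zs.
  have [|c /cder_continuous cz] := df z; first by rewrite zs s0.
  exact: (continuous_comp cz (@Re_continuous _ _)).
rewrite (gtr0_norm s0) => zs; have := H z; rewrite zs => /(_ sd) /ltW; apply: le_trans.
by apply: le_trans (Re_le_modulus _); case: (f z) (f a) => ? ? [].
Qed.

Lemma Re_conjM z : complex.Re ((conjc z : C) * z) = modulus z ^+ 2.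
Proof. by rewrite modulus_sqr; case: z => a b /=; ring. Qed.

Lemma modulus_conj z : modulus (conjc z : C) = modulus z.
Proof. by rewrite !modulusE; case: z => a b /=; rewrite sqrrN. Qed.

Lemma ReM_le z w : complex.Re (z * w) <= modulus z * modulus w.
Proof. by apply: le_trans (ler_norm _) _; rewrite -modulusM; exact: Re_le_modulus. Qed.

Lemma continuous_ReM f z c : {for z, continuous f} -> {for z, continuous (fun w => complex.Re (c * f w))}.
Proof.
move=> cf; apply/cvgCR_distP => e e0.
have m0 := modulus_ge0 c.
have e1 : 0 < e / (modulus c + 1) by rewrite divr_gt0//; lra.
have [d d0 H] := (continuous_modulusP f z).1 cf _ e1.
exists d => // w /H; rewrite ltr_pdivlMr; last lra.
move=> {}H; have := Re_le_modulus (c * (f w - f z)); rewrite modulusM mulrBr.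
case: (c * f w) (c * f z) => ? ? [? ?] /= K; apply: le_lt_trans K _.
by have := modulus_ge0 (f w - f z); nra.
Qed.

Lemma continuous_cstM f z c : {for z, continuous f} -> {for z, continuous (fun w => c * f w)}.
Proof.
move=> cf; apply/continuous_modulusP => e e0.
have m0 := modulus_ge0 c.
have e1 : 0 < e / (modulus c + 1) by rewrite divr_gt0//; lra.
have [d d0 H] := (continuous_modulusP f z).1 cf _ e1.
exists d => // w /H; rewrite ltr_pdivlMr; last lra.
by rewrite -mulrBr modulusM; have := modulus_ge0 (f w - f z); nra.
Qed.

Lemma continuous_cstMr u z (k : R) : {for z, continuous u} -> {for z, continuous (fun w => k * u w)}.
Proof.
move=> /cvgCR_distP cu; apply/cvgCR_distP => e e0.
have k0 : 0 < `|k| + 1 by have := normr_ge0 k; lra.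
have [d d0 H] := cu _ (divr_gt0 e0 k0); exists d => // w /H.
by rewrite ltr_pdivlMr// -mulrBr normrM; have := normr_ge0 (u w - u z); nra.
Qed.

(** Multiplying by [conjc (f a)] makes the value at the centre the real number [|f a| ^ 2]; the mean
    value property of the real part then gives the bound. *)
Lemma modulus_submean f a r : 0 <= r -> {for a, continuous f} ->
  (forall z, 0 < modulus (z - a) <= r -> exists c, cder f z c) ->
  modulus (f a) <= cavg (fun z => modulus (f z)) a r.
Proof.
rewrite le_eqVlt => /orP[/eqP <- _ _|r0 cf df]; first by rewrite cavg_r0.
have cfz z : modulus (z - a) = `|r| -> {for z, continuous f}.
  rewrite (gtr0_norm r0) => zr; have [|c /cder_continuous //] := df z; by rewrite zr r0 lexx.
have cm : circle_cts (fun z => modulus (f z)) a r.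
  by move=> z /cfz cz; exact: (continuous_comp cz (@modulus_continuous _ _)).
have [->|fa0] := eqVneq (f a) 0.
  by rewrite modulus0; apply: cavg_ge0 => // z _; exact: modulus_ge0.
have m0 : 0 < modulus (f a) by rewrite modulus_gt0.
have H : cavg (fun z => complex.Re ((conjc (f a) : C) * f z)) a r = modulus (f a) ^+ 2.
  rewrite -Re_conjM; apply: (@mean_value (fun z => (conjc (f a) : C) * f z)).
  - exact: ltW.
  - exact: continuous_cstM.
  - by move=> z /df[c fc]; eexists; apply: cderM; [exact: cder_cst|exact: fc].
rewrite -(ler_pM2l m0) -expr2 -H -cavgZ//; apply: cavg_le.
- by move=> z /cfz; exact: continuous_ReM.
- by move=> z /cm; exact: continuous_cstMr.
- by move=> z _; apply: le_trans (ReM_le _ _) _; rewrite modulus_conj.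
Qed.

(** The difference quotient at [a], completed by the value [c], is continuous at [a] and
    differentiable elsewhere, so its value at [a] is at most its mean over the circle. The factor
    [2] comes from [|f w - f a| <= 2 * K]. *)
Lemma cauchy_estimate f a c r K : 0 < r -> cder f a c ->
  (forall z, modulus (z - a) <= r -> exists c, cder f z c) ->
  (forall z, modulus (z - a) <= r -> modulus (f z) <= K) -> modulus c <= 2 * K / r.
Proof.
move=> r0 fc df fK.
pose k (w : C) : C := if w == a then c else (f w - f a) * (w - a)^-1.
have dk z : 0 < modulus (z - a) <= r -> exists c, cder k z c.
  move=> /andP[za zr]; have [c' fc'] := df _ zr.
  have za0 : z - a != 0 by rewrite -modulus_gt0.
  have : derivable (fun w : C => (w - a)^-1) z 1.
    exact: derivableV.
  move=> /cderP[c2 kc2].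
  exists ((f z - f a) * c2 + (z - a)^-1 * (c' - 0)).
  apply: (cder_near za) (cderM (cderB fc' (cder_cst _ _)) kc2) => w.
  rewrite /k; case: eqP => // ->; by rewrite modulusBC ltxx.
have ck : {for a, continuous k}.
  apply/continuous_modulusP => e e0.
  have e2 : 0 < e / 2 by lra.
  have [d d0 H] := fc _ e2; exists d => // w /H {}H.
  rewrite /k eqxx; case: eqVneq => [_|wa]; first by rewrite subrr modulus0.
  have m0 : 0 < modulus (w - a) by rewrite modulus_gt0 subr_eq0.
  rewrite -(ltr_pM2r m0) -modulusM mulrBl mulfVK ?subr_eq0//.
  by apply: le_lt_trans H _; rewrite ltr_pM2r//; lra.
have := modulus_submean (ltW r0) ck dk; rewrite {1}/k eqxx => /le_trans; apply.
have K0 : 0 <= K by apply: le_trans (fK a _); rewrite ?modulus_ge0// subrr modulus0 ltW.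
rewrite -[leRHS](cavg_cst _ a r); apply: cavg_le; [|exact: circle_cts_cst|].
  move=> z; rewrite (gtr0_norm r0) => zr.
  have [|c' /cder_continuous cz] := dk z; first by rewrite zr r0 lexx.
  exact: (continuous_comp cz (@modulus_continuous _ _)).
move=> z; rewrite (gtr0_norm r0) => zr; rewrite /k; case: eqP => [za|/eqP za].
  by move: zr; rewrite za subrr modulus0 => E; move: r0; rewrite -E ltxx.
rewrite modulusM modulusV zr ler_pM2r ?invr_gt0//.
apply: le_trans (modulusB _ _) _.
have := fK z; rewrite zr => /(_ (lexx _)); have := fK a; rewrite subrr modulus0 => /(_ (ltW r0)).
lra.
Qed.

End circle_average.

(** * Rotation of integrals, polar form, uniform continuity *)

Section subharmonic.
Context {R : realType}.
Local Notation C := (R[i]^o).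
Implicit Types (a z w c : C) (f : C -> C) (u v : C -> R) (r s t : R).

Lemma iint_shift (h : R -> R) (b s : R) : 0 <= b -> continuous h ->
  iint 0 b (fun t => h (t + s)) = iint s (b + s) h.
Proof.
move=> b0 ch; rewrite /iint /Rintegral; congr fine.
pose F := fun t : R => t + s.
have dF (x : R) : is_derive x 1 F 1.
  by apply: real_is_derive => e e0; exists 1 => // y _; rewrite /F mul1r opprD addrACA subrr addr0 subrr normr0 mulr_ge0// ltW.
have F1 : derive1 F = cst 1 by apply/funext => x; rewrite derive1E; have [_ ->] := dF x.
have cF : continuous F by move=> x; apply: cvgD; [exact: cvg_id|exact: cvg_cst].
have := @integration_by_substitution_increasing R F h 0 b b0.
rewrite F1 /F add0r -/F => ->.
- by apply: eq_integral => x _ /=; rewrite mulr1.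
- by move=> x y _ _ xy; rewrite ltrD2r.
- by move=> x _; exact: cst_continuous.
- exact: is_cvg_cst.
- exact: is_cvg_cst.
- split; first by move=> x _; have [] := dF x.
    apply: cvg_within_filter; exact: cF.
  apply: cvg_within_filter; exact: cF.
- exact: continuous_subspaceT.
Qed.

Lemma iint_periodic (h : R -> R) (s : R) : 0 <= s <= 2 * pi -> continuous h ->
  (forall t, h (t + 2 * pi) = h t) ->
  iint 0 (2 * pi) (fun t => h (t + s)) = iint 0 (2 * pi) h.
Proof.
move=> /andP[s0 s2] ch hp; have p0 := @pi2_gt0 R.
have cw (a b : R) : {within `[a, b], continuous h} by exact: continuous_subspaceT.
rewrite iint_shift ?ltW//.
rewrite (@iint_split _ s (2 * pi))//; last by rewrite lerDl.
rewrite [in RHS](@iint_split _ 0 s)// addrC; congr (_ + _).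
have := iint_shift (2 * pi) s0 ch; rewrite [s + _]addrC => <-.
by apply: eq_iint => t _; rewrite hp.
Qed.

Lemma polar_form z : exists2 t : R, 0 <= t <= 2 * pi & z = circle_point (modulus z) t.
Proof.
have [->|z0] := eqVneq z 0.
  by exists 0; rewrite ?lexx ?ltW ?pi2_gt0// modulus0 circle_point0.
have m0 : 0 < modulus z by rewrite modulus_gt0.
have mz := modulus_sqr z.
pose x := complex.Re z / modulus z; pose y := complex.Im z / modulus z.
have zE : z = Complex (modulus z * x) (modulus z * y).
  rewrite /x /y !mulrA ![modulus z * _]mulrC !mulfK ?gt_eqF//.
  by case: (z).
have xy : x ^+ 2 + y ^+ 2 = 1.
  by rewrite /x /y !exprMn -mulrDl -mz exprVn mulfV// expf_neq0// gt_eqF.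
have x1 : -1 <= x <= 1 by have := sqr_ge0 y; nra.
have x1' : x \in `[-1, 1] by rewrite in_itv.
have cx := acosK x1'.
have ax := acos_ge0 x1; have axp := acos_lepi x1.
have p0 := pi_gt0 R.
have sx : sin (acos x) = `|y|.
  rewrite sin_acos// -sqrtr_sqr; congr Num.sqrt; lra.
have [y0|y0] := leP 0 y.
  exists (acos x); first by lra.
  by rewrite {1}zE /circle_point cx sx ger0_norm.
exists (2 * pi - acos x); first by lra.
rewrite {1}zE /circle_point mulr_natl [pi *+ 2 - _]addrC cosD2pi sinD2pi cosN sinN.
by rewrite cx sx ltr0_norm// opprK.
Qed.

(** Only [z] is confined to [K]. The point [w] may lie outside, as [phi t z] does when it leaves a
    closed disk containing [z]. *)
Lemma unif_cts u (K : set C) : compact K -> (forall z, K z -> {for z, continuous u}) ->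
  forall e : R, 0 < e -> exists2 d : R, 0 < d &
    forall z w, K z -> modulus (w - z) < d -> `|u w - u z| < e.
Proof.
move=> /compact_near_coveringP cK cu e e0.
have e2 : 0 < e / 2 by lra.
pose P (d : R) z := forall w, modulus (w - z) < d -> `|u w - u z| < e.
have := cK R (0^'+) P _.
have -> : (forall x, K x -> \forall x' \near x & i \near 0^'+, P i x') =
  (forall x, K x -> \forall x' \near x & i \near (0 : R)^'+, P i x') by [].
case.
  move=> z Kz.
  have [d d0 H] := (cvgCR_distP u z (u z)).1 (cu _ Kz) _ e2.
  have d2 : 0 < d / 2 by lra.
  exists ([set w | modulus (w - z) < d / 2], [set x | x < d / 2]) => /=.
    split; first by apply/near_modulus; exists (d / 2).
    by near=> x; near: x; exact: nbhs_right_lt.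
  move=> [w i] /= [wz id2] w' w'w.
  have h1 := H w; have h2 := H w'.
  have T := modulusD (w' - w) (w - z); rewrite addrA subrK in T.
  have {}h1 := h1 (ltac:(lra)); have {}h2 := h2 (ltac:(lra)).
  have -> : u w' - u w = (u w' - u z) - (u w - u z) by lra.
  by apply: le_lt_trans (ler_normB _ _) _; lra.
move=> d /= d0 H; exists (d / 2); first by lra.
move=> z w Kz; apply: (H (d / 2)) => //=; rewrite ?sub0r ?normrN ?gtr0_norm; lra.
Unshelve. all: by end_near. Qed.

End subharmonic.

(** * Subharmonic functions: maximum principle and monotone circle means *)

Section subharmonic_functions.
Context {R : realType}.
Local Notation C := (R[i]^o).
Implicit Types (a z w c : C) (f : C -> C) (u v : C -> R) (r s t : R).

(** Convexity in tangent-line form. It is Young's inequality for [y] and [x ^ (P - 1)] with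
    exponents [P] and [P / (P - 1)]; [P = 1], which has no finite conjugate exponent, is
    separate. *)
Lemma powR_tangent (P x y : R) : 1 <= P -> 0 <= x -> 0 <= y ->
  x `^ P <= y `^ P + P * x `^ (P - 1) * (x - y).
Proof.
move=> P1 x0 y0.
have [->|P1'] := eqVneq P 1; first by rewrite subrr powRr0 !powRr1// !mul1r addrC subrK.
have {P1'} P1 : 1 < P by rewrite lt_neqAle eq_sym P1'.
have xx : x `^ (P - 1) * x = x `^ P.
  have [->|x0'] := eqVneq x 0; first by rewrite mulr0 powR0//; lra.
  have x1 : x `^ (P - 1) * x `^ 1 = x `^ P by rewrite -powRD ?x0' ?implybT// subrK.
  by rewrite -{2}(@powRr1 _ x).
have Pn0 : P != 0 by lra.
have := @conjugate_powR R y (x `^ (P - 1)) P (P / (P - 1)) y0 (powR_ge0 _ _).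
rewrite -powRrM mulrCA mulfV ?mulr1; last by lra.
have q0 : 0 < P / (P - 1) by rewrite divr_gt0//; lra.
have pq : P^-1 + (P / (P - 1))^-1 = 1 by rewrite invf_div; field; rewrite Pn0.
move=> /(_ ltac:(lra) q0 pq).
move: xx; set A := x `^ (P - 1); set X := x `^ P; set Y := y `^ P => xx.
rewrite invf_div => H.
have : P * (y * A) <= Y + X * (P - 1).
  have -> : Y + X * (P - 1) = P * (Y / P + X * ((P - 1) / P)) by field.
  by rewrite ler_pM2l//; lra.
have -> : P * A * (x - y) = P * (A * x) - P * (y * A) by ring.
rewrite xx; lra.
Qed.

Lemma powR_lip (P B x y : R) : 1 <= P -> 0 <= x <= B -> 0 <= y <= B ->
  `|x `^ P - y `^ P| <= P * B `^ (P - 1) * `|x - y|.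
Proof.
move=> P1 /andP[x0 xB] /andP[y0 yB].
have B0 : 0 <= B by lra.
have K1 (s t : R) : 0 <= t -> t <= s -> s <= B -> s `^ P - t `^ P <= P * B `^ (P - 1) * (s - t).
  move=> t0 ts sB; have := @powR_tangent P s t P1 (le_trans t0 ts) t0.
  have : s `^ (P - 1) <= B `^ (P - 1).
    by apply: ge0_ler_powR; rewrite ?nnegrE//; lra.
  move=> h1 h2; rewrite lerBlDl; apply: le_trans h2 _; rewrite lerD2l.
  by rewrite ler_wpM2r ?subr_ge0// ler_wpM2l//; lra.
have K2 (s t : R) : 0 <= t -> t <= s -> t `^ P <= s `^ P.
  by move=> t0 ts; apply: ge0_ler_powR; rewrite ?nnegrE//; lra.
have [xy|/ltW yx] := lerP x y.
  by rewrite distrC ger0_norm ?subr_ge0 ?K2//; exact: K1.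
by rewrite ger0_norm ?subr_ge0 ?K2//; exact: K1.
Qed.

Lemma continuous_powR u z (P : R) : 1 <= P -> (forall w, 0 <= u w) ->
  {for z, continuous u} -> {for z, continuous (fun w => u w `^ P)}.
Proof.
move=> P1 u0 /cvgCR_distP cu; apply/cvgCR_distP => e e0.
have [d1 d10 H1] := cu _ ltr01.
set K := P * (u z + 1) `^ (P - 1).
have K0 : 0 <= K by rewrite mulr_ge0 ?powR_ge0//; lra.
have eK : 0 < e / (K + 1) by rewrite divr_gt0//; lra.
have [d2 d20 H2] := cu _ eK.
exists (Num.min d1 d2); first by rewrite lt_min d10.
move=> w; rewrite lt_min => /andP[/H1 w1 /H2 w2].
have {}w1 : u w <= u z + 1 by move: w1; rewrite ltr_norml => /andP[]; lra.
apply: le_lt_trans (powR_lip P1 (B := u z + 1) _ _) _.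
- by rewrite u0 w1.
- by rewrite u0; lra.
rewrite -/K; move: w2; rewrite ltr_pdivlMr; last lra.
have := normr_ge0 (u w - u z); move: `|_| => q q0 qK; apply: le_lt_trans qK.
by rewrite mulrC ler_wpM2l//; lra.
Qed.

Lemma riemann_sum (h : R -> R) (n : nat) (b e : R) : 0 <= b -> continuous h ->
  (forall s t, 0 <= s -> `|s - t| <= b -> `|h s - h t| <= e) ->
  `|iint 0 (n%:R * b) h - b * \sum_(j < n) h (j%:R * b)| <= n%:R * b * e.
Proof.
move=> b0 ch H; have cw (x y : R) : {within `[x, y], continuous h} by exact: continuous_subspaceT.
elim: n => [|n ih].
  rewrite mul0r big_ord0 mulr0 subr0 mul0r.
  by rewrite /iint set_itv1 Rintegral_set1 normr0.
rewrite big_ord_recr /= -natr1 mulrDl mul1r (@iint_split _ 0 (n%:R * b))//; last 2 first.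
- by rewrite mulr_ge0.
- by rewrite lerDl.
rewrite mulrDr mulrDl opprD addrACA.
apply: le_trans (ler_normD _ _) _; apply: lerD => //.
have K := @iint_near_cst _ (n%:R * b) (n%:R * b + b) h (h (n%:R * b)) e.
rewrite lerDl addrAC subrr add0r in K.
rewrite [b * h _]mulrC [b * e]mulrC; apply: K => //.
move=> t /andP[t1 t2]; apply: H; first by apply: le_trans t1; rewrite mulr_ge0.
by rewrite ger0_norm ?subr_ge0//; lra.
Qed.

(** Only small circles are involved, with a bound on the radius that depends on the centre; large
    circles enter through the maximum principle. *)
Definition lsubmean u := forall a, modulus a < 1 -> exists2 d : R, 0 < d &
  forall s, 0 < s < d -> u a <= cavg u a s.

Definition disk_cts u := forall z, modulus z < 1 -> {for z, continuous u}.

Lemma disk_cts_circle u a : disk_cts u -> modulus a < 1 ->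
  forall s, 0 < s < 1 - modulus a -> circle_cts u a s.
Proof.
move=> cu a1 s /andP[s0 sa] z; rewrite gtr0_norm// => zs; apply: cu.
by have := modulusD (z - a) a; rewrite subrK; lra.
Qed.

Lemma disk_cts_circle0 u r : disk_cts u -> 0 <= r < 1 -> circle_cts u 0 r.
Proof. by move=> cu /andP[r0 r1] z; rewrite subr0 ger0_norm// => zr; apply: cu; rewrite zr. Qed.

Lemma disk_ctsD u v : disk_cts u -> disk_cts v -> disk_cts (fun z => u z + v z).
Proof.
move=> cu cv z z1; apply/cvgCR_distP => e e0.
have e2 : 0 < e / 2 by lra.
have [d1 d10 H1] := (cvgCR_distP _ _ _).1 (cu _ z1) _ e2.
have [d2 d20 H2] := (cvgCR_distP _ _ _).1 (cv _ z1) _ e2.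
exists (Num.min d1 d2); first by rewrite lt_min d10.
move=> w; rewrite lt_min => /andP[/H1 w1 /H2 w2].
by rewrite opprD addrACA; apply: le_lt_trans (ler_normD _ _) _; lra.
Qed.

Lemma disk_ctsZ k u : disk_cts u -> disk_cts (fun z => k * u z).
Proof. by move=> cu z /cu; exact: continuous_cstMr. Qed.

Lemma lsubmeanD u v : disk_cts u -> disk_cts v -> lsubmean u -> lsubmean v ->
  lsubmean (fun z => u z + v z).
Proof.
move=> cu cv mu mv a a1.
have [d1 d10 H1] := mu _ a1; have [d2 d20 H2] := mv _ a1.
exists (Num.min (1 - modulus a) (Num.min d1 d2)).
  by rewrite !lt_min d10 d20 subr_gt0 a1.
move=> s /andP[s0]; rewrite !lt_min => /and3P[sa s1 s2].
rewrite cavgD; try by apply: disk_cts_circle => //; rewrite s0.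
by apply: lerD; [apply: H1|apply: H2]; rewrite s0.
Qed.

Lemma lsubmeanZ k u : disk_cts u -> 0 <= k -> lsubmean u -> lsubmean (fun z => k * u z).
Proof.
move=> cu k0 mu a a1.
have [d1 d10 H1] := mu _ a1.
exists (Num.min (1 - modulus a) d1).
  by rewrite !lt_min d10 subr_gt0 a1.
move=> s /andP[s0]; rewrite !lt_min => /andP[sa s1].
rewrite cavgZ; last by apply: disk_cts_circle => //; rewrite s0.
by apply: ler_wpM2l => //; apply: H1; rewrite s0.
Qed.

(* Jensen's inequality, read off the tangent line at the mean. *)
Lemma lsubmean_powR u (P : R) : 1 <= P -> (forall z, 0 <= u z) -> disk_cts u -> lsubmean u ->
  lsubmean (fun z => u z `^ P).
Proof.
move=> P1 u0 cu mu a a1.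
have [d1 d10 H1] := mu _ a1.
exists (Num.min (1 - modulus a) d1).
  by rewrite !lt_min d10 subr_gt0 a1.
move=> s /andP[s0]; rewrite !lt_min => /andP[sa s1].
have su : circle_cts u a s by apply: disk_cts_circle => //; rewrite s0.
have {}H1 : u a <= cavg u a s by apply: H1; rewrite s0.
set m := cavg u a s in H1 *.
have m0 : 0 <= m by apply: le_trans H1.
apply: le_trans (_ : m `^ P <= _); first by apply: ge0_ler_powR; rewrite ?nnegrE//; lra.
set k := P * m `^ (P - 1).
have ck : circle_cts (fun z => k * u z) a s by move=> z /su; exact: continuous_cstMr.
have cc : circle_cts (fun=> m `^ P - k * m) a s by exact: circle_cts_cst.
have -> : m `^ P = cavg (fun z => k * u z + (m `^ P - k * m)) a s.
  by rewrite (cavgD ck cc) (cavgZ k su) cavg_cst -/m; lra.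
apply: cavg_le.
- move=> z zs; apply/cvgCR_distP => e e0.
  have [d d0 H] := (cvgCR_distP _ _ _).1 (ck _ zs) _ e0.
  by exists d => // w /H; rewrite opprD addrACA subrr addr0.
- by move=> z /su; exact: continuous_powR.
by move=> z _; have := powR_tangent P1 m0 (u0 z); rewrite -/k; lra.
Qed.

Lemma sqr_modulus_cavg a (s : R) : 0 <= s ->
  cavg (fun z => modulus z ^+ 2) a s = modulus a ^+ 2 + s ^+ 2.
Proof.
move=> s0.
have cz z : cder (fun w => (conjc a : C) * w) z (conjc a * 1 + z * 0).
  by apply: cderM; [exact: cder_cst|exact: cder_id].
have cr : circle_cts (fun z => complex.Re ((conjc a : C) * z)) a s.
  by move=> z _; apply: (continuous_comp (cder_continuous (cz z))); exact: Re_continuous.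
have := @mean_value R (fun w => (conjc a : C) * w) a s s0 (cder_continuous (cz a)) (fun z _ => ex_intro _ _ (cz z)).
rewrite Re_conjM => E.
rewrite (@eq_cavg _ _ (fun z => 2 * complex.Re ((conjc a : C) * z) + (s ^+ 2 - modulus a ^+ 2))).
  rewrite cavgD; [|by move=> z /cr; exact: continuous_cstMr|exact: circle_cts_cst].
  by rewrite cavgZ// E cavg_cst; lra.
move=> z; rewrite ger0_norm// => <-; rewrite !modulus_sqr.
by case: a {cz cr E} => a1 a2; case: z => x y /=; ring.
Qed.

(* Adding [eta |z|^2] makes the mean value inequality strict, so that no interior maximum survives. *)
Lemma lsubmean_max u (r B : R) : disk_cts u -> lsubmean u -> 0 <= r < 1 ->
  (forall z, modulus z = r -> u z <= B) -> forall z, modulus z <= r -> u z <= B.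
Proof.
move=> cu mu /andP[r0 r1] uB z zr; apply/ler_addgt0Pl => eta eta0.
pose q z : R := eta * modulus z ^+ 2.
have cq : continuous q.
  move=> w; apply: continuous_cstMr.
  have := @modulus_continuous R w => cm.
  apply: (@continuous_comp _ _ _ (modulus : C -> R) (fun x : R => x ^+ 2)); first exact: cm.
  exact: exprn_continuous.
have cuq : disk_cts (fun z => u z + q z) by apply: disk_ctsD => // w _; exact: cq.
have [c cr cmax] := @disk_max R r (fun z => u z + q z) r0 (fun w wr => cuq w (le_lt_trans wr r1)).
have q0 w : 0 <= q w by rewrite mulr_ge0 ?sqr_ge0// ltW.
move: (cr); rewrite le_eqVlt => /orP[/eqP crE|crlt].
  have := cmax _ zr; have := uB _ crE; have := q0 z.
  have : q c <= eta by rewrite /q crE -[leRHS]mulr1 ler_pM2l//; nra.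
  lra.
exfalso.
have c1 : modulus c < 1 by lra.
have [d d0 Hd] := mu _ c1.
pose s := Num.min (d / 2) ((r - modulus c) / 2).
have s0 : 0 < s by rewrite lt_min; lra.
have sd : s < d by rewrite gt_min; apply/orP; left; lra.
have sc : s < r - modulus c by rewrite gt_min; apply/orP; right; lra.
have su : circle_cts u c s by apply: disk_cts_circle => //; rewrite s0; lra.
have sq : circle_cts q c s by move=> w _; exact: cq.
have sm : circle_cts (fun z => modulus z ^+ 2) c s.
  move=> w _; have := @modulus_continuous R w => cm.
  apply: (@continuous_comp _ _ _ (modulus : C -> R) (fun x : R => x ^+ 2)); first exact: cm.
  exact: exprn_continuous.
have : cavg (fun z => u z + q z) c s <= u c + q c.
  rewrite -[leRHS](cavg_cst _ c s); apply: cavg_le; [|exact: circle_cts_cst|].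
    by move=> w ws; apply: cuq; have := modulusD (w - c) c; rewrite subrK ws gtr0_norm//; lra.
  by move=> w; rewrite gtr0_norm// => ws; apply: cmax; have := modulusD (w - c) c; rewrite subrK ws; lra.
rewrite cavgD// /q cavgZ// sqr_modulus_cavg; last exact: ltW.
have := Hd s; rewrite s0 sd => /(_ isT).
have : 0 < eta * s ^+ 2 by rewrite mulr_gt0// exprn_gt0.
lra.
Qed.

(* Rotations are built in because the average over n-th roots of unity is
   the function to which the maximum principle is applied. *)
Definition subharm u := disk_cts u /\
  forall w, modulus w = 1 -> lsubmean (fun z => u (z * w)).

Lemma disk_cts_rot u w : modulus w = 1 -> disk_cts u -> disk_cts (fun z => u (z * w)).
Proof.
move=> w1 cu z z1; apply/cvgCR_distP => e e0.
have [|d d0 H] := (cvgCR_distP u (z * w) (u (z * w))).1 _ _ e0.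
  by apply: cu; rewrite modulusM w1 mulr1.
by exists d => // x xz; apply: H; rewrite -mulrBl modulusM w1 mulr1.
Qed.

Lemma circle_lip r s t : 0 <= r -> modulus (circle_point r s - circle_point r t : C) <= r * `|s - t|.
Proof.
move=> r0.
have E x : circle_point r x = r%:C%C * cexp (Complex 0 x) :> C.
  by rewrite cexp_circle expR0 circle_pointZ mulr1.
rewrite !E -mulrBr modulusM modulusR ger0_norm// ler_wpM2l//.
have := @cder_segment_lip R cexp cexp (Complex 0 t) (Complex 0 s) 1.
rewrite mul1r => /(_ _)/le_trans; apply; last first.
  by apply: le_trans (modulus_le_ReIm _) _; rewrite /= subrr normr0 add0r.
move=> x _; split; first exact: cder_cexp.
have -> : Complex 0 t + x%:C%C * (Complex 0 s - Complex 0 t : C) = Complex 0 (t + x * (s - t)) :> C.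
  by apply/eqP; rewrite eq_complex /=; apply/andP; split; apply/eqP; ring.
by rewrite cexp_circle expR0 modulus_circle normr1.
Qed.

Lemma cavg_rot u r t : 0 <= t <= 2 * pi -> circle_cts u 0 r ->
  iint 0 (2 * pi) (fun x => u (circle_point r (x + t))) = 2 * pi * cavg u 0 r.
Proof.
move=> t2 cu; rewrite /cavg mulrA mulfV ?mul1r; last by rewrite gt_eqF// pi2_gt0.
have := circle_cts_continuous cu.
have -> : (fun x => u (0 + circle_point r x)) = (fun x => u (circle_point r x)).
  by apply/funext => x; rewrite add0r.
move=> cu'; rewrite (@iint_periodic _ (fun x => u (circle_point r x)))//.
by move=> x; rewrite circle_pointD2pi.
Qed.

(** The sum [U] over equidistant rotations, multiplied by the step [b], is at each point of a circle
    a Riemann sum of the circle integral, hence nearly constant on circles. The maximum principle,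
    applied to it on the disk of radius [r'], compares the values at radius [r] with those at radius
    [r']. *)
Lemma subharm_mono u r r' : subharm u -> 0 <= r -> r <= r' -> r' < 1 ->
  cavg u 0 r <= cavg u 0 r'.
Proof.
move=> [cu mu] r0 rr r'1; have r'0 : 0 <= r' by lra.
apply/ler_addgt0Pl => e e0; have e2 : 0 < e / 2 by lra.
have [d d0 Hd] := @unif_cts R u [set z | modulus z <= r'] (@closed_disk_compact _ _)
  (fun z zr => cu z (le_lt_trans zr r'1)) _ e2.
have p0 := @pi2_gt0 R.
have [n nd] : exists n : nat, 2 * pi / d < n.+1%:R.
  exists (Num.bound (2 * pi / d)); apply: lt_trans (archi_boundP _) _; first by rewrite divr_ge0// ltW.
  by rewrite ltr_nat.
have n0 : 0 < n.+1%:R :> R by rewrite ltr0n.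
pose b : R := 2 * pi / n.+1%:R.
have b0 : 0 < b by rewrite divr_gt0.
have bd : b < d by rewrite /b ltr_pdivrMr// [d * _]mulrC -ltr_pdivrMr//.
have nb : n.+1%:R * b = 2 * pi by rewrite /b mulrCA mulfV ?mulr1// gt_eqF.
pose w (j : nat) : C := circle_point 1 (j%:R * b).
pose U m z := \sum_(j < m) u (z * w j).
have w1 j : modulus (w j) = 1 by rewrite modulus_circle normr1.
have cw j : disk_cts (fun z => u (z * w j)) by exact: disk_cts_rot.
have U0 : U 0%N = fun=> 0 by apply/funext => z; rewrite /U big_ord0.
have US m : U m.+1 = fun z => U m z + u (z * w m).
  by apply/funext => z; rewrite /U big_ord_recr.
have cU m : disk_cts (U m).
  elim: m => [|m ih]; last by rewrite US; exact: disk_ctsD.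
  by rewrite U0 => z _; exact: (@cst_continuous C R 0 z).
have mU m : lsubmean (U m).
  elim: m => [|m ih]; last by rewrite US; apply: lsubmeanD => //; exact: mu.
  by rewrite U0 => z _; exists 1 => // s _; rewrite cavg_cst.
have RS s t : 0 <= s -> s <= r' -> 0 <= t <= 2 * pi ->
  `|2 * pi * cavg u 0 s - b * U n.+1 (circle_point s t)| <= 2 * pi * (e / 2).
  move=> s0 sr t2.
  have cs : circle_cts u 0 s by apply: disk_cts_circle0 => //; rewrite s0; lra.
  rewrite -(cavg_rot t2 cs) -nb.
  have -> : U n.+1 (circle_point s t) = \sum_(j < n.+1) u (circle_point s (j%:R * b + t)).
    by apply: eq_bigr => j _; rewrite /w circle_pointM mulr1 [t + _]addrC.
  apply: (@riemann_sum (fun x => u (circle_point s (x + t))) n.+1 b (e / 2)); first exact: ltW.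
    move=> x; apply: (@continuous_comp _ _ _ (fun x => x + t) (fun x => u (circle_point s x))).
      by apply: cvgD; [exact: cvg_id|exact: cvg_cst].
    have := circle_cts_continuous cs (x := x + t).
    by under eq_fun do rewrite add0r.
  move=> x y _ xy; apply/ltW; rewrite distrC; apply: Hd.
    by rewrite /= modulus_circle ger0_norm.
  apply: le_lt_trans (circle_lip _ _ s0) _.
  rewrite opprD addrACA subrr addr0 distrC; apply: le_lt_trans bd.
  by apply: le_trans xy; rewrite ler_piMl//; lra.
have B z : modulus z = r' -> b * U n.+1 z <= 2 * pi * (cavg u 0 r' + e / 2).
  move=> zr; have [t t2 ->] := polar_form z; rewrite zr.
  by have := RS r' t r'0 (lexx _) t2; rewrite ler_norml => /andP[]; lra.
have := @lsubmean_max (fun z => b * U n.+1 z) r' _ _ _ _ B (circle_point r 0).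
rewrite modulus_circle ger0_norm// rr r'0 r'1 => /(_ _ _ isT isT) H.
have {}H : b * U n.+1 (circle_point r 0) <= 2 * pi * (cavg u 0 r' + e / 2).
  by apply: H; [exact: disk_ctsZ|apply: lsubmeanZ => //; exact: ltW].
have := RS r 0 r0 rr; rewrite lexx (ltW p0) => /(_ isT); rewrite ler_norml => /andP[_ H'].
have : 2 * pi * cavg u 0 r <= 2 * pi * (e + cavg u 0 r') by lra.
by rewrite ler_pM2l.
Qed.

End subharmonic_functions.


(** * Semigroups of analytic self-maps of the disk *)

Section semigroup.
Context {R : realType}.
Local Notation C := (R[i]^o).
Implicit Types (z w c : C) (f : C -> C) (r s t : R).

Lemma analytic_cder f z : analytic_on_disk f -> modulus z < 1 -> cder f z (derive1 f z).
Proof. by move=> af z1; apply: derivable_cder; exact: af. Qed.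

Lemma analytic_disk_cts f : analytic_on_disk f -> forall z, modulus z < 1 -> {for z, continuous f}.
Proof. by move=> af z z1; exact: cder_continuous (analytic_cder af z1). Qed.

Lemma analytic_modulus_cts f : analytic_on_disk f -> disk_cts (fun z => modulus (f z)).
Proof.
move=> af z z1.
exact: (continuous_comp (analytic_disk_cts af z1) (@modulus_continuous _ _)).
Qed.

Lemma analytic_unif_cts f (rho : R) : analytic_on_disk f -> rho < 1 ->
  forall e : R, 0 < e -> exists2 d : R, 0 < d &
    forall z w, modulus z <= rho -> modulus (w - z) < d -> modulus (f w - f z) <= e.
Proof.
move=> af r1 e e0; have e2 : 0 < e / 2 by lra.
have cf z : [set z : C | modulus z <= rho] z -> {for z, continuous f}.
  by move=> /= zr; apply: analytic_disk_cts => //; exact: le_lt_trans r1.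
have K := @closed_disk_compact R rho.
have [|d1 d10 H1] := unif_cts (u := fun z => complex.Re (f z)) K _ e2.
  by move=> z /cf cz; exact: (continuous_comp cz (@Re_continuous _ _)).
have [|d2 d20 H2] := unif_cts (u := fun z => complex.Im (f z)) K _ e2.
  by move=> z /cf cz; exact: (continuous_comp cz (@Im_continuous _ _)).
exists (Num.min d1 d2); first by rewrite lt_min d10.
move=> z w zr; rewrite lt_min => /andP[w1 w2].
have := H1 z w zr w1; have := H2 z w zr w2.
have := modulus_le_ReIm (f w - f z); case: (f w) (f z) => ? ? [? ?] /=; lra.
Qed.

Variable phi : R -> C -> C.
Hypothesis hphi : analytic_semigroup phi.

Local Notation dphi t z := (derive1 (phi t) z).

Lemma phi_cder t z : 0 <= t -> modulus z < 1 -> cder (phi t) z (dphi t z).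
Proof. by move=> t0; apply: analytic_cder; exact: (semigroup_analytic hphi t0). Qed.

Lemma phi_lt1 t z : 0 <= t -> modulus z < 1 -> modulus (phi t z) < 1.
Proof. by move=> t0 z1; exact: (semigroup_self_map hphi t0 z1). Qed.

Lemma phi_cvg_id (rho e : R) : rho < 1 -> 0 < e -> exists2 d : R, 0 < d &
  forall t z, 0 <= t < d -> modulus z <= rho -> modulus (phi t z - z) < e.
Proof.
move=> r1 e0.
have Ksub : [set z : C | modulus z <= rho] `<=` unit_disk by move=> z /= /le_lt_trans; exact.
have H := semigroup_cvg0 hphi (@closed_disk_compact R rho) Ksub.
have eC : 0 < e%:C%C by rewrite ltcR.
pose P (g : C -> C) := forall y, modulus y <= rho -> ball (phi 0 y) e%:C%C (g y).
have : nbhs (phi @ 0^'+) P.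
  apply: H; apply/uniform_nbhs; exists [set xy : C * C | ball xy.1 e%:C%C xy.2]; split.
    exact: (@entourage_ball _ C (PosNum eC)).
  by [].
move=> [d /= d0 Hd]; exists d => // t z /andP[t0 td] zr.
(* The filter [0^'+] leaves out [t = 0], where [phi 0] is the identity of the disk. *)
have [->|tn0] := eqVneq t 0.
  by rewrite (semigroup_at0 hphi (Ksub _ zr)) subrr modulus0.
have tp : 0 < t by rewrite lt_neqAle eq_sym tn0.
have := Hd t _ tp z zr; rewrite /= sub0r normrN gtr0_norm// => /(_ td).
rewrite /ball /= (semigroup_at0 hphi (Ksub _ zr)) distrC normC_modulus ltcR.
by [].
Qed.

(** Cauchy's estimate for [phi t w - w] on circles of radius half the distance from [rho] to [1]. *)
Lemma phi_derive_cvg (rho e : R) : rho < 1 -> 0 < e -> exists2 d : R, 0 < d &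
  forall t z, 0 <= t < d -> modulus z <= rho -> modulus (dphi t z - 1) <= e.
Proof.
move=> r1 e0; pose r := (1 - rho) / 2; have r0 : 0 < r by rewrite /r; lra.
have [||d d0 H] := @phi_cvg_id (rho + r) (e * r / 2); [by rewrite /r; lra|by rewrite divr_gt0// mulr_gt0|].
exists d => // t z td zr; have /andP[t0 _] := td.
have B w : modulus (w - z) <= r -> modulus w <= rho + r.
  by have := modulusD (w - z) z; rewrite subrK; lra.
have L w : modulus (w - z) <= r -> modulus w < 1 by move=> /B; rewrite /r; lra.
have := @cauchy_estimate R (fun w => phi t w - w) z (dphi t z - 1) r (e * r / 2) r0.
have -> : 2 * (e * r / 2) / r = e by field; rewrite gt_eqF.
apply.
- by apply: cderB (cder_id _); apply: phi_cder => //; apply: L; rewrite subrr modulus0 ltW.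
- by move=> w /L w1; eexists; apply: cderB (cder_id _); exact: phi_cder t0 w1.
- by move=> w /B wr; apply: ltW; exact: H.
Qed.

Lemma comp_cvg f (rho e : R) : analytic_on_disk f -> rho < 1 -> 0 < e ->
  exists2 d : R, 0 < d &
  forall t z, 0 <= t < d -> modulus z <= rho -> modulus (f (phi t z) - f z) <= e.
Proof.
move=> af r1 e0; have [d1 d10 H1] := analytic_unif_cts af r1 e0.
have [d d0 H] := phi_cvg_id r1 d10.
by exists d => // t z td zr; apply: H1 => //; exact: H.
Qed.

(** The multiplier is left arbitrary because two families are of this form: [T_t] with [phi_t'], and
    its companion [S_t] with a square root of [phi_t']. *)
Lemma mul_comp_cvg (k : R -> C -> C) f : analytic_on_disk f ->
  (forall rho e : R, rho < 1 -> 0 < e -> exists2 d : R, 0 < d &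
    forall t z, 0 <= t < d -> modulus z <= rho -> modulus (k t z - 1) <= e) ->
  forall rho e : R, 0 <= rho < 1 -> 0 < e -> exists2 d : R, 0 < d &
    forall t z, 0 <= t < d -> modulus z <= rho -> modulus (k t z * f (phi t z) - f z) <= e.
Proof.
move=> af hk rho e /andP[r0 r1] e0.
have [c _ Hc] := @disk_max R rho (fun z => modulus (f z)) r0
  (fun z zr => analytic_modulus_cts af (le_lt_trans zr r1)).
have m0 := modulus_ge0 (f c).
have e1 : 0 < Num.min 1 (e / 2) by rewrite lt_min ltr01; lra.
have [d1 d10 H1] := comp_cvg af r1 e1.
have e2 : 0 < e / 2 / (modulus (f c) + 1) by rewrite !divr_gt0//; lra.
have [d2 d20 H2] := hk _ _ r1 e2.
exists (Num.min d1 d2); first by rewrite lt_min d10.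
move=> t z /andP[t0]; rewrite lt_min => /andP[td1 td2] zr.
have h1 := H1 t z; rewrite t0 td1 in h1; have {}h1 := h1 isT zr.
have h2 := H2 t z; rewrite t0 td2 in h2; have {}h2 := h2 isT zr.
move: h1; rewrite le_min => /andP[h1 h1'].
have -> : k t z * f (phi t z) - f z = (k t z - 1) * f (phi t z) + (f (phi t z) - f z) by ring.
apply: le_trans (modulusD _ _) _; rewrite modulusM.
have fb : modulus (f (phi t z)) <= modulus (f c) + 1.
  by have := modulusD (f (phi t z) - f z) (f z); rewrite subrK; have := Hc z zr; lra.
suff : modulus (k t z - 1) * modulus (f (phi t z)) <= e / 2 by lra.
move: h2; rewrite ler_pdivlMr; last lra.
by apply: le_trans; rewrite ler_wpM2l// modulus_ge0.
Qed.

Lemma weighted_comp_cvg f (rho e : R) : analytic_on_disk f -> 0 <= rho < 1 -> 0 < e ->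
  exists2 d : R, 0 < d &
  forall t z, 0 <= t < d -> modulus z <= rho -> modulus (weighted_comp phi t f z - f z) <= e.
Proof.
move=> af; apply: (mul_comp_cvg (k := fun t z => dphi t z)) => //.
by move=> rho' e' r1 e0; exact: phi_derive_cvg.
Qed.

(** Since [phi (r + h) z = phi r (phi h z)] and all maps [phi r] are bounded by [1], Cauchy's
    estimate gives them a common Lipschitz constant near [z]. Hence [d] does not depend on the time
    [r]. *)
Lemma phi_equicts z : modulus z < 1 -> forall e : R, 0 < e -> exists2 d : R, 0 < d &
  forall h r, 0 <= h < d -> 0 <= r -> modulus (phi (r + h) z - phi r z) < e.
Proof.
move=> z1 e e0; pose q := (1 - modulus z) / 4; have q0 : 0 < q by rewrite /q; lra.
have e1 : 0 < Num.min q (e * q / 4).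
  by rewrite lt_min q0 divr_gt0// mulr_gt0.
have [d d0 H] := phi_cvg_id z1 e1; exists d => // h r hd r0.
have /andP[h0 _] := hd.
rewrite (semigroup_comp hphi r0 h0)//.
have := H h z hd (lexx _); rewrite lt_min => /andP[hq he].
have := @cder_segment_lip R (phi r) (fun w => dphi r w) z (phi h z) (2 / q) _.
move=> K; apply: le_lt_trans (K _) _.
  move=> s /andP[s0 s1]; set w := z + _.
  have wz : modulus (w - z) <= q.
    rewrite /w addrAC subrr add0r modulusM modulusR ger0_norm//.
    by apply: le_trans (ltW hq); rewrite ler_piMl// modulus_ge0.
  have L (x : C) : modulus (x - w) <= q -> modulus x < 1.
    have := modulusD (x - w) (w - z); have := modulusD (x - z) z.
    by rewrite subrK addrA subrK; rewrite /q in wz *; lra.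
  split; first by apply: phi_cder => //; apply: L; rewrite subrr modulus0 ltW.
  rewrite -[X in X / q]mulr1.
  apply: (@cauchy_estimate R (phi r) w) => //.
  - by apply: phi_cder => //; apply: L; rewrite subrr modulus0 ltW.
  - by move=> x /L x1; eexists; exact: phi_cder r0 x1.
  - by move=> x /L x1; apply: ltW; exact: phi_lt1.
apply: (@le_lt_trans _ _ (2 / q * (e * q / 4))).
  by rewrite ler_pM2l ?ltW// divr_gt0.
have -> : 2 / q * (e * q / 4) = e / 2 by field; rewrite gt_eqF.
lra.
Qed.

(* An orbit that dips below [rho] within a short time must pass through the
   annulus [rho < |w| <= (1 + rho) / 2], where the semigroup moves slowly. *)
Lemma phi_modulus_ge (rho : R) : 0 <= rho < 1 -> exists R0 d : R,
  [/\ 0 <= R0 < 1, 0 < d & forall t z, 0 <= t < d -> R0 <= modulus z < 1 ->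
    rho <= modulus (phi t z)].
Proof.
move=> /andP[r0 r1]; pose rho' := (1 + rho) / 2; pose e := (1 - rho) / 8.
have e0 : 0 < e by rewrite /e; lra.
have r'1 : rho' < 1 by rewrite /rho'; lra.
have [d d0 H] := phi_cvg_id r'1 e0.
exists rho', d; split => //; first by rewrite r'1 andbT /rho'; lra.
move=> t z /andP[t0 td] /andP[zr z1].
have [h0 h00 Hh] := phi_equicts z1 e0.
have [N N0 tN] : exists2 N : nat, (0 < N)%N & t / N%:R < h0.
  exists (Num.truncn (t / h0)).+1 => //.
  have := truncnS_gt (t / h0); rewrite ltr_pdivrMr// => K.
  by rewrite ltr_pdivrMr ?ltr0n// mulrC.
have NR : 0 < N%:R :> R by rewrite ltr0n.
pose h := t / N%:R; have h_ge0 : 0 <= h by rewrite divr_ge0.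
(* A discrete intermediate value argument: one step moves the point by less than [e], so the first
   step below [rho'] lands in [[rho' - e, rho']]. In the remaining time, less than [d], the point
   moves by less than [e] again, and [rho' - 2 * e >= rho]. *)
have S j : (j <= N)%N -> rho' <= modulus (phi (j%:R * h) z) \/
    exists2 i : nat, (i <= N)%N & rho' - e <= modulus (phi (i%:R * h) z) <= rho'.
  elim: j => [_|j ih jN].
    by left; rewrite mul0r (semigroup_at0 hphi)//.
  have [] := ih (ltnW jN); last by right.
  move=> hj; have [?|lt] := lerP rho' (modulus (phi (j.+1%:R * h) z)); [by left|right].
  exists j.+1 => //; rewrite (ltW lt) andbT.
  have := Hh h (j%:R * h); rewrite h_ge0 tN mulr_ge0// => /(_ isT isT).
  have -> : j%:R * h + h = j.+1%:R * h by rewrite -natr1 mulrDl mul1r.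
  have := modulusD (phi (j.+1%:R * h) z) (phi (j%:R * h) z - phi (j.+1%:R * h) z).
  rewrite addrCA subrr addr0 modulusBC; move=> a b; lra.
have Nh : N%:R * h = t by rewrite /h mulrC divfK// gt_eqF.
have := S N (leqnn _); rewrite Nh => -[|[i iN /andP[i1 i2]]]; first by rewrite /rho'; lra.
have ih : i%:R * h <= t by rewrite -Nh ler_wpM2r// ler_nat.
have ih0 : 0 <= i%:R * h by rewrite mulr_ge0.
have := H (t - i%:R * h) (phi (i%:R * h) z).
rewrite -(semigroup_comp hphi)//; last by rewrite subr_ge0.
rewrite subrK subr_ge0 ih => /(_ ltac:(lra) i2).
have := modulusD (phi t z) (phi (i%:R * h) z - phi t z).
rewrite addrCA subrr addr0 modulusBC /e /rho' in i1 *; move=> a b; lra.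
Qed.

Lemma phi_chain t s z : 0 <= t -> 0 <= s -> modulus z < 1 ->
  dphi (t + s) z = dphi t (phi s z) * dphi s z.
Proof.
move=> t0 s0 z1; apply: cder_derive1.
have d1 : 0 < 1 - modulus z by rewrite subr_gt0.
apply: (cder_near d1 _ (cder_comp (phi_cder s0 z1) (phi_cder t0 (phi_lt1 s0 z1)))).
move=> w wz; rewrite (semigroup_comp hphi t0 s0)//.
by have := modulusD (w - z) z; rewrite subrK /unit_disk /=; lra.
Qed.

Lemma phi_near_id z : modulus z < 1 -> forall e : R, 0 < e -> exists2 d : R, 0 < d &
  forall t w, 0 <= t < d -> modulus (w - z) < d -> modulus (dphi t w - 1) <= e.
Proof.
move=> z1 e e0; have r1 : (1 + modulus z) / 2 < 1 by lra.
have [d d0 H] := phi_derive_cvg r1 e0.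
exists (Num.min d ((1 - modulus z) / 2)); first by rewrite lt_min d0; lra.
move=> t w /andP[t0]; rewrite !lt_min => /andP[td _] /andP[_ wz]; apply: H; first by rewrite t0.
by have := modulusD (w - z) z; rewrite subrK; lra.
Qed.

(** For small times the derivative is close to [1]. If [phi_s' z = 0] for some [s], the infimum [i]
    of such times is attained, because [phi_(s - i)'] does not vanish at [phi i z] for [s] near [i].
    The chain rule over [(i - h) + h] then moves the zero to the earlier time [i - h], since
    [phi_h'] does not vanish at [phi (i - h) z], a point near [phi i z]. *)
Lemma phi_derive_neq0 t z : 0 <= t -> modulus z < 1 -> dphi t z != 0.
Proof.
move=> t0 z1; apply/eqP => dt.
have half : 0 < 1 / 2 :> R by lra.
have nz c : c = 0 -> modulus (c - 1) <= 1 / 2 -> False.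
  by move=> ->; rewrite sub0r modulusN modulus1; lra.
pose A := [set s : R | 0 <= s /\ dphi s z = 0].
have At : A t by [].
have iA : has_inf A by split; [exists t|exists 0 => s []].
pose i := inf A.
have i0 : 0 <= i by apply: lb_le_inf; [exists t|move=> s []].
have ge_i s : A s -> i <= s by move=> As; exact: (ge_inf iA.2).
have zi1 := phi_lt1 i0 z1.
have [d d0 Hd] := phi_near_id zi1 half.
have di : dphi i z = 0.
  have [s [s0 ds] sd] := inf_adherent d0 iA.
  have leis : i <= s by exact: (ge_i s (conj s0 ds)).
  have := phi_chain (t := s - i) (s := i) (z := z); rewrite subrK subr_ge0 ds.
  move=> /(_ leis i0 z1) /esym/eqP; rewrite mulf_eq0 => /orP[/eqP E|/eqP//].
  have := Hd (s - i) (phi i z); rewrite subr_ge0 leis subrr modulus0 => /(_ _ d0).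
  by move=> K; case: (nz _ E); apply: K; rewrite /= ltrBlDl.
have in0 : 0 < i.
  rewrite lt_neqAle i0 andbT; apply/eqP => E.
  have [d' d'0 H'] := phi_near_id z1 half.
  have := H' 0 z; rewrite subrr modulus0 lexx d'0 => K.
  by apply: (nz _ _ (K isT isT)); rewrite E.
have [d' d'0 Hd'] := phi_equicts z1 d0.
pose h := Num.min (i / 2) (Num.min (d / 2) (d' / 2)).
have h0 : 0 < h by rewrite !lt_min; apply/and3P; split; lra.
have hi : h <= i / 2 by rewrite ge_min lexx.
have hd : h <= d / 2 by rewrite !ge_min lexx orbT.
have hd' : h <= d' / 2 by rewrite !ge_min lexx !orbT.
have ih0 : 0 <= i - h by lra.
have := phi_chain (t := h) (s := i - h) (z := z) (ltW h0) ih0 z1.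
rewrite addrC subrK di => /esym/eqP; rewrite mulf_eq0 => /orP[/eqP E|/eqP E].
  have := Hd' h (i - h); rewrite subrK ih0 modulusBC => /(_ ltac:(lra) isT) K.
  have := Hd h (phi (i - h) z) ltac:(lra) K; exact: (nz _ E).
by have := ge_i (i - h) (conj ih0 E); lra.
Qed.

Lemma weighted_comp0 f z : modulus z < 1 -> weighted_comp phi 0 f z = f z.
Proof.
move=> z1; rewrite /weighted_comp (semigroup_at0 hphi)//.
have -> : dphi 0 z = 1; last by rewrite mul1r.
apply: cder_derive1; have d1 : 0 < 1 - modulus z by rewrite subr_gt0.
apply: (cder_near d1 _ (cder_id z)) => w wz; rewrite (semigroup_at0 hphi)//.
by have := modulusD (w - z) z; rewrite subrK /unit_disk /=; lra.
Qed.

Lemma weighted_compD t s f z : 0 <= t -> 0 <= s -> modulus z < 1 ->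
  weighted_comp phi (t + s) f z = weighted_comp phi t (weighted_comp phi s f) z.
Proof.
move=> t0 s0 z1; rewrite /weighted_comp addrC phi_chain// (semigroup_comp hphi)//.
by rewrite [RHS]mulrA [in RHS](mulrC (dphi t z)).
Qed.

End semigroup.

(** * Integral means of analytic functions *)

Section integral_means.
Context {R : realType}.
Local Notation C := (R[i]^o).
Local Notation mu := (@lebesgue_measure R).
Implicit Types (z w c : C) (f g : C -> C) (r s t a : R).

Lemma powR_super (p x y : R) : 1 <= p -> 0 <= x -> 0 <= y ->
  x `^ p + y `^ p <= (x + y) `^ p.
Proof.
move=> p1 x0 y0.
have K (a b : R) : 0 <= a -> a <= b -> a `^ p <= a * b `^ (p - 1).
  move=> a0 ab; have [->|an] := eqVneq a 0; first by rewrite powR0 ?mul0r//; lra.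
  have -> : a `^ p = a * a `^ (p - 1).
    by rewrite -{2}(powRr1 a0) -powRD ?an ?implybT// (addrC 1) subrK.
  rewrite ler_wpM2l//.
  by apply: ge0_ler_powR; rewrite ?nnegrE//; lra.
have [xy|xy] := eqVneq (x + y) 0.
  have -> : x = 0 by lra.
  have -> : y = 0 by lra.
  by rewrite addr0 !powR0 ?addr0//; lra.
have -> : (x + y) `^ p = x * (x + y) `^ (p - 1) + y * (x + y) `^ (p - 1).
  have xy0 : 0 <= x + y by lra.
  by rewrite -mulrDl -{2}(powRr1 xy0) -powRD ?xy ?implybT// (addrC 1) subrK.
by apply: lerD; apply: K; lra.
Qed.

Lemma powR_add3_le (p x y z : R) : 0 <= p -> 0 <= x -> 0 <= y -> 0 <= z ->
  (x + y + z) `^ p <= 3 `^ p * (x `^ p + y `^ p + z `^ p).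
Proof.
move=> p0 x0 y0 z0; pose m := Num.max x (Num.max y z).
have m0 : 0 <= m by rewrite le_max x0.
have hx : x <= m by rewrite le_max lexx.
have hy : y <= m by rewrite !le_max lexx orbT.
have hz : z <= m by rewrite !le_max lexx !orbT.
apply: (@le_trans _ _ ((3 * m) `^ p)).
  by apply: ge0_ler_powR; rewrite ?nnegrE//; lra.
rewrite powRM// ler_pM2l ?powR_gt0//.
have := powR_ge0 x p; have := powR_ge0 y p; have := powR_ge0 z p.
by rewrite /m /Num.max; do 2 case: ifP; lra.
Qed.

Lemma powR_add3_inv (p x y z : R) : 1 <= p -> 0 <= x -> 0 <= y -> 0 <= z ->
  (x + y + z) `^ p^-1 <= x `^ p^-1 + y `^ p^-1 + z `^ p^-1.
Proof.
move=> p1 x0 y0 z0; have p0 : 0 < p by lra.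
have K (a : R) : 0 <= a -> a = (a `^ p^-1) `^ p.
  by move=> a0; rewrite -powRrM mulVf ?powRr1// gt_eqF.
have G (a : R) : 0 <= a `^ p^-1 by exact: powR_ge0.
rewrite {1}(K x)// {1}(K y)// {1}(K z)//.
apply: (@le_trans _ _ (((x `^ p^-1 + y `^ p^-1 + z `^ p^-1) `^ p) `^ p^-1)).
  apply: ge0_ler_powR; rewrite ?nnegrE ?invr_ge0 ?(ltW p0) ?addr_ge0 ?powR_ge0//.
  apply: le_trans (powR_super _ _ _); rewrite ?addr_ge0//.
  by rewrite lerD2r powR_super.
by rewrite -powRrM mulfV ?powRr1 ?gt_eqF// !addr_ge0.
Qed.

Definition im (p : \bar R) r f : R := fine (integral_mean p r f).

Lemma analytic_powR_cts f (p : R) : 1 <= p -> analytic_on_disk f ->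
  disk_cts (fun z => modulus (f z) `^ p).
Proof.
move=> p1 af z z1; apply: continuous_powR => // [w|]; first exact: modulus_ge0.
exact: analytic_modulus_cts.
Qed.

Lemma circle_integral (u : C -> R) r : circle_cts u 0 r ->
  (\int[mu]_(t in `[0%R, (2 * pi)%R]) (u (circle_point r t) / (2 * pi))%:E)%E = (cavg u 0 r)%:E.
Proof.
move=> cu; have cw := circle_cts_within cu.
have E : (fun t => u (0 + circle_point r t)) = (fun t => u (circle_point r t)).
  by apply/funext => t; rewrite add0r.
rewrite E in cw.
have H : forall t, (u (circle_point r t) / (2 * pi))%:E = (((2 * pi)^-1)%:E * (u (circle_point r t))%:E)%E.
  by move=> t; rewrite -EFinM mulrC.
under eq_integral => t _ do rewrite H.
rewrite integralZl//; last exact: (itv_integrable cw).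
rewrite /cavg E EFinM /iint /Rintegral fineK//.
by apply: integrable_fin_num => //; exact: (itv_integrable cw).
Qed.

Lemma integral_meanE (p : R) r f : 1 <= p -> analytic_on_disk f -> 0 <= r < 1 ->
  integral_mean p%:E r f = (cavg (fun z => modulus (f z) `^ p) 0 r `^ p^-1)%:E.
Proof.
move=> p1 af r01; rewrite /integral_mean.
have := circle_integral (disk_cts_circle0 (analytic_powR_cts p1 af) r01).
by move=> ->; rewrite poweR_EFin.
Qed.

Lemma imE (p : R) r f : 1 <= p -> analytic_on_disk f -> 0 <= r < 1 ->
  im p%:E r f = cavg (fun z => modulus (f z) `^ p) 0 r `^ p^-1.
Proof. by move=> p1 af r01; rewrite /im integral_meanE. Qed.

Lemma analytic_circle_bound f r : analytic_on_disk f -> 0 <= r < 1 ->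
  exists2 B : R, 0 <= B & forall z, modulus z <= r -> modulus (f z) <= B.
Proof.
move=> af /andP[r0 r1].
have [c _ H] := disk_max r0 (fun z zr => analytic_modulus_cts af (le_lt_trans zr r1)).
by exists (modulus (f c)); [exact: modulus_ge0|].
Qed.

Lemma integral_mean_pinfty_le r f (B : R) : 0 <= r ->
  (forall z, modulus z = r -> modulus (f z) <= B) -> (integral_mean +oo r f <= B%:E)%E.
Proof.
move=> r0 H; apply: ge_ereal_sup => _ [t /= _ <-].
by rewrite lee_fin; apply: H; rewrite modulus_circle ger0_norm.
Qed.

Lemma integral_mean_pinfty_ge r f z : modulus z = r ->
  ((modulus (f z))%:E <= integral_mean +oo r f)%E.
Proof.
move=> zr; have [t t2 zt] := polar_form z; rewrite zt zr.
by apply: ereal_sup_ubound; exists t => //=; rewrite in_itv.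
Qed.

Lemma integral_mean_im p r f : (1 <= p)%E -> analytic_on_disk f -> 0 <= r < 1 ->
  integral_mean p r f = (im p r f)%:E.
Proof.
case: p => [p||] // p1 af r01; first by rewrite /im integral_meanE.
rewrite /im fineK// fin_numElt; have /andP[r0 r1] := r01.
have [B B0 H] := analytic_circle_bound af r01.
apply/andP; split.
  apply: lt_le_trans (integral_mean_pinfty_ge (z := r%:C%C) _ _); rewrite ?ltNyr//.
  by rewrite modulusR ger0_norm.
apply: le_lt_trans (integral_mean_pinfty_le (B := B) r0 _) _; rewrite ?ltry//.
by move=> z zr; apply: H; rewrite zr.
Qed.

Lemma im_pinfty_ge r f z : analytic_on_disk f -> 0 <= r < 1 -> modulus z = r ->
  modulus (f z) <= im +oo r f.
Proof.
move=> af r01 zr; rewrite -lee_fin -integral_mean_im ?leey//; exact: integral_mean_pinfty_ge.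
Qed.

Lemma im_pinfty_le r f (B : R) : analytic_on_disk f -> 0 <= r < 1 ->
  (forall z, modulus z = r -> modulus (f z) <= B) -> im +oo r f <= B.
Proof.
move=> af r01 H; rewrite -lee_fin -integral_mean_im ?leey//.
by apply: integral_mean_pinfty_le => //; case/andP: r01.
Qed.

Lemma im_ge0 p r f : (1 <= p)%E -> analytic_on_disk f -> 0 <= r < 1 -> 0 <= im p r f.
Proof.
case: p => [p||] // p1 af r01; first by rewrite imE// powR_ge0.
have zr : modulus (r%:C%C : C) = r by rewrite modulusR ger0_norm//; case/andP: r01.
exact: le_trans (modulus_ge0 _) (im_pinfty_ge af r01 zr).
Qed.

(** A triangle inequality with the factor [3], from [(x + y + z) ^ p <= 3 ^ p * (x ^ p + y ^ p + z ^
    p)] and subadditivity of the [p]-th root. It takes a pointwise bound as hypothesis, which is the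
    form in which domination is used, and it also covers [p = +oo]. *)
Lemma im_le3 p r f g h a : (1 <= p)%E -> analytic_on_disk f -> analytic_on_disk g ->
  analytic_on_disk h -> 0 <= r < 1 -> 0 <= a ->
  (forall z, modulus z = r -> modulus (f z) <= a + modulus (g z) + modulus (h z)) ->
  im p r f <= 3 * (a + im p r g + im p r h).
Proof.
case: p => [p||] // p1 af ag ah r01 a0 H; last first.
  have g0 := im_ge0 p1 ag r01; have h0 := im_ge0 p1 ah r01.
  apply: im_pinfty_le => // z zr; have := im_pinfty_ge ag r01 zr.
  by have := im_pinfty_ge ah r01 zr; have := H z zr; clear -g0 h0 a0; lra.
have {}p1 : 1 <= p by rewrite -lee_fin.
rewrite !imE//.
have C1 f' : analytic_on_disk f' -> circle_cts (fun z => modulus (f' z) `^ p) 0 r.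
  by move=> af'; exact: disk_cts_circle0 (analytic_powR_cts p1 af') r01.
have A0 f' : analytic_on_disk f' -> 0 <= cavg (fun z => modulus (f' z) `^ p) 0 r.
  by move=> af'; apply: cavg_ge0; [exact: C1|move=> z _; exact: powR_ge0].
have p0 : 0 < p by lra.
have Cs : circle_cts (fun z => a `^ p + modulus (g z) `^ p + modulus (h z) `^ p) 0 r.
  apply: disk_cts_circle0 => //; apply: disk_ctsD; last exact: analytic_powR_cts.
  by apply: disk_ctsD; [move=> z _; exact: cst_continuous|exact: analytic_powR_cts].
have : cavg (fun z => modulus (f z) `^ p) 0 r <=
    3 `^ p * (a `^ p + cavg (fun z => modulus (g z) `^ p) 0 r + cavg (fun z => modulus (h z) `^ p) 0 r).
  rewrite -{1}(cavg_cst (a `^ p) 0 r) -cavgD; [|exact: circle_cts_cst|exact: C1].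
  rewrite -cavgD; [|by apply: disk_cts_circle0 => //; apply: disk_ctsD;
    [move=> z _; exact: cst_continuous|exact: analytic_powR_cts]|exact: C1].
  rewrite -cavgZ//; apply: cavg_le; [exact: C1|by move=> z /Cs; exact: continuous_cstMr|].
  rewrite (ger0_norm (proj1 (andP r01))) => z; rewrite subr0 => zr.
  apply: le_trans (powR_add3_le _ _ _ _); rewrite ?modulus_ge0 ?(ltW p0)//.
  by apply: ge0_ler_powR; rewrite ?nnegrE ?addr_ge0 ?modulus_ge0 ?(ltW p0)//; exact: H.
have := A0 f af; have := A0 g ag; have := A0 h ah.
set x := cavg (fun z => modulus (h z) `^ p) 0 r.
set y := cavg (fun z => modulus (g z) `^ p) 0 r.
set z := cavg (fun z => modulus (f z) `^ p) 0 r.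
move: x y z => x y z x0 y0 z0 K.
apply: (@le_trans _ _ ((3 `^ p * (a `^ p + y + x)) `^ p^-1)).
  by apply: ge0_ler_powR; rewrite ?nnegrE ?invr_ge0 ?(ltW p0) ?mulr_ge0 ?addr_ge0 ?addr_ge0 ?powR_ge0.
rewrite powRM ?powR_ge0 ?addr_ge0 ?addr_ge0 ?powR_ge0//.
rewrite -powRrM mulfV ?gt_eqF// powRr1// ler_pM2l//.
apply: le_trans (powR_add3_inv _ _ _ _) _; rewrite ?powR_ge0//.
by rewrite -powRrM mulfV ?gt_eqF// powRr1.
Qed.

Lemma im_scale p r f g a : (1 <= p)%E -> analytic_on_disk f -> analytic_on_disk g ->
  0 <= r < 1 -> 0 <= a -> (forall z, modulus z = r -> modulus (f z) = a * modulus (g z)) ->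
  im p r f = a * im p r g.
Proof.
case: p => [p||] // p1 af ag r01 a0 H; last first.
  have zr : modulus (r%:C%C : C) = r by rewrite modulusR ger0_norm//; case/andP: r01.
  apply/eqP; rewrite eq_le; apply/andP; split.
    by apply: im_pinfty_le => // z zr'; rewrite H// ler_wpM2l// im_pinfty_ge.
  have [->|an] := eqVneq a 0; first by rewrite mul0r im_ge0.
  have a1 : 0 < a by rewrite lt_neqAle eq_sym an.
  rewrite -ler_pdivlMl//; apply: im_pinfty_le => // z zr'.
  by rewrite ler_pdivlMl// -H//; exact: im_pinfty_ge.
have {}p1 : 1 <= p by rewrite -lee_fin.
have p0 : 0 < p by lra.
rewrite !imE//.
have C1 : circle_cts (fun z => modulus (g z) `^ p) 0 r.
  exact: disk_cts_circle0 (analytic_powR_cts p1 ag) r01.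
have -> : cavg (fun z => modulus (f z) `^ p) 0 r = a `^ p * cavg (fun z => modulus (g z) `^ p) 0 r.
  rewrite -cavgZ//; apply: eq_cavg => z; rewrite subr0 (ger0_norm (proj1 (andP r01))) => zr.
  by rewrite H// powRM// modulus_ge0.
rewrite powRM ?powR_ge0//; last by apply: cavg_ge0 => // z _; exact: powR_ge0.
by rewrite -powRrM mulfV ?gt_eqF// powRr1.
Qed.

Lemma analytic_submean f : analytic_on_disk f -> lsubmean (fun z => modulus (f z)).
Proof.
move=> af a a1; exists (1 - modulus a) => [|s /andP[s0 s1]]; first by rewrite subr_gt0.
apply: modulus_submean; [exact: ltW|exact: analytic_disk_cts|] => z /andP[_ za].
exists (derive1 f z); apply: analytic_cder => //.
by have := modulusD (z - a) a; rewrite subrK; lra.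
Qed.

Lemma analytic_rot f w : modulus w = 1 -> analytic_on_disk f -> analytic_on_disk (fun z => f (z * w)).
Proof.
move=> w1 af z z1; apply/cderP; eexists.
apply: (@cder_comp _ (fun z => z * w) f); first by apply: cderM; [exact: cder_id|exact: cder_cst].
by apply: analytic_cder => //; rewrite modulusM w1 mulr1.
Qed.

Lemma subharm_analytic (p : R) f : 1 <= p -> analytic_on_disk f ->
  subharm (fun z => modulus (f z) `^ p).
Proof.
move=> p1 af; split; first exact: analytic_powR_cts.
move=> w w1; have afw := analytic_rot w1 af.
apply: (@lsubmean_powR _ (fun z => modulus (f (z * w)))) => //.
- by move=> z; exact: modulus_ge0.
- exact: (analytic_modulus_cts afw).
- exact: (analytic_submean afw).
Qed.

(** Its use is measurability in [r]: monotone functions are measurable, whatever [p] is. For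
    [p = +oo] this is the maximum principle for [|f|]. *)
Lemma im_mono p r s f : (1 <= p)%E -> analytic_on_disk f -> 0 <= r -> r <= s -> s < 1 ->
  im p r f <= im p s f.
Proof.
move=> p1 af r0 rs s1; have s01 : 0 <= s < 1 by rewrite (le_trans r0 rs) s1.
have r01 : 0 <= r < 1 by rewrite r0 (le_lt_trans rs s1).
case: p p1 => [p p1|_|]; last by [].
  have {}p1 : 1 <= p by rewrite -lee_fin.
  rewrite (imE p1 af r01) (imE p1 af s01); apply: ge0_ler_powR; rewrite ?nnegrE ?invr_ge0.
  - by apply: le_trans p1.
  - apply: cavg_ge0 => [|z _]; last exact: powR_ge0.
    exact: disk_cts_circle0 (analytic_powR_cts p1 af) r01.
  - apply: cavg_ge0 => [|z _]; last exact: powR_ge0.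
    exact: disk_cts_circle0 (analytic_powR_cts p1 af) s01.
  - exact: (subharm_mono (subharm_analytic p1 af) r0 rs s1).
apply: im_pinfty_le => // z zr.
apply: (@lsubmean_max _ (fun z => modulus (f z)) s) => //.
- exact: analytic_modulus_cts.
- exact: analytic_submean.
- by move=> w ws; exact: (im_pinfty_ge af s01 ws).
- by rewrite zr.
Qed.

End integral_means.

(** * Operator bounds, and convergence in spaces where powers of [z] damp the norm *)

Section operator_bound.
Context {R : realType}.
Local Notation C := (R[i]^o).
Implicit Types (z w c : C) (f g : C -> C) (r s t a b : R) (X : function_space R).

Definition homogeneous X := forall f a b, 0 < a -> in_space X f ->
  (space_norm X f <= b%:E)%E ->
  in_space X (fun z => a%:C%C * f z) /\ (space_norm X (fun z => a%:C%C * f z)%R <= (a * b)%:E)%E.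

Lemma weighted_compZ phi t f (a : C) :
  weighted_comp phi t (fun z => a * f z) = (fun z => a * weighted_comp phi t f z).
Proof. by apply/funext => z; rewrite /weighted_comp mulrCA. Qed.

(** [operator_norm] tests functions of norm at most [1]; scaling by [b^-1] and back carries the
    bound to all of [X]. A positive bound [b] stands in for the norm, which may vanish. *)
Lemma operator_bound X phi : homogeneous X ->
  (forall t : R, 0 <= t -> bounded_on X (weighted_comp phi t)) ->
  (ereal_sup [set operator_norm X (weighted_comp phi t) | t in `[0%R, 1%R]] < +oo)%E ->
  exists2 M : R, 1 <= M & forall t f b, 0 <= t <= 1 -> in_space X f -> 0 < b ->
    (space_norm X f <= b%:E)%E -> (space_norm X (weighted_comp phi t f) <= (M * b)%:E)%E.
Proof.
move=> hX hT; set S := ereal_sup _ => S1.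
have [M M1 SM] : exists2 M : R, 1 <= M & (S <= M%:E)%E.
  case: S S1 => [x _|//|_]; last by exists 1; rewrite ?leNye.
  by exists (Num.max 1 x); rewrite ?lee_fin le_max lexx ?orbT.
exists M => // t f b t01 Xf b0 fb.
have [Xg gb] := hX f b^-1 b (ltac:(by rewrite invr_gt0)) Xf fb.
rewrite mulVf ?gt_eqF// in gb.
have /andP[t0 _] := t01.
have K : (space_norm X (weighted_comp phi t (fun z => (b^-1)%:C%C * f z)%R) <= M%:E)%E.
  apply: le_trans SM; apply: (@le_trans _ _ (operator_norm X (weighted_comp phi t))).
    by apply: ereal_sup_ubound; exists (fun z => (b^-1)%:C%C * f z).
  by apply: ereal_sup_ubound; exists t; rewrite //= in_itv.
have E : (fun z => b%:C%C * weighted_comp phi t (fun z => (b^-1)%:C%C * f z) z) = weighted_comp phi t f.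
  rewrite weighted_compZ; apply/funext => z.
  have bb : (b%:C%C : C) * (b^-1)%:C%C = 1 by rewrite -rmorphM mulfV ?gt_eqF// rmorph1.
  by rewrite (mulrA (b%:C%C : C)) bb mul1r.
by have [_] := hX _ b M b0 ((hT t t0).1 _ Xg) K; rewrite E (mulrC b).
Qed.

Definition norm_cvg X (phi : R -> C -> C) := forall f, in_space X f -> forall e : R, 0 < e ->
  exists2 d : R, 0 < d & forall t, 0 < t < d ->
    (space_norm X (fun z => weighted_comp phi t f z - f z)%R <= e%:E)%E.

Lemma integral_mean_ge0 (p : \bar R) r f : (0 <= integral_mean p r f)%E.
Proof.
case: p => [p||] //=; first exact: poweR_ge0.
apply: (@le_trans _ _ (modulus (f (circle_point r 0)))%:E); first by rewrite lee_fin modulus_ge0.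
by apply: ereal_sup_ubound; exists 0 => //=; rewrite in_itv /= lexx mulr_ge0// pi_ge0.
Qed.

Lemma space_norm_ge0 X f : (0 <= space_norm X f)%E.
Proof.
case: X => [p|p q al|p al|p al] /=; try exact: poweR_ge0.
- apply: le_trans (integral_mean_ge0 p%:E 0 f) _; apply: ereal_sup_ubound; exists 0 => //=.
  by rewrite in_itv /= lexx ltr01.
- apply: (@le_trans _ _ (((1 - 0) `^ al)%:E * integral_mean p 0 f)%E).
    by rewrite mule_ge0 ?lee_fin ?powR_ge0// integral_mean_ge0.
  by apply: ereal_sup_ubound; exists 0 => //=; rewrite in_itv /= lexx ltr01.
Qed.

Lemma ecvg0P (T : Type) (F : set_system T) (g : T -> \bar R) : Filter F ->
  (forall x, (0 <= g x)%E) ->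
  g @ F --> (0 : \bar R)%E <-> forall e, 0 < e -> \forall x \near F, (g x <= e%:E)%E.
Proof.
move=> FF g0; split=> [H e e0|H].
  have : \forall x \near F, (g x < e%:E)%E.
    by apply: (H (fun u => (u < e%:E)%E)); apply: open_ereal_lt'; rewrite lte_fin.
  by apply: filterS => x /ltW.
apply/fine_cvgP; split.
  have := H 1 ltr01; apply: filterS => x gx.
  by rewrite ge0_fin_numE//; exact: le_lt_trans gx (ltry _).
apply/cvgrPdist_le => e e0; have := H e e0; apply: filterS => x /=.
have := g0 x; case: (g x) => [y||] //=; rewrite !lee_fin => y0 ye.
by rewrite sub0r normrN ger0_norm.
Qed.

Lemma norm_cvgP X phi : analytic_semigroup phi ->
  (forall t : R, 0 <= t -> bounded_on X (weighted_comp phi t)) ->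
  norm_cvg X phi -> strongly_continuous_semigroup X (weighted_comp phi).
Proof.
move=> hphi hT H; split=> [//|f z _ z1|t s f z t0 s0 _ z1|f Xf].
- exact: (weighted_comp0 hphi).
- exact: (weighted_compD hphi).
apply/ecvg0P => [t|e e0]; first exact: space_norm_ge0.
have [d d0 Hd] := H f Xf e e0; near=> t.
by apply: Hd; apply/andP; split; near: t; [exact: nbhs_right_gt|exact: nbhs_right_lt].
Unshelve. all: by end_near. Qed.

(** The order of quantifiers matters. [K] comes before [rho], since it decides how small the norm of
    [z ^ k * f] must be, hence [k], hence the radius [rho]. The cost [c] of the values inside that
    radius may depend on [rho], because these values tend to [0] with [t]. *)
Record damped X : Prop := Damped {
  damped_homogeneous : homogeneous X ;
  damped_dominated : exists2 K : R, 0 < K & forall rho, 0 <= rho < 1 ->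
    exists2 c, 0 < c & forall f g h a b, 0 <= a -> 0 <= b ->
      analytic_on_disk f -> in_space X g -> in_space X h ->
      (forall z, modulus z < 1 ->
        modulus (f z) <= (if modulus z < rho then a else 0) + modulus (g z) + modulus (h z)) ->
      (space_norm X g <= b%:E)%E -> (space_norm X h <= b%:E)%E ->
      (space_norm X f <= (K * (c * a + b))%:E)%E ;
  damped_powers : forall f e, in_space X f -> 0 < e -> exists k : nat,
    in_space X (fun z => z ^+ k * f z) /\ (space_norm X (fun z => z ^+ k * f z)%R <= e%:E)%E
}.

Lemma power_half (k : nat) : exists2 rho : R, 0 <= rho < 1 & forall x, rho <= x -> 1 <= 2 * x ^+ k.
Proof.
have k1 : 1 <= k.+1%:R :> R by rewrite ler1n.
have i0 : 0 < (2 * k.+1%:R)^-1 :> R by rewrite invr_gt0; lra.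
have i1 : (2 * k.+1%:R)^-1 <= 1 / 2 :> R by rewrite div1r lef_pV2 ?posrE; lra.
have ki : k%:R * (2 * k.+1%:R)^-1 <= 1 / 2 :> R.
  by rewrite ler_pdivrMr; [rewrite -(natr1 k); lra|lra].
set i := (_^-1) in i0 i1 ki; move: i i0 i1 ki => i i0 i1 ki.
exists (1 - i); first by apply/andP; split; lra.
(* Bernoulli's inequality; [k.+1] in the definition of [i] keeps the witness meaningful for
   [k = 0]. *)
move=> x rx; have B (n : nat) : 1 - n%:R * i <= (1 - i) ^+ n.
  elim: n => [|n ih]; first by rewrite expr0 mul0r subr0.
  rewrite exprS -(natr1 n); have r1 : (1 - i) ^+ n <= 1 by rewrite exprn_ile1; lra.
  by move: ih r1; move: (_ ^+ n) => y; have n0 : 0 <= n%:R :> R by []; nra.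
have : (1 - i) ^+ k <= x ^+ k by rewrite lerXn2r ?nnegrE//; lra.
by have := B k; lra.
Qed.

(* For [|z|] close to [1] both [|z ^ k|] and [|phi_t z ^ k|] are at least [1 / 2], so there
   [T_t f - f] is dominated by [T_t (z ^ k f)] and [z ^ k f]. *)
Lemma damped_cvg X phi : analytic_semigroup phi -> damped X ->
  (forall t : R, 0 <= t -> bounded_on X (weighted_comp phi t)) ->
  (ereal_sup [set operator_norm X (weighted_comp phi t) | t in `[0%R, 1%R]] < +oo)%E ->
  norm_cvg X phi.
Proof.
move=> hphi [hX [K K0 HK] Hk] hT hS f Xf e e0.
have [M M1 HM] := operator_bound hX hT hS.
(* The final bound is [3 / 4 * e]: [K * c * a] is [e / 2], and [K * M * (2 * eta)] is [e / 4]. *)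
have eta0 : 0 < e / (8 * K * M) by rewrite divr_gt0// !mulr_gt0//; lra.
set eta := e / _ in eta0.
have [k [Xk Nk]] := Hk f eta Xf eta0.
have two0 : 0 < 2 :> R by [].
have [X2 N2] := hX _ 2 eta two0 Xk Nk.
have [rho rho01 rhok] := power_half k.
have [R0 [d1 [/andP[R00 R01] d10 H1]]] := phi_modulus_ge hphi rho01.
pose R1 := Num.max R0 rho.
have R11 : 0 <= R1 < 1 by rewrite le_max R00 gt_max R01; case/andP: rho01.
have [c c0 Hc] := HK _ R11.
have a0 : 0 < e / (2 * K * c) by rewrite divr_gt0// !mulr_gt0.
set a := e / _ in a0.
have af : analytic_on_disk f by case: Xf.
have [d2 d20 H2] := weighted_comp_cvg hphi af R11 a0.
exists (Num.min 1 (Num.min d1 d2)); first by rewrite !lt_min ltr01 d10.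
move=> t; rewrite !lt_min => /and4P[t0 t1 td1 td2].
have XT := (hT t (ltW t0)).1 _ Xf.
have [aT _ _] := XT.
have X2T := (hT t (ltW t0)).1 _ X2.
have eta2 : 0 < 2 * eta by rewrite mulr_gt0.
have t01 : 0 <= t <= 1 by rewrite !ltW.
have N2T := HM t _ _ t01 X2 eta2 N2.
have b0 : 0 <= M * (2 * eta) by rewrite mulr_ge0// ltW//; lra.
have aF : analytic_on_disk (fun z => weighted_comp phi t f z - f z).
  move=> z z1; apply/cderP; eexists.
  by apply: cderB; [exact: (analytic_cder aT z1)|exact: (analytic_cder af z1)].
have := Hc _ _ _ a _ (ltW a0) b0 aF X2T X2 _ N2T.
have -> : K * (c * a + M * (2 * eta)) = e * (3 / 4).
  rewrite /a /eta; field; rewrite ?gt_eqF//; lra.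
move=> P; apply: le_trans (P _ _) _.
- move=> z z1; case: ifP => [zR|/negbT]; last rewrite -leNgt ge_max => /andP[zR0 zr].
    apply: le_trans (H2 t z _ (ltW zR)) _; first by rewrite ltW.
    by rewrite -addrA lerDl addr_ge0 ?modulus_ge0.
  rewrite add0r; apply: le_trans (modulusB _ _) _; apply: lerD.
    rewrite /weighted_comp !modulusM modulusR ger0_norm// modulusX.
    rewrite ler_wpM2l ?modulus_ge0// mulrA ler_peMl ?modulus_ge0//; apply: rhok; apply: H1; first by rewrite ltW.
    by rewrite zR0.
  rewrite !modulusM modulusR ger0_norm// modulusX mulrA ler_peMl ?modulus_ge0//.
  exact: rhok.
- apply: le_trans N2 _; rewrite lee_fin.
  by rewrite ler_peMl// ltW.
- by rewrite lee_fin; lra.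
Qed.

End operator_bound.

(** * The spaces H_0(p, oo, alpha) *)

Section little_mixed_norm.
Context {R : realType}.
Local Notation C := (R[i]^o).
Implicit Types (z w c : C) (f g : C -> C) (r s t a b : R).

Lemma analytic_scale c f : analytic_on_disk f -> analytic_on_disk (fun z => c * f z).
Proof.
move=> af z z1; apply/cderP; eexists.
by apply: cderM; [exact: cder_cst|exact: (analytic_cder af z1)].
Qed.

Lemma analytic_mul f g : analytic_on_disk f -> analytic_on_disk g ->
  analytic_on_disk (fun z => f z * g z).
Proof.
move=> af ag z z1; apply/cderP; eexists.
by apply: cderM; [exact: (analytic_cder af z1)|exact: (analytic_cder ag z1)].
Qed.

Lemma analytic_id : analytic_on_disk (fun z : C => z).
Proof. by move=> z z1; apply/cderP; exists 1; exact: cder_id. Qed.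

Lemma analytic_cst c : analytic_on_disk (fun=> c : C).
Proof. by move=> z z1; apply/cderP; exists 0; exact: cder_cst. Qed.

Lemma analytic_add f g : analytic_on_disk f -> analytic_on_disk g ->
  analytic_on_disk (fun z => f z + g z).
Proof.
move=> af ag z z1; apply/cderP; eexists.
by apply: cderD; [exact: (analytic_cder af z1)|exact: (analytic_cder ag z1)].
Qed.

Lemma analytic_sub f g : analytic_on_disk f -> analytic_on_disk g ->
  analytic_on_disk (fun z => f z - g z).
Proof.
move=> af ag z z1; apply/cderP; eexists.
by apply: cderB; [exact: (analytic_cder af z1)|exact: (analytic_cder ag z1)].
Qed.

Lemma analytic_power k f : analytic_on_disk f -> analytic_on_disk (fun z => z ^+ k * f z).
Proof.
move=> af; elim: k => [|k ih].
  by rewrite (_ : (fun z => _) = f)//; apply/funext => z; rewrite expr0 mul1r.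
rewrite (_ : (fun z => _) = (fun z => z * (z ^+ k * f z))).
  exact: (analytic_mul analytic_id ih).
by apply/funext => z; rewrite exprS mulrA.
Qed.

Lemma im_power p r k f : (1 <= p)%E -> analytic_on_disk f -> 0 <= r < 1 ->
  im p r (fun z => z ^+ k * f z) = r ^+ k * im p r f.
Proof.
move=> p1 af r01; have /andP[r0 _] := r01.
apply: (im_scale p1 (analytic_power af) af r01); first exact: exprn_ge0.
by move=> z zr; rewrite modulusM modulusX zr.
Qed.

Lemma im_scaleR p r f a : (1 <= p)%E -> analytic_on_disk f -> 0 <= r < 1 -> 0 <= a ->
  im p r (fun z => a%:C%C * f z) = a * im p r f.
Proof.
move=> p1 af r01 a0; apply: (im_scale p1 (analytic_scale af) af r01 a0).
by move=> z zr; rewrite modulusM modulusR ger0_norm.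
Qed.

Lemma small_power (rho e : R) : 0 <= rho < 1 -> 0 < e -> exists k : nat, rho ^+ k <= e.
Proof.
move=> /andP[r0 r1] e0.
have : rho ^+ n @[n --> \oo] --> (0 : R) by apply: cvg_expr; rewrite ger0_norm.
move=> /cvgrPdist_le /(_ e e0) [N _ H]; exists N.
by have := H N (leqnn N); rewrite sub0r normrN ger0_norm// exprn_ge0.
Qed.

Lemma left1P (P : R -> Prop) : (\forall r \near 1^'-, P r) <->
  exists2 d : R, 0 <= d < 1 & forall r, d < r < 1 -> P r.
Proof.
split=> [[d /= d0 H]|[d /andP[d0 d1] H]].
  exists (Num.max 0 (1 - d)); first by rewrite le_max lexx gt_max ltr01/=; lra.
  by move=> r; rewrite gt_max => /andP[/andP[r0 rd] r1]; apply: H => //=; rewrite gtr0_norm; lra.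
near=> r; apply: H; apply/andP; split; near: r; last exact: nbhs_left_lt.
exact: nbhs_left_gt.
Unshelve. all: by end_near. Qed.

Variables (p : \bar R) (al : R).
Hypotheses (p1 : (1 <= p)%E) (al0 : 0 < al).
Local Notation X := (LittleMixedNorm p al).
Local Notation v f r := ((1 - r) `^ al * im p r f).

Lemma little_val r f : analytic_on_disk f -> 0 <= r < 1 ->
  (((1 - r) `^ al)%:E * integral_mean p r f)%E = (v f r)%:E.
Proof. by move=> af r01; rewrite integral_mean_im// EFinM. Qed.

Lemma little_norm_le f b : analytic_on_disk f ->
  (space_norm X f <= b%:E)%E <-> forall r, 0 <= r < 1 -> v f r <= b.
Proof.
move=> af; split=> [H r r01|H].
  rewrite -lee_fin -little_val//; apply: le_trans H.
  by apply: ereal_sup_ubound; exists r; rewrite //= in_itv.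
apply: ge_ereal_sup => _ [r /= r01 <-]; rewrite in_itv /= in r01.
by rewrite little_val// lee_fin; exact: H.
Qed.

Lemma in_littleP f : in_space X f <-> [/\ analytic_on_disk f,
  exists b, forall r, 0 <= r < 1 -> v f r <= b &
  forall e : R, 0 < e -> exists2 d : R, 0 <= d < 1 & forall r, d < r < 1 -> v f r <= e].
Proof.
have E : forall r, (0 <= ((1 - r) `^ al)%:E * integral_mean p r f)%E.
  by move=> r; rewrite mule_ge0 ?lee_fin ?powR_ge0// integral_mean_ge0.
split=> [[af Nf Lf]|[af [b Hb] H]].
  split=> //.
    exists (fine (space_norm X f)); apply/little_norm_le => //.
    by rewrite fineK// ge0_fin_numE// space_norm_ge0.
  move=> e e0; have [d d01 H] := (left1P _).1 ((ecvg0P _ E).1 Lf e e0).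
  exists d => // r /andP[dr r1]; rewrite -lee_fin -little_val//; first by apply: H; rewrite dr.
  by rewrite r1 andbT; case/andP: d01 => d0 _; lra.
split=> //.
  by apply: le_lt_trans (ltry b); apply/little_norm_le.
apply/(ecvg0P _ E) => e e0; have [d d01 {}H] := H e e0; apply/left1P; exists d => // r dr1.
rewrite little_val ?lee_fin//; first exact: H.
by case/andP: dr1 d01 => dr -> /andP[d0 _]; rewrite andbT; lra.
Qed.

(** For the powers, the decay of the weighted means handles radii beyond some [d < 1], and
    [r ^ k <= d ^ k] handles the others. Without that decay, powers of [z] would not make the norm
    small. *)
Lemma little_damped : damped X.
Proof.
have v0 f r : analytic_on_disk f -> 0 <= r < 1 -> 0 <= v f r.
  by move=> af r01; rewrite mulr_ge0 ?powR_ge0// im_ge0.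
split.
- move=> f a b a0 /in_littleP[af [B HB] Hf] /(little_norm_le _ af) Nf.
  have afa := @analytic_scale a%:C%C f af.
  have E r : 0 <= r < 1 -> v (fun z => a%:C%C * f z) r = a * v f r.
    by move=> r01; rewrite im_scaleR// ?ltW// mulrCA.
  split.
    apply/in_littleP; split=> //.
      by exists (a * B) => r r01; rewrite E// ler_wpM2l ?HB// ltW.
    move=> e e0; have [d d01 H] := Hf (e / a) (divr_gt0 e0 a0); exists d => // r dr.
    rewrite E; first by rewrite mulrC -ler_pdivlMr//; exact: H.
    by case/andP: dr d01 => dr -> /andP[d0 _]; rewrite andbT; lra.
  by apply/little_norm_le => // r r01; rewrite E// ler_wpM2l ?Nf// ltW.
(* The factor [3] of [im_le3], doubled because [g] and [h] each contribute [b]. The weight is at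
   most [1], so [c = 1]. *)
- exists 6 => // rho rho01; exists 1 => // f g h a b a0 b0 af Xg Xh H.
  have ag : analytic_on_disk g by case: Xg.
  have ah : analytic_on_disk h by case: Xh.
  move=> /(little_norm_le _ ag) Ng /(little_norm_le _ ah) Nh.
  apply/little_norm_le => // r r01.
  have : im p r f <= 3 * (a + im p r g + im p r h).
    apply: im_le3 => // z zr; apply: le_trans (H z _) _; first by rewrite zr; case/andP: r01.
    by rewrite !lerD2r; case: ifP.
  have := Ng r r01; have := Nh r r01.
  have : 0 <= (1 - r) `^ al <= 1.
    rewrite powR_ge0 /=; have : (1 - r) `^ al <= (1 - r) `^ 0.
      by apply: ger_powR; [case/andP: r01 => ? ?; apply/andP; split; lra|exact: ltW].
    by rewrite powRr0.
  clear -a0 b0; move: (im p r f) (im p r g) (im p r h) (_ `^ _) => x y z q /andP[q0 q1] hz hy hx.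
  have := ler_wpM2l q0 hx; have : q * a <= a by rewrite ler_piMl.
  by move=> h1 h2; nra.
- move=> f e /in_littleP[af [B HB] Hf] e0.
  have [d d01 Hd] := Hf e e0.
  have B0 : 0 <= B by apply: le_trans (HB 0 _); rewrite ?v0 ?lexx ?ltr01.
  have eB : 0 < e / (B + 1) by rewrite divr_gt0//; lra.
  have [k Hk] := small_power d01 eB.
  have afk := @analytic_power k f af.
  have E r : 0 <= r < 1 -> v (fun z => z ^+ k * f z) r = r ^+ k * v f r.
    by move=> r01; rewrite im_power// mulrCA.
  have le1 r : 0 <= r < 1 -> r ^+ k * v f r <= v f r.
    move=> r01; rewrite ler_piMl ?v0//; case/andP: r01 => r0 r1.
    by rewrite exprn_ile1// ltW.
  exists k; split.
    apply/in_littleP; split=> //.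
      by exists B => r r01; rewrite E//; apply: le_trans (le1 r r01) (HB r r01).
    move=> e' e'0; have [d' d'01 Hd'] := Hf e' e'0; exists d' => // r dr.
    have r01 : 0 <= r < 1 by case/andP: dr d'01 => dr -> /andP[d0 _]; rewrite andbT; lra.
    by rewrite E//; apply: le_trans (le1 r r01) (Hd' r dr).
  apply/little_norm_le => // r r01; rewrite E//.
  have [rd|dr] := lerP r d; last first.
    by apply: le_trans (le1 r r01) (Hd r _); rewrite dr; case/andP: r01.
  have /andP[r0 _] := r01.
  have rk : r ^+ k <= d ^+ k by rewrite lerXn2r ?nnegrE// (le_trans r0 rd).
  apply: (@le_trans _ _ (e / (B + 1) * B)).
    by apply: ler_pM; rewrite ?exprn_ge0 ?v0 ?HB//; exact: le_trans rk Hk.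
  by rewrite mulrAC ler_pdivrMr; [rewrite ler_pM2l//; lra|lra].
Qed.

End little_mixed_norm.

(** * Weighted L^q norms, a common frame for mixed norm and Bergman spaces *)

Section weighted_Lq.
Context {R : realType} (d : measure_display) (T : measurableType d).
Local Notation C := (R[i]^o).
Implicit Types (z c : C) (f g h : C -> C) (a b e : R) (y : T) (k : nat).
Variables (mu : {measure set T -> \bar R}) (D : set T) (X : function_space R).
Variables (rad w : T -> R) (m : (C -> C) -> T -> R) (q c0 : R).
Hypotheses (mD : measurable D) (muD : (mu D < +oo)%E) (q1 : 1 <= q) (c00 : 0 < c0).
Hypothesis rad01 : forall y, D y -> 0 <= rad y < 1.
Hypothesis w0 : forall y, D y -> 0 <= w y.
Hypothesis m0 : forall f y, analytic_on_disk f -> D y -> 0 <= m f y.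
Hypothesis in_XE : forall f, in_space X f <-> analytic_on_disk f /\ (space_norm X f < +oo)%E.
Hypothesis normE : forall f, analytic_on_disk f ->
  space_norm X f = ((c0%:E * \int[mu]_(y in D) (w y * m f y `^ q)%:E) `^ q^-1)%E.
Hypothesis meas : forall f, analytic_on_disk f -> measurable_fun D (fun y => w y * m f y `^ q).
Hypothesis m_le3 : forall f g h a y, analytic_on_disk f -> analytic_on_disk g ->
  analytic_on_disk h -> 0 <= a -> D y ->
  (forall z, modulus z = rad y -> modulus (f z) <= a + modulus (g z) + modulus (h z)) ->
  m f y <= 3 * (a + m g y + m h y).
Hypothesis m_scale : forall f g a y, analytic_on_disk f -> analytic_on_disk g -> 0 <= a -> D y ->
  (forall z, modulus z = rad y -> modulus (f z) = a * modulus (g z)) -> m f y = a * m g y.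
Hypothesis w_le : forall rho, 0 <= rho < 1 -> exists2 B, 0 <= B &
  forall y, D y -> rad y < rho -> w y <= B.

Local Notation J f := (fun y => (w y * m f y `^ q)%:E).
Local Notation I f := (\int[mu]_(y in D) (w y * m f y `^ q)%:E)%E.

Let q0 : 0 < q. Proof. by apply: lt_le_trans q1. Qed.

Let J0 f y : analytic_on_disk f -> D y -> (0 <= (w y * m f y `^ q)%:E)%E.
Proof. by move=> af Dy; rewrite lee_fin mulr_ge0 ?powR_ge0// w0. Qed.

Let mJ f : analytic_on_disk f -> measurable_fun D (J f).
Proof. by move=> af; apply/measurable_EFinP; exact: meas. Qed.

Let I0 f : analytic_on_disk f -> (0 <= I f)%E.
Proof. by move=> af; apply: integral_ge0 => y Dy; exact: J0. Qed.

Let root_le (x : \bar R) b : 0 <= b -> (0 <= x)%E -> ((x `^ q^-1 <= b%:E) <-> (x <= (b `^ q)%:E))%E.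
Proof.
move=> b0; case: x => [x||] //; last first.
  by rewrite poweRyr ?invr_eq0 ?gt_eqF// !leye_eq.
rewrite lee_fin poweR_EFin !lee_fin => x0.
have bE : (b `^ q) `^ q^-1 = b by rewrite -powRrM mulfV ?powRr1// gt_eqF.
have xE : (x `^ q^-1) `^ q = x by rewrite -powRrM mulVf ?powRr1// gt_eqF.
split=> H; [rewrite -xE|rewrite -bE]; apply: ge0_ler_powR;
  by rewrite ?nnegrE ?powR_ge0 ?invr_ge0 ?(ltW q0).
Qed.

Let normP f b : analytic_on_disk f -> 0 <= b ->
  (space_norm X f <= b%:E)%E <-> (I f <= (b `^ q / c0)%:E)%E.
Proof.
move=> af b0; rewrite normE//; apply: iff_trans (root_le b0 _) _.
  by rewrite mule_ge0 ?lee_fin ?(ltW c00)// I0.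
by rewrite -lee_pdivlMl// -EFinM mulrC.
Qed.

Let I_scale f g a : analytic_on_disk f -> analytic_on_disk g -> 0 <= a ->
  (forall y, D y -> m f y <= a * m g y) -> (I f <= (a `^ q)%:E * I g)%E.
Proof.
move=> af ag a0 H.
rewrite -ge0_integralZl_EFin//; [|by move=> y Dy; exact: J0|exact: mJ|exact: powR_ge0].
apply: ge0_le_integral => //; [by move=> y Dy; exact: J0|exact: mJ| |].
  by apply: measurable_funeM; exact: mJ.
move=> y Dy; rewrite -EFinM lee_fin mulrCA ler_wpM2l ?w0// -powRM ?m0//.
by apply: ge0_ler_powR; rewrite ?nnegrE ?mulr_ge0 ?m0 ?(ltW q0)//; exact: H.
Qed.

Let I_fin f : in_space X f -> (I f < +oo)%E.
Proof.
move=> /in_XE[af]; rewrite normE// => /(lty_poweRy _) H.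
have {}H := H (ltac:(by rewrite invr_eq0 gt_eqF)).
move: H; have := I0 af; case: (I f) => [x||] // _; rewrite ?ltry//.
by rewrite gt0_muley ?lte_fin// ltxx.
Qed.

(** [m f y] depends only on [|f|] on the circle of radius [rad y]: it is a circle mean for the mixed
    norm, and [|f|] at the point itself for the Bergman norm. Inside [rad y < rho] the weight is
    bounded and the measure finite, which pays for the constant [a]. As [rad y < 1], the integrands
    of [z ^ k * f] tend to [0] under that of [f], and dominated convergence applies. *)
Lemma weighted_Lq_damped : damped X.
Proof.
have inX f b : analytic_on_disk f -> (space_norm X f <= b%:E)%E -> in_space X f.
  by move=> af fb; apply/in_XE; split=> //; exact: le_lt_trans fb (ltry _).
split.
- move=> f a b a0 Xf fb; have [af _] := (in_XE f).1 Xf.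
  have afa := @analytic_scale _ a%:C%C f af.
  have b0 : 0 <= b by rewrite -lee_fin; apply: le_trans fb; exact: space_norm_ge0.
  have a00 := ltW a0.
  suff H : (space_norm X (fun z => a%:C%C * f z)%R <= (a * b)%:E)%E by split; [exact: (inX _ _ afa H)|exact: H].
  apply/normP; rewrite ?mulr_ge0//.
  apply: le_trans (I_scale (a := a) afa af a00 _) _.
  + move=> y Dy; rewrite (m_scale (a := a) afa af a00 Dy)//.
    by move=> z _; rewrite modulusM modulusR ger0_norm.
  rewrite powRM// -mulrA EFinM lee_wpmul2l ?lee_fin ?powR_ge0//; exact/normP.
(* [9 = 3 * 3] comes from [m_le3] and [powR_add3_le]; it doubles because both [g] and [h] contribute
   [b]. *)
- exists 18 => // rho rho01.
  have [B B0 HB] := w_le rho01.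
  pose v := fine (mu D).
  have v0 : 0 <= v by exact: fine_ge0.
  have vE : mu D = v%:E by rewrite fineK// ge0_fin_numE.
  (* [c' ^ q = c0 * B * v] bounds the weighted mass of the region [rad y < rho]. It may vanish, and
     [c' + 1] makes the constant positive. *)
  pose c' := (c0 * B * v) `^ q^-1.
  have c'0 : 0 <= c' by exact: powR_ge0.
  exists (c' + 1) => [|f g h a b a0 b0 af Xg Xh H]; first lra.
  have [ag _] := (in_XE g).1 Xg; have [ah _] := (in_XE h).1 Xh.
  move=> /(normP ag b0) Ig /(normP ah b0) Ih.
  have K0 : 0 <= 18 * ((c' + 1) * a + b) by rewrite mulr_ge0// addr_ge0// mulr_ge0//; lra.
  apply/normP => //.
  have mf y : D y -> w y * m f y `^ q <=
      9 `^ q * (B * a `^ q + (w y * m g y `^ q + w y * m h y `^ q)).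
    move=> Dy; have /andP[ry0 ry1] := rad01 Dy.
    pose a' := if rad y < rho then a else 0.
    have a'0 : 0 <= a' by rewrite /a'; case: ifP.
    have Hf : m f y <= 3 * (a' + m g y + m h y).
      by apply: m_le3 => // z zr; have := H z; rewrite /a' zr; exact.
    have S0 : 0 <= a' + m g y + m h y by rewrite !addr_ge0// m0.
    have wa : w y * a' `^ q <= B * a `^ q.
      rewrite /a'; case: ifP => [yr|_]; first by rewrite ler_wpM2r ?powR_ge0// HB.
      by rewrite powR0 ?gt_eqF// mulr0 mulr_ge0// powR_ge0.
    apply: (@le_trans _ _ (w y * (9 `^ q * (a' `^ q + m g y `^ q + m h y `^ q)))).
      rewrite ler_wpM2l ?w0//; apply: (@le_trans _ _ ((3 * (a' + m g y + m h y)) `^ q)).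
        by apply: ge0_ler_powR; rewrite ?nnegrE ?mulr_ge0 ?m0 ?(ltW q0).
      have -> : 9 = 3 * 3 :> R by ring.
      rewrite !powRM// -mulrA ler_wpM2l ?powR_ge0//.
      by apply: powR_add3_le; rewrite ?m0// ltW.
    by rewrite mulrCA ler_wpM2l ?powR_ge0// -addrA !mulrDr lerD2r.
  have mc : measurable_fun D (fun=> (B * a `^ q)%:E : \bar R) by exact: measurable_cst.
  have mgh : measurable_fun D (fun y => J g y + J h y)%E.
    by apply: emeasurable_funD; exact: mJ.
  have Jgh y : D y -> (0 <= J g y + J h y)%E by move=> Dy; rewrite adde_ge0 ?J0.
  have Ba0 : (0 <= (B * a `^ q)%:E)%E by rewrite lee_fin mulr_ge0 ?powR_ge0.
  have ms : measurable_fun D (fun y => (B * a `^ q)%:E + (J g y + J h y))%E.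
    exact: emeasurable_funD.
  apply: (@le_trans _ _ ((9 `^ q)%:E * ((B * a `^ q)%:E * mu D + (I g + I h)))%E).
    have Jg y : D y -> (0 <= J g y)%E by exact: J0.
    have Jh y : D y -> (0 <= J h y)%E by exact: J0.
    have <- := ge0_integralD mu mD Jg (mJ ag) Jh (mJ ah).
    have <- := @integral_cst _ _ _ mu D mD (B * a `^ q)%:E.
    have <- := ge0_integralD mu mD (fun y _ => Ba0) mc Jgh mgh.
    have sum0 y : D y -> (0 <= (B * a `^ q)%:E + (J g y + J h y))%E.
      by move=> Dy; rewrite adde_ge0// Jgh.
    have <- := ge0_integralZl_EFin mu mD sum0 ms (powR_ge0 9 q).
    apply: ge0_le_integral; [exact: mD|by move=> y Dy; exact: J0|exact: mJ|exact: measurable_funeM|].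
    by move=> y Dy; rewrite -!EFinD -EFinM lee_fin; exact: mf.
  rewrite vE -EFinM.
  apply: (@le_trans _ _ ((9 `^ q)%:E * ((B * a `^ q * v)%:E + ((b `^ q / c0)%:E + (b `^ q / c0)%:E)))%E).
    apply: lee_wpmul2l; first by rewrite lee_fin powR_ge0.
    by apply: leeD2l; apply: leeD; [exact: Ig|exact: Ih].
  rewrite -!EFinD -EFinM lee_fin ler_pdivlMr//.
  have -> : 9 `^ q * (B * a `^ q * v + (b `^ q / c0 + b `^ q / c0)) * c0 =
     9 `^ q * (c0 * B * v * a `^ q + b `^ q + b `^ q) by field; rewrite gt_eqF.
  have c'q : c' `^ q = c0 * B * v.
    by rewrite /c' -powRrM mulVf ?gt_eqF// powRr1// !mulr_ge0// ltW.
  rewrite -c'q -powRM//.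
  have c'a : 0 <= c' * a by exact: mulr_ge0.
  apply: (@le_trans _ _ (9 `^ q * (c' * a + b + b) `^ q)).
    rewrite ler_wpM2l ?powR_ge0//; apply: le_trans (powR_super q1 _ _); rewrite ?addr_ge0//.
    by rewrite lerD2r powR_super.
  rewrite -powRM ?addr_ge0//; apply: ge0_ler_powR; rewrite ?nnegrE ?(ltW q0)//.
    by rewrite mulr_ge0 ?addr_ge0.
  have -> : 18 * ((c' + 1) * a + b) = 9 * (c' * a + b + b) + (9 * (c' * a) + 18 * a) by ring.
  by rewrite lerDl addr_ge0// mulr_ge0.
- move=> f e Xf e0; have [af Nf] := (in_XE f).1 Xf.
  have afk k := @analytic_power _ k f af.
  have mk k y : D y -> m (fun z => z ^+ k * f z) y = rad y ^+ k * m f y.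
    move=> Dy; apply: (m_scale (afk k) af _ Dy).
      by rewrite exprn_ge0//; case/andP: (rad01 Dy).
    by move=> z zr; rewrite modulusM modulusX zr.
  have Jk k y : D y -> w y * m (fun z => z ^+ k * f z) y `^ q <= rad y ^+ k * (w y * m f y `^ q).
    move=> Dy; have /andP[r0 r1] := rad01 Dy.
    have rk0 : 0 <= rad y ^+ k by exact: exprn_ge0.
    rewrite mk// powRM ?m0// mulrCA ler_wpM2r ?mulr_ge0 ?w0 ?powR_ge0//.
    have [->|rn] := eqVneq (rad y ^+ k) 0; first by rewrite powR0// gt_eqF.
    rewrite -[leRHS]powRr1//; apply: ger_powR => //.
    by rewrite lt_neqAle eq_sym rn rk0 exprn_ile1// ltW.
  have iJ : mu.-integrable D (J f).
    apply/integrableP; split; first exact: mJ.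
    have -> : (\int[mu]_(y in D) `|(w y * m f y `^ q)%:E| = I f)%E.
      by apply: eq_integral => y; rewrite inE => Dy; apply: gee0_abs; exact: (J0 af Dy).
    exact: (I_fin Xf).
  have [||||] := @dominated_convergence _ _ _ mu D mD
    (fun k => J (fun z => z ^+ k * f z)) (fun=> 0%E) (J f) _ _ _ iJ.
  + by move=> k; exact: (mJ (afk k)).
  + exact: measurable_cst.
  + apply: aeW => y Dy; have /andP[r0 r1] := rad01 Dy.
    have : (rad y ^+ n * (w y * m f y `^ q))%:E @[n --> \oo] --> (0 : \bar R)%E.
      apply: cvg_EFin; first by near=> n.
      rewrite [X in _ --> X](_ : _ = 0 * (w y * m f y `^ q)); last by rewrite mul0r.
      by apply: cvgMr_tmp; apply: cvg_expr; rewrite ger0_norm.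
    apply: (squeeze_cvge _ (cvg_cst 0%E)).
    by near=> n; rewrite (J0 (afk n) Dy) /= lee_fin Jk.
  + apply: aeW => y k Dy; rewrite (gee0_abs (J0 (afk k) Dy)).
    rewrite lee_fin; apply: le_trans (Jk k y Dy) _; have /andP[r0 r1] := rad01 Dy.
    by rewrite ler_piMl ?mulr_ge0 ?w0 ?powR_ge0// exprn_ile1// ltW.
  move=> _ _; rewrite integral0 => H.
  have eq0 : 0 < e `^ q / c0 by rewrite divr_gt0// powR_gt0.
  have I0k k : (0 <= I (fun z => z ^+ k * f z)%R)%E by exact: (I0 (afk k)).
  have [k _ Hk] := (ecvg0P _ I0k).1 H _ eq0.
  exists k; suff N : (space_norm X (fun z => z ^+ k * f z)%R <= e%:E)%E by split; [exact: (inX _ _ (afk k) N)|exact: N].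
  apply/(normP (afk k) (ltW e0)); exact: (Hk k (leqnn k)).
Unshelve. all: by end_near. Qed.

End weighted_Lq.

(** * The mixed norm spaces H(p, q, alpha) *)

Section mixed_norm.
Context {R : realType}.
Local Notation C := (R[i]^o).
Implicit Types (z c : C) (f g h : C -> C) (a b e r : R).
Variables (p : \bar R) (q al : R).
Hypotheses (p1 : (1 <= p)%E) (q1 : 1 <= q) (al0 : 0 < al).

Local Notation I01 := (`[0%R, 1%R[%classic : set R).

Let itv01 r : I01 r -> 0 <= r < 1.
Proof. by rewrite /= in_itv. Qed.

Lemma im_measurable f : analytic_on_disk f -> measurable_fun I01 (fun r => im p r f).
Proof.
move=> af; apply: (measurability (@RGenCInfty.G R)) => [|/= _ [_] [x] -> <-].
  exact: RGenCInfty.measurableE.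
apply: is_interval_measurable => s t /= [].
rewrite !in_itv /= !andbT => /andP[s0 s1] fs [/andP[t0 t1] ft] r /andP[sr rt].
have r0 := le_trans s0 sr; have r1 := le_lt_trans rt t1.
rewrite !in_itv /= andbT; split; first by rewrite r0.
by apply: le_trans fs _; exact: (im_mono p1 af s0 sr r1).
Qed.

(** The exponent of the weight may have either sign: for [b >= 0] the power is at most [1], for
    [b < 0] it is largest at [s], and the sum covers both cases. *)
Lemma one_sub_powR_le (t s b : R) : 0 < s -> s <= t -> t <= 1 -> t `^ b <= 1 + s `^ b.
Proof.
move=> s0 st t1; have t0 : 0 < t by exact: lt_le_trans st.
have [b0|b0] := lerP 0 b.
  apply: (@le_trans _ _ 1); last by rewrite lerDl powR_ge0.
  have -> : 1 = t `^ 0 :> R by rewrite powRr0.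
  by apply: ger_powR; rewrite ?t0.
apply: (@le_trans _ _ (s `^ b)); last by rewrite lerDr.
have E (x : R) : x `^ b = (x `^ (- b))^-1 by rewrite powRN invrK.
rewrite !E lef_pV2 ?posrE ?powR_gt0//.
by apply: ge0_ler_powR; rewrite ?nnegrE ?(ltW s0) ?(ltW t0)//; lra.
Qed.

Lemma mixed_damped : damped (MixedNorm p q al).
Proof.
have fin : (@lebesgue_measure R I01 < +oo)%E.
  by rewrite lebesgue_measure_itv /= lte_fin ltr01 -EFinB ltry.
apply: (@weighted_Lq_damped R _ _ (@lebesgue_measure R) I01 (MixedNorm p q al)
  id (fun r => (1 - r) `^ (al * q - 1)) (fun f r => im p r f) q (al * q)).
- exact: measurable_itv.
- exact: fin.
- exact: q1.
- by rewrite mulr_gt0//; exact: lt_le_trans q1.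
- by move=> r /itv01.
- by move=> r _; exact: powR_ge0.
- by move=> f r af /itv01; exact: im_ge0.
- by move=> f; split=> [[]|[]].
- move=> f af /=; congr (((_ * _) `^ _)%E); apply: eq_integral => r; rewrite inE => /itv01 r01.
  by rewrite (integral_mean_im p1 af r01) poweR_EFin.
- move=> f af; apply: measurable_funM.
    apply: (measurableT_comp (measurable_powR _)).
    by apply: measurable_funB => //; exact: measurable_id.
  by apply: (measurableT_comp (measurable_powR _)); exact: im_measurable.
- by move=> f g h a r af ag ah a0 /itv01 r01; exact: (im_le3 p1 af ag ah r01 a0).
- by move=> f g a r af ag a0 /itv01 r01; exact: (im_scale p1 af ag r01 a0).
- move=> rho /andP[rho0 rho1]; exists (1 + (1 - rho) `^ (al * q - 1)).
    by rewrite addr_ge0// powR_ge0.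
  move=> r /itv01 /andP[r0 r1] rr; apply: one_sub_powR_le; lra.
Qed.

End mixed_norm.

(** * The weighted Bergman spaces *)

Section bergman.
Context {R : realType}.
Local Notation C := (R[i]^o).
Implicit Types (z c : C) (f g h : C -> C) (a b e : R) (v : R * R).
Local Notation mu := (@lebesgue_measure R).

(** The plane carries the product sigma-algebra, so the open set is written as a countable union of
    squares with rational centres, which are measurable rectangles. *)
Lemma open_measurable_plane (A : set (R * R)) : open A -> measurable A.
Proof.
move=> oA; pose S (x y e : R) := ball x e `*` ball y e.
have -> : A = \bigcup_(x : rat) \bigcup_(y : rat) \bigcup_(n in [set n : nat |
    S (ratr x) (ratr y) n.+1%:R^-1 `<=` A]) S (ratr x) (ratr y) n.+1%:R^-1.
  apply/seteqP; split=> [[x y] Axy|v [x _ [y _ [n /= SA Sv]]]]; last exact: SA.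
  have [e /= e0 He] := (nbhs_ballP _ _).1 (oA _ Axy).
  pose n := Num.truncn (2 / e).
  have n0 : 0 < n.+1%:R^-1 :> R by rewrite invr_gt0.
  have ne : 2 * n.+1%:R^-1 < e.
    have := truncnS_gt (2 / e); rewrite -/n ltr_pdivrMr// => K.
    by rewrite ltr_pdivrMr// mulrC.
  have [i iE] : exists i : R, i = n.+1%:R^-1 by exists n.+1%:R^-1.
  rewrite -iE in n0 ne.
  have near (u : R) : exists t : rat, ball (ratr t : R) i u.
    have [|t] := @rat_in_itvoo R (u - i) (u + i); first lra.
    rewrite in_itv /= => /andP[t1 t2]; exists t; rewrite /ball /= ltr_norml; apply/andP; split; lra.
  have [s sx] := near x; have [t ty] := near y.
  exists s => //; exists t => //; exists n; rewrite /= -iE; last by split.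
  have ii : i + i <= e by lra.
  move=> [x' y'] [/= sx' ty']; apply: He; split => /=.
    by apply: (le_ball ii); apply: (ball_triangle _ sx'); exact: ball_sym.
  by apply: (le_ball ii); apply: (ball_triangle _ ty'); exact: ball_sym.
apply: bigcupT_measurable_rat => x; apply: bigcupT_measurable_rat => y.
by apply: bigcup_measurable => n _; apply: measurableX; exact: measurable_ball.
Qed.

Local Notation cplx v := (Complex v.1 v.2 : C).
Local Notation D := ([set v : R * R | unit_disk (cplx v)]).

Lemma plane_continuous (u : C -> R) v : {for cplx v, continuous u} ->
  {for v, continuous (fun v => u (cplx v))}.
Proof. by move=> cu; exact: (continuous_comp (@Complex_continuous R v) cu). Qed.

Lemma disk_cts_measurable (u : C -> R) : disk_cts u -> measurable_fun D (fun v => u (cplx v)).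
Proof.
move=> cu; apply: (measurability (@RGenOInfty.G R)) => [|/= _ [_] [x] -> <-].
  exact: RGenOInfty.measurableE.
apply: open_measurable_plane; rewrite openE => v [/= Dv].
rewrite in_itv /= andbT => xu.
have M := plane_continuous (@modulus_continuous R (cplx v)).
have U := plane_continuous (cu _ Dv).
have h1 : \forall v' \near v, modulus (cplx v') < 1 by apply: (cvgr_lt _ M).
have h2 : \forall v' \near v, x < u (cplx v') by apply: (cvgr_gt _ U).
by near=> v'; split; [near: v'|rewrite /= in_itv /= andbT; near: v'].
Unshelve. all: by end_near. Qed.

Lemma disk_measurable : measurable D.
Proof.
apply: open_measurable_plane; rewrite openE => v /= Dv.
have M := plane_continuous (@modulus_continuous R (cplx v)).
exact: (cvgr_lt _ M).
Qed.

Variables (p al : R).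
Hypothesis p1 : 1 <= p.

Local Notation I11 := (`[(-1)%R, 1%R]%classic : set R).

(** The area integral is treated directly, with [|f|] at a point in the role of the circle mean,
    rather than through the equivalent mixed norm. *)
Lemma bergman_damped : damped (Bergman p al).
Proof.
have p0 : 0 < p by apply: lt_le_trans p1.
have ipi : 0 <= pi^-1 :> R by rewrite invr_ge0 pi_ge0.
apply: (@weighted_Lq_damped R _ _ (mu \x mu)%E D (Bergman p al) (fun v => modulus (cplx v))
  (fun v => (1 - modulus (cplx v) ^+ 2) `^ al / pi) (fun f v => modulus (f (cplx v))) p 1).
- exact: disk_measurable.
- have sub : D `<=` I11 `*` I11.
    move=> [x y] /= D1; have := Re_le_modulus (Complex x y : C).
    have := Im_le_modulus (Complex x y : C); rewrite /unit_disk /= in D1 *.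
    by rewrite !in_itv /= -!ler_norml => ? ?; split; apply: le_trans (ltW D1).
  have mI : measurable I11 by exact: measurable_itv.
  have mIf : (mu I11 < +oo)%E.
    by rewrite lebesgue_measure_itv /= lte_fin; case: ifP => _; rewrite -?EFinB ltry.
  have V : ((mu \x mu) (I11 `*` I11) < +oo)%E.
    have -> := product_measure1E mu mu mI mI.
    apply: lte_mul_pinfty; [exact: measure_ge0| |exact: mIf].
    by rewrite ge0_fin_numE; [exact: mIf|exact: measure_ge0].
  exact: le_lt_trans (@le_measure _ _ _ (mu \x mu)%E _ _ (mem_set disk_measurable)
    (mem_set (measurableX mI mI)) sub) V.
- exact: p1.
- exact: ltr01.
- by move=> v Dv; rewrite modulus_ge0.
- by move=> v Dv; rewrite mulr_ge0// powR_ge0.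
- by move=> f v _ _; exact: modulus_ge0.
- by move=> f; split=> [[]|[]].
- move=> f af /=; rewrite mul1e; congr (_ `^ _)%E; apply: eq_integral => v _.
  by rewrite -mulrA mulrC.
- move=> f af; apply: measurable_funM.
    apply: measurable_funM; last exact: measurable_cst.
    apply: (measurableT_comp (measurable_powR _)).
    apply: measurable_funB; first exact: measurable_cst.
    apply: measurable_funX; apply: disk_cts_measurable => z _; exact: modulus_continuous.
  apply: (measurableT_comp (measurable_powR _)).
  by apply: (@disk_cts_measurable (fun z => modulus (f z))); exact: analytic_modulus_cts.
- move=> f g h a v _ _ _ a0 _ H; apply: le_trans (H _ erefl) _.
  have := modulus_ge0 (g (cplx v)); have := modulus_ge0 (h (cplx v)).
  by move: (modulus _) (modulus _) => x y; lra.
- by move=> f g a v _ _ _ _ H; exact: H.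
- move=> rho /andP[rho0 rho1]; exists ((1 + (1 - rho ^+ 2) `^ al) / pi).
    by rewrite mulr_ge0// addr_ge0// powR_ge0.
  move=> v Dv vr; rewrite ler_wpM2r//; have := modulus_ge0 (cplx v) => m0.
  by apply: one_sub_powR_le; nra.
Qed.

End bergman.

(** * Hardy norms and Clarkson's inequality *)

Section hardy.
Context {R : realType}.
Local Notation C := (R[i]^o).
Implicit Types (z w : C) (f g h x y : C -> C) (a b c e r p q : R).

Definition pmean p r f : R := cavg (fun z => modulus (f z) `^ p) 0 r.

(** [c] bounds the [p]-th power of the norm. Pointwise inequalities between integrands then pass to
    norms without roots, also between the exponents [p] and [2 * p]. *)
Definition hardy_le p c f := forall r, 0 <= r < 1 -> pmean p r f <= c.

Lemma pmean_cts p r f : 1 <= p -> analytic_on_disk f -> 0 <= r < 1 ->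
  circle_cts (fun z => modulus (f z) `^ p) 0 r.
Proof. by move=> p1 af r01; exact: disk_cts_circle0 (analytic_powR_cts p1 af) r01. Qed.

Lemma pmean_ge0 p r f : 1 <= p -> analytic_on_disk f -> 0 <= r < 1 -> 0 <= pmean p r f.
Proof.
by move=> p1 af r01; apply: cavg_ge0 => [|z _]; [exact: pmean_cts|exact: powR_ge0].
Qed.

Lemma hardy_le_ge0 p c f : 1 <= p -> analytic_on_disk f -> hardy_le p c f -> 0 <= c.
Proof.
move=> p1 af H; have r01 : 0 <= (0 : R) < 1 by rewrite lexx ltr01.
exact: le_trans (pmean_ge0 p1 af r01) (H 0 r01).
Qed.

Lemma hardy_le_trans p c c' f : hardy_le p c f -> c <= c' -> hardy_le p c' f.
Proof. by move=> H cc r r01; exact: le_trans (H r r01) cc. Qed.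

Lemma pmean_mono p r s f : 1 <= p -> analytic_on_disk f -> 0 <= r -> r <= s -> s < 1 ->
  pmean p r f <= pmean p s f.
Proof. by move=> p1 af r0 rs s1; exact: (subharm_mono (subharm_analytic p1 af) r0 rs s1). Qed.

Lemma circle_lt1 r z : 0 <= r < 1 -> modulus (z - 0) = `|r| -> modulus z = r /\ modulus z < 1.
Proof. by move=> /andP[r0 r1]; rewrite subr0 ger0_norm// => ->. Qed.

(** The exponents differ when a product is estimated in exponent [p] through its factors in exponent
    [2 * p]. *)
Lemma pmean_comb p q r f g h (K1 K2 : R) : 1 <= p -> 1 <= q -> analytic_on_disk f ->
  analytic_on_disk g -> analytic_on_disk h -> 0 <= r < 1 ->
  (forall z, modulus z < 1 ->
    modulus (f z) `^ p <= K1 * modulus (g z) `^ q + K2 * modulus (h z) `^ q) ->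
  pmean p r f <= K1 * pmean q r g + K2 * pmean q r h.
Proof.
move=> p1 q1 af ag ah r01 H.
have cg := pmean_cts q1 ag r01; have ch := pmean_cts q1 ah r01.
have D1 := disk_ctsZ (k := K1) (analytic_powR_cts q1 ag).
have D2 := disk_ctsZ (k := K2) (analytic_powR_cts q1 ah).
rewrite /pmean -(cavgZ K1 cg) -(cavgZ K2 ch).
rewrite -cavgD; [|exact: disk_cts_circle0 D1 r01|exact: disk_cts_circle0 D2 r01].
apply: cavg_le; [exact: pmean_cts|exact: disk_cts_circle0 (disk_ctsD D1 D2) r01|].
by move=> z /(circle_lt1 r01)[_ z1]; exact: H.
Qed.

Lemma hardy_comb p q f g h (K1 K2 c d : R) : 1 <= p -> 1 <= q -> analytic_on_disk f ->
  analytic_on_disk g -> analytic_on_disk h -> 0 <= K1 -> 0 <= K2 ->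
  (forall z, modulus z < 1 ->
    modulus (f z) `^ p <= K1 * modulus (g z) `^ q + K2 * modulus (h z) `^ q) ->
  hardy_le q c g -> hardy_le q d h -> hardy_le p (K1 * c + K2 * d) f.
Proof.
move=> p1 q1 af ag ah K10 K20 H Hg Hh r r01.
apply: le_trans (pmean_comb p1 q1 af ag ah r01 H) _.
by apply: lerD; apply: ler_wpM2l => //; [exact: Hg|exact: Hh].
Qed.

Lemma hardy_dom p q f g (K c : R) : 1 <= p -> 1 <= q -> analytic_on_disk f ->
  analytic_on_disk g -> 0 <= K ->
  (forall z, modulus z < 1 -> modulus (f z) `^ p <= K * modulus (g z) `^ q) ->
  hardy_le q c g -> hardy_le p (K * c) f.
Proof.
move=> p1 q1 af ag K0 H Hg.
have := hardy_comb (K2 := 0) p1 q1 af ag ag K0 (lexx _) _ Hg Hg; rewrite mul0r addr0; apply.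
by move=> z z1; rewrite mul0r addr0; exact: H.
Qed.

Lemma powR_add2_le p a b : 1 <= p -> 0 <= a -> 0 <= b ->
  (a + b) `^ p <= 2 `^ p * a `^ p + 2 `^ p * b `^ p.
Proof.
move=> p1 a0 b0; have p0 : 0 <= p by lra.
apply: (@le_trans _ _ ((2 * Num.max a b) `^ p)).
  by apply: ge0_ler_powR; rewrite ?nnegrE ?le_max ?a0//; rewrite /Num.max; case: ltP; lra.
rewrite powRM ?le_max ?a0// -mulrDr ler_wpM2l ?powR_ge0//.
by rewrite /Num.max; case: ltP => _; rewrite ?lerDl ?lerDr powR_ge0.
Qed.

Lemma hardy_add p f g (c d : R) : 1 <= p -> analytic_on_disk f -> analytic_on_disk g ->
  hardy_le p c f -> hardy_le p d g -> hardy_le p (2 `^ p * c + 2 `^ p * d) (fun z => f z + g z).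
Proof.
move=> p1 af ag; have K := powR_ge0 2 p.
apply: (hardy_comb p1 p1 (analytic_add af ag) af ag K K) => z _.
apply: le_trans (powR_add2_le p1 (modulus_ge0 _) (modulus_ge0 _)).
by apply: ge0_ler_powR; rewrite ?nnegrE ?addr_ge0 ?modulus_ge0 ?modulusD//; lra.
Qed.

Lemma hardy_normP p f b : 1 <= p -> analytic_on_disk f -> 0 <= b ->
  (space_norm (Hardy p) f <= b%:E)%E <-> hardy_le p (b `^ p) f.
Proof.
move=> p1 af b0; have p0 : 0 < p by lra.
have E r : 0 <= r < 1 -> (integral_mean p%:E r f <= b%:E)%E <-> pmean p r f <= b `^ p.
  move=> r01; rewrite integral_meanE// lee_fin -/(pmean p r f).
  have m0 := pmean_ge0 p1 af r01.
  have bE : (b `^ p) `^ p^-1 = b by rewrite -powRrM mulfV ?powRr1// gt_eqF.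
  have xE : (pmean p r f `^ p^-1) `^ p = pmean p r f.
    by rewrite -powRrM mulVf ?powRr1// gt_eqF.
  split=> H; [rewrite -xE|rewrite -bE]; apply: ge0_ler_powR;
    by rewrite ?nnegrE ?powR_ge0 ?invr_ge0 ?(ltW p0).
split=> [H r r01|H].
  apply/(E r r01); apply: le_trans H; apply: ereal_sup_ubound.
  by exists r; rewrite //= in_itv.
apply: ge_ereal_sup => _ [r /= r01 <-]; rewrite in_itv /= in r01.
by apply/(E r r01); exact: H.
Qed.

Lemma in_hardyP p f : 1 <= p ->
  in_space (Hardy p) f <-> analytic_on_disk f /\ exists c, hardy_le p c f.
Proof.
move=> p1; have p0 : 0 < p by lra.
split=> [[af Nf _]|[af [c H]]].
  split=> [//|]; exists (fine (space_norm (Hardy p) f) `^ p).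
  have N0 := space_norm_ge0 (Hardy p) f.
  have F : space_norm (Hardy p) f \is a fin_num by rewrite ge0_fin_numE.
  by apply/(hardy_normP p1 af (fine_ge0 N0)); rewrite (fineK F).
have c0 := hardy_le_ge0 p1 af H.
have ce : c = (c `^ p^-1) `^ p by rewrite -powRrM mulVf ?powRr1// gt_eqF.
split=> [//| |//]; rewrite ce in H.
have := (hardy_normP p1 af (powR_ge0 _ _)).2 H.
by move=> K; exact: le_lt_trans K (ltry _).
Qed.

Lemma hardy_homogeneous p : 1 <= p -> homogeneous (Hardy p).
Proof.
move=> p1 f a b a0 Xf fb; have [af _] := (in_hardyP f p1).1 Xf.
have b0 : 0 <= b by rewrite -lee_fin; apply: le_trans fb; exact: space_norm_ge0.
have afa := @analytic_scale _ a%:C%C f af.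
have H : hardy_le p ((a * b) `^ p) (fun z => a%:C%C * f z).
  rewrite powRM// ?(ltW a0)//; apply: (hardy_dom p1 p1 afa af (powR_ge0 _ _)).
    by move=> z _; rewrite modulusM modulusR ger0_norm ?(ltW a0)// powRM ?modulus_ge0// ltW.
  exact: (hardy_normP p1 af b0).1 fb.
split; first by apply/(in_hardyP _ p1); split; [exact: afa|exists ((a * b) `^ p)].
by apply/(hardy_normP p1 afa); [rewrite mulr_ge0// ltW|exact: H].
Qed.

Lemma powR_midpoint p a b : 1 <= p -> 0 <= a -> 0 <= b ->
  ((a + b) / 2) `^ p <= (a `^ p + b `^ p) / 2.
Proof.
move=> p1 a0 b0; have m0 : 0 <= (a + b) / 2 by lra.
have := powR_tangent p1 m0 a0; have := powR_tangent p1 m0 b0.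
have -> : (a + b) / 2 - a = (b - a) / 2 by field.
have -> : (a + b) / 2 - b = - ((b - a) / 2) by field.
by move: (_ * _ `^ (p - 1)) => k; rewrite mulrN; lra.
Qed.

Lemma parallelogram z w : modulus (z + w) ^+ 2 + modulus (z - w) ^+ 2 =
  2 * (modulus z ^+ 2 + modulus w ^+ 2).
Proof. by rewrite !modulus_sqr; case: z w => ? ? [? ?] /=; ring. Qed.

Lemma powR_sqr p a : 0 <= a -> (a ^+ 2) `^ p = a `^ (2 * p).
Proof. by move=> a0; rewrite powRrM powR_mulrn. Qed.

(** Superadditivity of [x ^ p] on the two squares, the parallelogram law for their sum, and midpoint
    convexity of [x ^ p]. *)
Lemma clarkson p z w : 1 <= p ->
  (modulus (z + w) / 2) `^ (2 * p) + (modulus (z - w) / 2) `^ (2 * p) <=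
  (modulus z `^ (2 * p) + modulus w `^ (2 * p)) / 2.
Proof.
move=> p1; have h v : 0 <= modulus v / 2 by rewrite divr_ge0// modulus_ge0.
have s a : 0 <= a ^+ 2 by exact: sqr_ge0.
rewrite -!powR_sqr ?modulus_ge0//.
apply: le_trans (powR_super p1 (s _) (s _)) _.
have -> : (modulus (z + w) / 2) ^+ 2 + (modulus (z - w) / 2) ^+ 2 =
    (modulus z ^+ 2 + modulus w ^+ 2) / 2.
  have := parallelogram z w; move: (modulus z) (modulus w) (modulus (z + w)) (modulus (z - w)).
  by move=> A B A' B' H; rewrite !expr_div_n; lra.
exact: powR_midpoint.
Qed.

(* Uniform convexity, made effective by the monotonicity of the means: a lower bound for the
   midpoint on a single circle controls the difference on the whole disk. *)
Lemma clarkson_hardy p (L e r0 : R) x y : 1 <= p -> analytic_on_disk x -> analytic_on_disk y ->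
  hardy_le (2 * p) L x -> hardy_le (2 * p) L y -> 0 <= r0 < 1 ->
  (L - e) * 2 `^ (2 * p) <= pmean (2 * p) r0 (fun z => x z + y z) ->
  hardy_le (2 * p) (2 `^ (2 * p) * e) (fun z => x z - y z).
Proof.
move=> p1 ax ay Hx Hy /andP[r00 r01] H; have P1 : 1 <= 2 * p by lra.
set P := 2 * p in P1 H Hx Hy *.
have axy := analytic_add ax ay; have axy' := analytic_sub ax ay.
have K2 : 0 < 2 `^ P :> R by rewrite powR_gt0.
have big r : r0 <= r -> r < 1 -> pmean P r (fun z => x z - y z) <= 2 `^ P * e.
  move=> rr r1; have r01' : 0 <= r < 1 by rewrite (le_trans r00 rr).
  have A := le_trans H (pmean_mono P1 axy r00 rr r1).
  have cp := pmean_cts P1 axy r01'; have cm := pmean_cts P1 axy' r01'.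
  have cx := pmean_cts P1 ax r01'; have cy := pmean_cts P1 ay r01'.
  have : pmean P r (fun z => x z + y z) + pmean P r (fun z => x z - y z) <=
      2 `^ P / 2 * pmean P r x + 2 `^ P / 2 * pmean P r y.
    rewrite /pmean -cavgD// -!cavgZ//.
    have D1 := disk_ctsZ (k := 2 `^ P / 2) (analytic_powR_cts P1 ax).
    have D2 := disk_ctsZ (k := 2 `^ P / 2) (analytic_powR_cts P1 ay).
    have D3 := disk_ctsD (analytic_powR_cts P1 axy) (analytic_powR_cts P1 axy').
    rewrite -cavgD; [|exact: disk_cts_circle0 D1 r01'|exact: disk_cts_circle0 D2 r01'].
    apply: cavg_le; [exact: disk_cts_circle0 D3 r01'|exact: disk_cts_circle0 (disk_ctsD D1 D2) r01'|].
    move=> z _; have := clarkson (x z) (y z) p1; rewrite -/P.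
    have h (v : C) : (modulus v / 2) `^ P * 2 `^ P = modulus v `^ P.
      by rewrite -powRM ?divr_ge0 ?modulus_ge0// divfK.
    rewrite -(ler_pM2r K2) mulrDl !h => /le_trans; apply.
    by rewrite le_eqVlt; apply/orP; left; apply/eqP; field.
  have := Hx r r01'; have := Hy r r01'; move: A.
  move: (pmean _ _ _) (pmean _ _ _) (pmean _ _ _) (pmean _ _ _) (2 `^ P) K2 => A B C' D k k0.
  by move=> *; nra.
move=> r /andP[r0' r1]; have [rr|rr] := lerP r0 r; first exact: big.
apply: (@le_trans _ _ (pmean P r0 (fun z => x z - y z))); last exact: big.
exact: (pmean_mono P1 axy' r0' (ltW rr) r01).
Qed.

Lemma pmean_near p r f e : 1 <= p -> analytic_on_disk f -> 0 <= r < 1 -> 0 < e ->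
  exists2 d : R, 0 < d & forall g, analytic_on_disk g ->
    (forall z, modulus z = r -> modulus (g z - f z) <= d) -> `|pmean p r g - pmean p r f| <= e.
Proof.
move=> p1 af r01 e0; have [B B0 HB] := analytic_circle_bound af r01.
set K := p * (B + 1) `^ (p - 1).
have K0 : 0 <= K by rewrite mulr_ge0 ?powR_ge0//; lra.
have eK : 0 < e / (K + 1) by rewrite divr_gt0//; lra.
exists (Num.min 1 (e / (K + 1))) => [|g ag H]; first by rewrite lt_min ltr01.
rewrite /pmean -cavgB; [|exact: pmean_cts|exact: pmean_cts].
rewrite -[X in `|X|]subr0; apply: cavg_near.
  move=> z zr; have [_ z1] := circle_lt1 r01 zr.
  by apply: continuousB; apply: analytic_powR_cts.
move=> z zr; have [zr' z1] := circle_lt1 r01 zr; rewrite subr0.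
have := H z zr'; rewrite le_min => /andP[h1 h2].
have fB : modulus (f z) <= B by apply: HB; rewrite zr'.
have gB : modulus (g z) <= B + 1 by have := modulusD (g z - f z) (f z); rewrite subrK; lra.
apply: le_trans (powR_lip p1 (B := B + 1) _ _) _.
- by rewrite modulus_ge0.
- by rewrite modulus_ge0; lra.
rewrite -/K; have := modulus_dist (g z) (f z).
move: h2; rewrite ler_pdivlMr; last lra.
by move: (modulus (g z - f z)) (`|_|) (normr_ge0 (modulus (g z) - modulus (f z))) => s t *; nra.
Qed.

End hardy.

(** * Analytic square roots of zero-free functions on the disk *)

Section square_root.
Context {R : realType}.
Local Notation C := (R[i]^o).
Implicit Types (z w a b c : C) (f g : C -> C).

Lemma cder_inv f z c : cder f z c -> f z != 0 -> exists c', cder (fun w => (f w)^-1) z c'.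
Proof.
move=> fc fz; apply/cderP; apply: derivableV; first exact: fz.
by apply/cderP; exists c.
Qed.

Lemma sqrtc_sqr w : (sqrtc w : C) ^+ 2 = w. Proof. exact: sqr_sqrtc. Qed.

Lemma Re_sqr w : complex.Re (w ^+ 2) = complex.Re w ^+ 2 - complex.Im w ^+ 2.
Proof. by rewrite expr2; case: w => x y /=; ring. Qed.

Lemma Re_sqrtc_gt0 w : 0 < complex.Re w -> 0 < complex.Re (sqrtc w).
Proof.
move=> w0; have r0 : 0 <= complex.Re (sqrtc w) by case: w w0 => x y _ /=; exact: sqrtr_ge0.
rewrite lt_neqAle r0 andbT; apply/eqP => E.
by move: w0; rewrite -{1}(sqrtc_sqr w) Re_sqr -E expr0n /= sub0r; have := sqr_ge0 (complex.Im (sqrtc w)); lra.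
Qed.

Lemma sqr_inj_Re a b : a ^+ 2 = b ^+ 2 -> 0 < complex.Re a -> 0 < complex.Re b -> a = b.
Proof.
move=> /eqP; rewrite eqf_sqr => /orP[/eqP//|/eqP ->].
by case: b => x y /= h1 h2; exfalso; lra.
Qed.

(** Principal roots of numbers in the right half-plane lie in the sector [|y| < x]. The product of
    two such roots has positive real part, and this singles out the principal root of [a * b]. *)
Lemma sqrtcM a b : 0 < complex.Re a -> 0 < complex.Re b -> 0 < complex.Re (a * b) ->
  sqrtc (a * b) = (sqrtc a : C) * sqrtc b.
Proof.
move=> a0 b0 ab0; apply: sqr_inj_Re; [by rewrite exprMn !sqrtc_sqr|exact: Re_sqrtc_gt0|].
have := Re_sqrtc_gt0 a0; have := Re_sqrtc_gt0 b0.
move: a0 b0; rewrite -{1}(sqrtc_sqr a) -{1}(sqrtc_sqr b) !Re_sqr.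
case: (sqrtc a) (sqrtc b) => x y [u v] /= xy uv u0 x0.
have : `|y| < x by rewrite -ltr_sqr ?nnegrE ?(ltW x0)// real_normK ?num_real//; lra.
have : `|v| < u by rewrite -ltr_sqr ?nnegrE ?(ltW u0)// real_normK ?num_real//; lra.
move=> vu yx; have : `|y| * `|v| < x * u by apply: ltr_pM.
by rewrite -normrM; have := ler_norm (y * v); lra.
Qed.

Lemma cder_sqrtc a : 0 < complex.Re a -> exists c, cder (@sqrtc R : C -> C) a c.
Proof.
move=> a0; set s := sqrtc a : C; have s0 : 0 < complex.Re s by exact: Re_sqrtc_gt0.
have sm : complex.Re s <= modulus s by apply: le_trans (ler_norm _) (Re_le_modulus _).
have ns : 0 < modulus s by exact: lt_le_trans s0 sm.
exists (s + s)^-1 => e e0; set q := complex.Re s in s0 sm.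
(* As [w - a = (t - s) * (t + s)] and [|t + s| >= q], this radius gives
   [|t - s| <= e * (2 * q ^ 2)]. The error [|t - s| ^ 2 / |2 * s|] is then at most [e * |w - a|]. *)
have d0 : 0 < e * (2 * q ^+ 3) by rewrite !mulr_gt0// exprn_gt0.
exists (Num.min (complex.Re a) (e * (2 * q ^+ 3))); first by rewrite lt_min a0.
move=> w; rewrite lt_min => /andP[wa we].
have w0 : 0 < complex.Re w.
  have := Re_le_modulus (w - a); move: wa; case: (w) (a) => ? ? [? ?] /=.
  by move=> h; rewrite ler_norml => /andP[]; lra.
set t := sqrtc w : C; have t0 : 0 < complex.Re t by exact: Re_sqrtc_gt0.
have ts : q <= modulus (t + s).
  apply: le_trans (le_trans (ler_norm _) (Re_le_modulus _)); rewrite /q.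
  by case: (t) (s) t0 => ? ? [? ?] /= ?; lra.
have wE : w - a = (t - s) * (t + s) by rewrite -subr_sqr !sqrtc_sqr.
have ss : modulus (s + s) = 2 * modulus s.
  have -> : s + s = (2%:C%C : C) * s by rewrite -[X in X + X = _]mul1r -mulrDl -rmorphD.
  by rewrite modulusM modulusR ger0_norm.
have sn : s + s != 0 by rewrite -modulus_gt0 ss mulr_gt0.
have E : t - s - (s + s)^-1 * (w - a) = - ((s + s)^-1 * (t - s) * (t - s)).
  have h : (s + s)^-1 * (s + s) = 1 by rewrite mulVf.
  rewrite -[X in X - (s + s)^-1 * _]mul1r -h wE.
  by move: (s + s)^-1 => k; ring.
rewrite E modulusN !modulusM modulusV wE modulusM ss.
have d1 : modulus (t - s) * q <= e * (2 * q ^+ 3).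
  by apply: le_trans (ltW we); rewrite wE modulusM ler_wpM2l ?modulus_ge0.
have d2 : modulus (t - s) <= e * (2 * q ^+ 2).
  by rewrite -(ler_pM2r s0); apply: le_trans d1 _; rewrite exprSr !mulrA.
rewrite mulrA [_ * modulus (t + s)]mulrAC ler_wpM2r ?modulus_ge0//.
rewrite ler_pdivrMl; last by rewrite mulr_gt0.
apply: le_trans d2 _.
have -> : 2 * modulus s * (e * modulus (t + s)) = e * (2 * (modulus s * modulus (t + s))) by ring.
by rewrite ler_pM2l// ler_pM2l// expr2 ler_pM// ltW.
Qed.

Variable g : C -> C.
Hypotheses (ag : analytic_on_disk g) (g0 : forall z, modulus z < 1 -> g z != 0).

(* A square root of [g b / g a], built from principal square roots along [2 ^ n] steps. *)
Fixpoint sqrt_chain n a b : C :=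
  if n is n'.+1 then
    sqrt_chain n' a (2^-1 * (a + b)) * sqrt_chain n' (2^-1 * (a + b)) b
  else sqrtc (g b / g a).

Let modulus_half : modulus (2^-1 : C) = 2^-1.
Proof.
have -> : (2^-1 : C) = (2^-1)%:C%C by rewrite fmorphV rmorphD.
by rewrite modulusR ger0_norm// invr_ge0.
Qed.

Let mid_le a b (rho : R) : modulus a <= rho -> modulus b <= rho -> modulus (2^-1 * (a + b)) <= rho.
Proof. by move=> ha hb; rewrite modulusM modulus_half; have := modulusD a b; lra. Qed.

Let mid_distl a b : modulus (2^-1 * (a + b) - a) = 2^-1 * modulus (b - a).
Proof.
rewrite -modulus_half -modulusM; congr modulus.
have h : (2^-1 + 2^-1 : C) = 1.
  by rewrite -[X in X + X]mulr1 -mulrDr mulVf// pnatr_eq0.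
by move: (2^-1 : C) h => k h; rewrite -[X in _ - X = _](mul1r a) -h; ring.
Qed.

Let mid_distr a b : modulus (b - 2^-1 * (a + b)) = 2^-1 * modulus (b - a).
Proof. by rewrite -(modulusBC a) -mid_distl (addrC b a) modulusBC. Qed.

Lemma sqrt_chain_sqr n a b : modulus a < 1 -> modulus b < 1 ->
  sqrt_chain n a b ^+ 2 = g b / g a.
Proof.
elim: n a b => [|n ih] a b a1 b1 /=; first exact: sqrtc_sqr.
have m1 : modulus (2^-1 * (a + b)) < 1.
  apply: le_lt_trans (mid_le (rho := Num.max (modulus a) (modulus b)) _ _) _.
  - by rewrite le_max lexx.
  - by rewrite le_max lexx orbT.
  - by rewrite gt_max a1.
by rewrite exprMn !ih// [LHS]mulrC mulrA divfK// g0.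
Qed.

Lemma ratio_near (rho : R) : 0 <= rho < 1 -> exists2 d : R, 0 < d & forall a b,
  modulus a <= rho -> modulus b <= rho -> modulus (b - a) < d -> 0 < complex.Re (g b / g a).
Proof.
move=> /andP[r0 r1].
have lt1 z : modulus z <= rho -> modulus z < 1 by move=> /le_lt_trans; exact.
have [|c cr Hc] := @disk_max _ rho (fun z => - modulus (g z)) r0.
  move=> z /lt1 z1; apply: continuousN; exact: (analytic_modulus_cts ag z1).
have m0 : 0 < modulus (g c) by rewrite modulus_gt0 g0 ?lt1.
have m2 : 0 < modulus (g c) / 2 by lra.
have [d d0 Hd] := analytic_unif_cts ag r1 m2.
exists d => // a b ar br ab; have ga := Hc a ar.
have gan : g a != 0 by rewrite g0 ?lt1.
have ga0 : 0 < modulus (g a) by rewrite modulus_gt0.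
have : modulus (g b / g a - 1) <= 1 / 2.
  have -> : g b / g a - 1 = (g b - g a) / g a by rewrite mulrBl mulfV.
  rewrite modulusM modulusV ler_pdivrMr//; have := Hd a b ar ab; lra.
move=> h; have := le_trans (Re_le_modulus _) h.
by case: (g b / g a) => x y /=; rewrite ler_norml => /andP[]; lra.
Qed.

(** Once the links are shorter than [d], all ratios involved lie in the right half-plane and
    [sqrtcM] applies to each link, so a further halving changes nothing. *)
Lemma sqrt_chainS (rho d : R) n a b : (forall a b, modulus a <= rho -> modulus b <= rho ->
    modulus (b - a) < d -> 0 < complex.Re (g b / g a)) -> rho < 1 ->
  modulus a <= rho -> modulus b <= rho -> modulus (b - a) < d * 2 ^+ n ->
  sqrt_chain n.+1 a b = sqrt_chain n a b.
Proof.
move=> H r1; have lt1 z : modulus z <= rho -> modulus z < 1 by move=> /le_lt_trans; exact.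
elim: n a b => [|n ih] a b ar br ab; last first.
  have mr := mid_le ar br.
  rewrite -[LHS]/(sqrt_chain n.+1 a (2^-1 * (a + b)) * sqrt_chain n.+1 (2^-1 * (a + b)) b).
  rewrite exprS in ab.
  have h1 : modulus (2^-1 * (a + b) - a) < d * 2 ^+ n by rewrite mid_distl; lra.
  have h2 : modulus (b - 2^-1 * (a + b)) < d * 2 ^+ n by rewrite mid_distr; lra.
  by rewrite (ih _ _ ar mr h1) (ih _ _ mr br h2).
rewrite expr0 mulr1 in ab; have ab0 := modulus_ge0 (b - a).
have mr := mid_le ar br; set m := 2^-1 * (a + b) in mr *.
have E : g b / g a = g m / g a * (g b / g m) by rewrite [RHS]mulrC mulrA divfK// g0 ?lt1.
have h0 : 0 < complex.Re (g b / g a) by exact: H.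
have h1 : 0 < complex.Re (g m / g a) by apply: H => //; rewrite mid_distl; lra.
have h2 : 0 < complex.Re (g b / g m) by apply: H => //; rewrite mid_distr; lra.
by rewrite /= -/m; rewrite E in h0 *; rewrite (sqrtcM h1 h2 h0).
Qed.

(** Both endpoints are multiples of [z], so that midpoints have the same form and the induction
    closes; the case of interest is [al = 0], [be = 1]. *)
Lemma sqrt_chain_cder (rho d : R) n al be z : (forall a b, modulus a <= rho -> modulus b <= rho ->
    modulus (b - a) < d -> 0 < complex.Re (g b / g a)) -> rho < 1 ->
  modulus al <= 1 -> modulus be <= 1 -> modulus z <= rho ->
  modulus (be * z - al * z) < d * 2 ^+ n ->
  exists c, cder (fun z => sqrt_chain n (al * z) (be * z)) z c.
Proof.
move=> H r1; have lt1 w : modulus w <= rho -> modulus w < 1 by move=> /le_lt_trans; exact.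
elim: n al be => [|n ih] al be al1 be1 zr ab.
  have zz t : modulus t <= 1 -> modulus (t * z) <= rho.
    by move=> t1; rewrite modulusM; apply: le_trans zr; rewrite ler_piMl ?modulus_ge0.
  have dg t : modulus t <= 1 -> exists c, cder (fun w => g (t * w)) z c.
    move=> t1; eexists; apply: (@cder_comp _ (fun w => t * w) g).
      by apply: cderM; [exact: cder_cst|exact: cder_id].
    by apply: analytic_cder => //; apply: lt1; exact: zz.
  have [c1 h1] := dg be be1; have [c2 h2] := dg al al1.
  have [c3 h3] := cder_inv h2 (g0 (lt1 _ (zz _ al1))).
  have [|c4 h4] := @cder_sqrtc (g (be * z) / g (al * z)).
    by rewrite expr0 mulr1 in ab; apply: H => //; exact: zz.
  by eexists; exact: (cder_comp (cderM h1 h3) h4).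
have m1 := mid_le al1 be1; set ga := 2^-1 * (al + be) in m1.
have E w : 2^-1 * (al * w + be * w) = ga * w by rewrite /ga -mulrDl mulrA.
have fE : (fun z => sqrt_chain n.+1 (al * z) (be * z)) =
    (fun z => sqrt_chain n (al * z) (ga * z) * sqrt_chain n (ga * z) (be * z)).
  by apply/funext => w /=; rewrite E.
rewrite exprS in ab; have dl := mid_distl (al * z) (be * z); have dr := mid_distr (al * z) (be * z).
rewrite E in dl dr.
have [|c1 h1] := ih al ga al1 m1 zr; first by rewrite dl; lra.
have [|c2 h2] := ih ga be m1 be1 zr; first by rewrite dr; lra.
by eexists; rewrite fE; exact: (cderM h1 h2).
Qed.

(** A root of [g 0] is continued along the segment from [0] to [z] by a chain of principal roots.
    The number of halvings is chosen for each radius; since chains stabilise, two choices agree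
    wherever both apply, and the local pieces fit together. *)
Lemma analytic_square_root : exists k : C -> C, [/\ analytic_on_disk k,
  forall z, modulus z < 1 -> k z ^+ 2 = g z & 0 <= complex.Re (k 0)].
Proof.
have L1 (rho : R) : exists n : nat, 0 <= rho < 1 ->
    (forall m z, (n <= m)%N -> modulus z <= rho -> sqrt_chain m 0 z = sqrt_chain n 0 z) /\
    (forall z, modulus z <= rho -> exists c, cder (sqrt_chain n 0) z c).
  have [r01|] := boolP (0 <= rho < 1); last by exists 0%N.
  have /andP[r0 r1] := r01; have [d d0 H] := ratio_near r01.
  exists (Num.truncn (rho / d)).+1 => _; set n := (Num.truncn _).+1.
  have nd : rho < d * 2 ^+ n.
    have := truncnS_gt (rho / d); rewrite -/n ltr_pdivrMr// mulrC => h; apply: lt_trans h _.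
    by rewrite ltr_pM2l// -natrX ltr_nat ltn_expl.
  split=> [m z|z zr]; last first.
    have [|||c h] := @sqrt_chain_cder rho d n 0 1 z H r1 _ _ zr.
    - by rewrite modulus0.
    - by rewrite modulus1.
    - rewrite mul1r mul0r subr0; exact: le_lt_trans zr nd.
    exists c; rewrite (_ : sqrt_chain n 0 = fun w => sqrt_chain n (0 * w) (1 * w))//.
    by apply/funext => w; rewrite mul0r mul1r.
  move=> nm zr; rewrite -(subnK nm) addnC; elim: (m - n)%N => [|j ih]; first by rewrite addn0.
  rewrite addnS -ih; apply: (sqrt_chainS H) => //; first by rewrite modulus0.
  rewrite subr0; apply: le_lt_trans zr _; apply: lt_le_trans nd _.
  by rewrite ler_pM2l// ler_eXn2l ?leq_addr// ltr1n.
pose N (rho : R) := sval (cid (L1 rho)).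
have HN (rho : R) : 0 <= rho < 1 ->
    (forall m z, (N rho <= m)%N -> modulus z <= rho -> sqrt_chain m 0 z = sqrt_chain (N rho) 0 z) /\
    (forall z, modulus z <= rho -> exists c, cder (sqrt_chain (N rho) 0) z c).
  exact: (svalP (cid (L1 rho))).
have Nindep (r s : R) z : 0 <= r < 1 -> 0 <= s < 1 -> modulus z <= r -> modulus z <= s ->
    sqrt_chain (N r) 0 z = sqrt_chain (N s) 0 z.
  move=> /HN[hr _] /HN[hs _] zr zs.
  by rewrite -(hr (maxn (N r) (N s)))// -?(hs (maxn (N r) (N s)))// ?leq_maxl ?leq_maxr.
(* A radius strictly between [|z|] and [1] serves a whole neighbourhood of [z], as differentiability
   at [z] requires. *)
pose r z := (1 + modulus z) / 2.
have r01 z : modulus z < 1 -> 0 <= r z < 1.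
  by move=> z1; have := modulus_ge0 z; rewrite /r => ?; apply/andP; split; lra.
have zr z : modulus z < 1 -> modulus z <= r z by rewrite /r; lra.
pose k0 z := sqrtc (g 0) * sqrt_chain (N (r z)) 0 z : C.
have ak : analytic_on_disk k0.
  move=> z z1; have [_ /(_ z (zr z z1))[c hc]] := HN _ (r01 z z1).
  apply/cderP; exists (sqrtc (g 0) * c + sqrt_chain (N (r z)) 0 z * 0).
  have d0 : 0 < (1 - modulus z) / 2 by rewrite /unit_disk /= in z1; lra.
  apply: (cder_near d0 _ (cderM (cder_cst (sqrtc (g 0)) z) hc)) => w wz.
  have wr : modulus w <= r z by have := modulusD (w - z) z; rewrite subrK /r; lra.
  have w1 : modulus w < 1 by apply: le_lt_trans wr _; case/andP: (r01 z z1).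
  rewrite /k0; congr (_ * _); apply: Nindep => //; [exact: r01|exact: r01|exact: zr].
have k2 z : modulus z < 1 -> k0 z ^+ 2 = g z.
  move=> z1; have m0 : modulus (0 : C) < 1 by rewrite modulus0.
  by rewrite exprMn sqrtc_sqr sqrt_chain_sqr// mulrC divfK// g0.
(* The remaining freedom is a sign. This choice is what later forces the roots of [phi_t'] to be
   near [1] rather than [-1]. *)
have [h|h] := lerP 0 (complex.Re (k0 0)); first by exists k0.
exists (fun z => (-1) * k0 z); split=> [|z z1|].
- exact: analytic_scale.
- by rewrite mulN1r sqrrN k2.
- by rewrite mulN1r; case: (k0 0) h => x y /= x0; lra.
Qed.

End square_root.

(** * Dilates approximate in H^p *)

Section dilation.
Context {R : realType}.
Local Notation C := (R[i]^o).
Implicit Types (z w a b : C) (f g : C -> C) (u v : C -> R) (r s e p : R).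

Definition sqrt_modulus f z : R := Num.sqrt (modulus (f z)).

Lemma sqrt_modulus_ge0 f z : 0 <= sqrt_modulus f z. Proof. exact: sqrtr_ge0. Qed.

Lemma sqrt_modulus_powR p f z : sqrt_modulus f z `^ (2 * p) = modulus (f z) `^ p.
Proof. by rewrite powRrM powR_mulrn ?sqrtr_ge0// sqr_sqrtr// modulus_ge0. Qed.

Lemma sqrtr_dist (x y : R) : 0 <= x -> 0 <= y -> `|Num.sqrt x - Num.sqrt y| ^+ 2 <= `|x - y|.
Proof.
move=> x0 y0; have h : x - y = (Num.sqrt x - Num.sqrt y) * (Num.sqrt x + Num.sqrt y).
  by rewrite -subr_sqr !sqr_sqrtr.
rewrite [in leRHS]h normrM expr2 ler_wpM2l//.
have := sqrtr_ge0 x; have := sqrtr_ge0 y; move: (Num.sqrt x) (Num.sqrt y) => a b b0 a0.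
by rewrite [in leRHS]ger0_norm ?addr_ge0// ler_norml; apply/andP; split; lra.
Qed.

Lemma sqrt_modulus_cts f : analytic_on_disk f -> disk_cts (sqrt_modulus f).
Proof.
move=> af z z1; apply/cvgCR_distP => e e0.
have e2 : 0 < e ^+ 2 by rewrite exprn_gt0.
have [d d0 H] := (cvgCR_distP _ _ _).1 (analytic_modulus_cts af z1) _ e2.
exists d => // w /H {}H; rewrite -ltr_sqr ?nnegrE ?(ltW e0)//.
by apply: le_lt_trans H; apply: sqrtr_dist; exact: modulus_ge0.
Qed.

(** At a zero of [f] nothing is to be shown. Elsewhere [f / f a] stays in the right half-plane near
    [a], and its principal root is an analytic function whose modulus is [sqrt_modulus f] up to a
    constant factor. *)
Lemma sqrt_modulus_submean f : analytic_on_disk f -> lsubmean (sqrt_modulus f).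
Proof.
move=> af a a1; have [fa|fa] := eqVneq (f a) 0.
  exists (1 - modulus a) => [|s s1]; first by rewrite subr_gt0.
  rewrite {1}/sqrt_modulus fa modulus0 sqrtr0; apply: cavg_ge0 => [|z _]; last exact: sqrt_modulus_ge0.
  exact: (disk_cts_circle (sqrt_modulus_cts af) a1).
have m0 : 0 < modulus (f a) by rewrite modulus_gt0.
have [d d0 H] := (continuous_modulusP _ _).1 (analytic_disk_cts af a1) _ m0.
exists (Num.min d (1 - modulus a)); first by rewrite lt_min d0 subr_gt0.
move=> s /andP[s0]; rewrite lt_min => /andP[sd s1].
pose h z : C := sqrtc (f z / f a).
have dh z : modulus (z - a) <= s -> exists c, cder h z c.
  move=> zs; have z1 : modulus z < 1 by have := modulusD (z - a) a; rewrite subrK; lra.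
  have [|c hc] := @cder_sqrtc R (f z / f a).
    have : modulus (f z / f a - 1) < 1.
      have -> : f z / f a - 1 = (f z - f a) / f a by rewrite mulrBl mulfV.
      by rewrite modulusM modulusV ltr_pdivrMr// mul1r; apply: H; lra.
    move=> k; have := le_lt_trans (Re_le_modulus _) k.
    by case: (f z / f a) => x y /=; rewrite ltr_norml => /andP[]; lra.
  by eexists; exact: (cder_comp (cderM (analytic_cder af z1) (cder_cst (f a)^-1 z)) hc).
have hE z : modulus (h z) = (sqrt_modulus f a)^-1 * sqrt_modulus f z.
  have h2 : modulus (h z) ^+ 2 = modulus (f z) / modulus (f a).
    by rewrite -modulusX sqrtc_sqr modulusM modulusV.
  rewrite -[LHS]ger0_norm ?modulus_ge0// -sqrtr_sqr h2.
  by rewrite sqrtrM ?modulus_ge0// sqrtrV ?modulus_ge0// mulrC.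
have ha := dh a (ltac:(by rewrite subrr modulus0 ltW)).
have ca : {for a, continuous h} by case: ha => c /cder_continuous.
have := modulus_submean (ltW s0) ca (fun z zs => dh z (proj2 (andP zs))).
have sa0 : 0 < sqrt_modulus f a by rewrite sqrtr_gt0.
rewrite hE mulVf ?gt_eqF//.
have -> : cavg (fun z => modulus (h z)) a s = (sqrt_modulus f a)^-1 * cavg (sqrt_modulus f) a s.
  rewrite -cavgZ; first by apply: eq_cavg => z _; exact: hE.
  by apply: (disk_cts_circle (sqrt_modulus_cts af) a1); rewrite s0.
by rewrite ler_pdivlMl// mulr1.
Qed.

Lemma subharm_sqrt_modulus_add p f g : 1 <= p -> analytic_on_disk f -> analytic_on_disk g ->
  subharm (fun z => (2^-1 * (sqrt_modulus f z + sqrt_modulus g z)) `^ p).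
Proof.
move=> p1; have h0 (f' g' : C -> C) z : 0 <= 2^-1 * (sqrt_modulus f' z + sqrt_modulus g' z).
  by rewrite mulr_ge0 ?addr_ge0 ?sqrt_modulus_ge0// invr_ge0.
have cts f' g' : analytic_on_disk f' -> analytic_on_disk g' ->
    disk_cts (fun z => 2^-1 * (sqrt_modulus f' z + sqrt_modulus g' z)).
  by move=> af ag; apply: disk_ctsZ; apply: disk_ctsD; exact: sqrt_modulus_cts.
move=> af ag; split=> [z z1|w w1]; first by apply: continuous_powR => //; exact: cts.
have afw := analytic_rot w1 af; have agw := analytic_rot w1 ag.
have cfw := sqrt_modulus_cts afw; have cgw := sqrt_modulus_cts agw.
apply: (@lsubmean_powR _ (fun z => 2^-1 * (sqrt_modulus f (z * w) + sqrt_modulus g (z * w)))) => //.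
- exact: (cts _ _ afw agw).
- apply: (lsubmeanZ (k := 2^-1) (disk_ctsD cfw cgw)); first by rewrite invr_ge0.
  exact: (lsubmeanD cfw cgw (sqrt_modulus_submean afw) (sqrt_modulus_submean agw)).
Qed.

(** With [s = |a| + |b|], the parallelogram law writes [|a - b| ^ 2] as [(s - |a + b|) * (s + |a +
    b|) + (|a| - |b|) ^ 2], which is at most [2 * s * (t ^ 2 + d)]. The weight [th] splits this
    product into a sum. *)
Lemma modulus_sub_le a b (th : R) : 0 < th ->
  modulus (a - b) <= th * (modulus a + modulus b) +
    ((Num.sqrt (modulus a) - Num.sqrt (modulus b)) ^+ 2 +
     (modulus a + modulus b - modulus (a + b))) / th.
Proof.
move=> th0; set t := Num.sqrt _ - Num.sqrt _; set d := _ + _ - modulus (a + b).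
have d0 : 0 <= d by rewrite subr_ge0 modulusD.
have P := parallelogram a b.
have t0 : 0 <= t ^+ 2 by exact: sqr_ge0.
have hA := sqr_sqrtr (modulus_ge0 a); have hB := sqr_sqrtr (modulus_ge0 b).
have A0 := modulus_ge0 a; have B0 := modulus_ge0 b.
have m0 := modulus_ge0 (a + b).
set s := modulus a + modulus b; have s0 : 0 <= s by rewrite addr_ge0.
have key : modulus (a - b) ^+ 2 <= 2 * s * (t ^+ 2 + d).
  have E : modulus (a - b) ^+ 2 = (s - modulus (a + b)) * (s + modulus (a + b)) +
      (modulus a - modulus b) ^+ 2 by rewrite /s; move: P; lra.
  have h1 : (s - modulus (a + b)) * (s + modulus (a + b)) <= 2 * s * d.
    by rewrite mulrC -/d ler_wpM2r//; have := modulusD a b; rewrite -/s; lra.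
  have h2 : (modulus a - modulus b) ^+ 2 <= 2 * s * t ^+ 2.
    rewrite /s -hA -hB /t; move: (Num.sqrt _) (Num.sqrt _) => x y.
    by rewrite subr_sqr exprMn mulrC ler_wpM2r ?sqr_ge0//; have := sqr_ge0 (x - y); lra.
  by rewrite E mulrDr; lra.
have g0 : 0 <= t ^+ 2 + d by rewrite addr_ge0.
have x0 : 0 <= th * s by rewrite mulr_ge0// ltW.
have y0 : 0 <= (t ^+ 2 + d) / th by rewrite divr_ge0// ltW.
rewrite -ler_sqr ?nnegrE ?modulus_ge0 ?addr_ge0//; apply: le_trans key _.
have -> : 2 * s * (t ^+ 2 + d) = 2 * (th * s * ((t ^+ 2 + d) / th)) by field; rewrite gt_eqF.
by move: (th * s) (_ / th) x0 y0 => x y *; nra.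
Qed.

(* The gaps in the triangle inequality for [a, b] and in the convexity of [x ^ (2 p)] at
   [sqrt |a|, sqrt |b|] together control [|a - b|], even for [p = 1]. *)
Lemma powR_modulus_sub_le p a b (k : R) : 1 <= p -> 0 < k ->
  modulus (a - b) `^ p <= 4 `^ p * k * (modulus a `^ p + modulus b `^ p) +
    16 `^ p / k * (modulus a `^ p + modulus b `^ p -
      (2^-1 * (Num.sqrt (modulus a) + Num.sqrt (modulus b))) `^ (2 * p) -
      (modulus (a + b) / 2) `^ p).
Proof.
move=> p1 k0; have p0 : 0 < p by lra.
set th := k `^ p^-1; have th0 : 0 < th by exact: powR_gt0.
have thp : th `^ p = k by rewrite /th -powRrM mulVf ?gt_eqF// powRr1// ltW.
have := modulus_sub_le a b th0.
set al := Num.sqrt (modulus a); set be := Num.sqrt (modulus b).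
set s := modulus a + modulus b; set d := s - modulus (a + b); set t := al - be => H.
have A0 := modulus_ge0 a; have B0 := modulus_ge0 b.
have al0 : 0 <= al by exact: sqrtr_ge0.
have be0 : 0 <= be by exact: sqrtr_ge0.
have alp : al `^ (2 * p) = modulus a `^ p by rewrite powRrM powR_mulrn// sqr_sqrtr.
have bep : be `^ (2 * p) = modulus b `^ p by rewrite powRrM powR_mulrn// sqr_sqrtr.
have d0 : 0 <= d by rewrite subr_ge0 modulusD.
have s0 : 0 <= s by rewrite addr_ge0.
have t0 : 0 <= t ^+ 2 by exact: sqr_ge0.
have td0 : 0 <= t ^+ 2 + d by exact: addr_ge0.
have ths : 0 <= th * s by rewrite mulr_ge0// ltW.
have tdt : 0 <= (t ^+ 2 + d) / th by rewrite divr_ge0// ltW.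
apply: (@le_trans _ _ ((th * s + (t ^+ 2 + d) / th) `^ p)).
  by apply: ge0_ler_powR; rewrite ?nnegrE ?modulus_ge0 ?addr_ge0 ?(ltW p0).
apply: le_trans (powR_add2_le p1 ths tdt) _.
have mul2 (x y : R) : 0 <= x -> 0 <= y -> x `^ p * y `^ p = (x * y) `^ p by move=> *; rewrite powRM.
set S := modulus a `^ p + modulus b `^ p.
have T1 : 2 `^ p * (th * s) `^ p <= 4 `^ p * k * S.
  rewrite powRM ?(ltW th0)// thp mulrCA (mulrC (4 `^ p)) -(mulrA k) ler_wpM2l ?(ltW k0)//.
  apply: (@le_trans _ _ (2 `^ p * (2 `^ p * S))).
    by rewrite ler_wpM2l ?powR_ge0// mulrDr; exact: powR_add2_le.
  by rewrite mulrA mul2//; have -> : 2 * 2 = 4 :> R by ring.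
have T2 : (`|t| / 2) `^ (2 * p) <= S / 2 - (2^-1 * (al + be)) `^ (2 * p).
  have := clarkson (al%:C%C : C) be%:C%C p1.
  rewrite -rmorphD -rmorphB !modulusR (ger0_norm al0) (ger0_norm be0) ger0_norm ?addr_ge0//.
  by rewrite alp bep -/S -/t [2^-1 * _]mulrC; lra.
have T3 : (d / 2) `^ p <= S / 2 - (modulus (a + b) / 2) `^ p.
  have m0 := modulus_ge0 (a + b).
  have := powR_midpoint p1 A0 B0; rewrite -/s -/S.
  have d2 : 0 <= d / 2 by lra.
  have m2 : 0 <= modulus (a + b) / 2 by lra.
  have := powR_super p1 d2 m2; rewrite -mulrDl /d subrK; lra.
have T4 : (t ^+ 2 + d) `^ p <= 8 `^ p * ((`|t| / 2) `^ (2 * p) + (d / 2) `^ p).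
  apply: le_trans (powR_add2_le p1 t0 d0) _.
  have -> : 8 = 2 * 4 :> R by ring.
  rewrite powRM// -mulrDr -mulrA ler_wpM2l ?powR_ge0// mulrDr; apply: lerD.
    rewrite -(powR_sqr p (a := `|t| / 2)) ?divr_ge0// mul2 ?sqr_ge0//.
    have -> : 4 * (`|t| / 2) ^+ 2 = t ^+ 2 by rewrite expr_div_n real_normK ?num_real//; field.
    by [].
  rewrite mul2 ?divr_ge0//; apply: ge0_ler_powR; rewrite ?nnegrE ?(ltW p0) ?mulr_ge0 ?invr_ge0//.
  by lra.
apply: lerD => //.
have ti : th^-1 `^ p = k^-1.
  have := mul2 th^-1 th; rewrite invr_ge0 (ltW th0) mulVf ?gt_eqF// powR1 thp => h.
  by apply: (@mulIf _ k); rewrite ?gt_eqF// h// mulVf ?gt_eqF.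
have thi : 0 <= th^-1 by rewrite invr_ge0 ltW.
rewrite -(mul2 _ _ td0 thi) ti mulrA [16 `^ p / k * _]mulrAC ler_wpM2r ?invr_ge0 ?(ltW k0)//.
apply: (@le_trans _ _ (2 `^ p * (8 `^ p * ((`|t| / 2) `^ (2 * p) + (d / 2) `^ p)))).
  by rewrite ler_wpM2l ?powR_ge0.
rewrite mulrA mul2//; have -> : 2 * 8 = 16 :> R by ring.
by rewrite ler_wpM2l ?powR_ge0//; lra.
Qed.

Lemma dilation_lt1 (sg : R) z : 0 <= sg <= 1 -> modulus z < 1 -> modulus ((sg%:C%C : C) * z) < 1.
Proof.
move=> /andP[s0 s1] z1; rewrite modulusM modulusR ger0_norm//.
by apply: le_lt_trans z1; rewrite ler_piMl ?modulus_ge0.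
Qed.

Lemma analytic_dilation (sg : R) f : 0 <= sg <= 1 -> analytic_on_disk f ->
  analytic_on_disk (fun z => f (sg%:C%C * z)).
Proof.
move=> sg01 af z z1; apply/cderP; eexists.
apply: (@cder_comp _ (fun z => sg%:C%C * z) f); first by apply: cderM; [exact: cder_cst|exact: cder_id].
by apply: analytic_cder => //; exact: dilation_lt1.
Qed.

Lemma pmean_dilation p (sg : R) f r :
  pmean p r (fun z => f (sg%:C%C * z)) = pmean p (sg * r) f.
Proof.
apply: (congr1 (fun x => (2 * pi)^-1 * x)); apply: eq_iint => t _.
by rewrite !add0r circle_pointZ.
Qed.

Lemma cavg_powR_near (P B d r : R) u v : 1 <= P -> 0 <= r < 1 -> disk_cts (fun z => u z `^ P) ->
  disk_cts (fun z => v z `^ P) ->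
  (forall z, modulus z = r -> [/\ 0 <= u z <= B, 0 <= v z <= B & `|u z - v z| <= d]) ->
  `|cavg (fun z => u z `^ P) 0 r - cavg (fun z => v z `^ P) 0 r| <= P * B `^ (P - 1) * d.
Proof.
move=> P1 r01 cu cv H; have cu' := disk_cts_circle0 cu r01; have cv' := disk_cts_circle0 cv r01.
rewrite -cavgB// -[X in `|X|]subr0; apply: cavg_near.
  by move=> z zr; apply: continuousB; [exact: cu'|exact: cv'].
move=> z zr; have [zr' _] := circle_lt1 r01 zr; have [h1 h2 h3] := H z zr'.
rewrite subr0; apply: le_trans (powR_lip P1 h1 h2) _.
by apply: ler_wpM2l => //; rewrite mulr_ge0 ?powR_ge0//; lra.
Qed.

Lemma mid_bound (x y m B B' : R) : 0 <= m -> m <= x + y -> x <= B -> y <= B -> B <= B' ->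
  0 <= m / 2 <= B'.
Proof. by move=> *; apply/andP; split; lra. Qed.

(** Valid for [p = 1] too, where H^p itself is not uniformly convex. The means of [f] nearly reach
    their supremum [L] on a circle [|z| = r0], on which a dilate is uniformly close to [f]. The
    means of both midpoint functions [v ^ p] and [w ^ (2 * p)] are thus nearly [L] there, and on
    larger circles by subharmonicity, while the means of [f] and of its dilate never exceed [L].
    Both gaps in [powR_modulus_sub_le] are then small. *)
Lemma hardy_dilation_cvg p f c e : 1 <= p -> analytic_on_disk f -> hardy_le p c f -> 0 < e ->
  exists2 sg : R, 0 < sg < 1 & hardy_le p e (fun z => f z - f (sg%:C%C * z)).
Proof.
move=> p1 af Hf e0; have P1 : 1 <= 2 * p by lra.
pose A := [set pmean p r f | r in [set r : R | 0 <= r < 1]].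
have z01 : 0 <= (0 : R) < 1 by rewrite lexx ltr01.
have sA : has_sup A.
  by split; [exists (pmean p 0 f), 0|exists c => _ [r r01 <-]; exact: Hf].
pose L := sup A.
have HL : hardy_le p L f by move=> r r01; apply: (ub_le_sup sA.2); exists r.
have L0 : 0 <= L := hardy_le_ge0 p1 af HL.
have K4 : 0 < 4 `^ p :> R by rewrite powR_gt0.
have K16 : 0 < 16 `^ p :> R by rewrite powR_gt0.
(* [k] makes the term with [4 ^ p * k] at most [e / 2], as the two means sum to at most [2 * L].
   Then [ep] makes [16 ^ p / k] times the total gap [4 * ep] equal to [e / 2]. *)
pose k := e / (4 * 4 `^ p * (L + 1)).
have L1 : 0 < L + 1 by lra.
have k0 : 0 < k by rewrite divr_gt0// !mulr_gt0.
pose ep := e * k / (8 * 16 `^ p).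
have ep0 : 0 < ep by rewrite divr_gt0// mulr_gt0.
have [_ [r0 r01 <-] rL] := sup_adherent ep0 sA; rewrite -/L in rL; rewrite /= in r01.
have /andP[r00 r0lt] := r01.
have [B B0 HB] := analytic_circle_bound af r01.
(* One bound for both [|f|], taken to the power [p], and [sqrt |f|], taken to the power [2 * p]. *)
pose B1 := Num.max B (Num.sqrt B).
have BB1 : B <= B1 by rewrite le_max lexx.
have sBB1 : Num.sqrt B <= B1 by rewrite le_max lexx orbT.
pose K := p * B1 `^ (p - 1) + 2 * p * B1 `^ (2 * p - 1).
have K1 : 0 <= p * B1 `^ (p - 1) by rewrite mulr_ge0 ?powR_ge0//; lra.
have K2 : 0 <= 2 * p * B1 `^ (2 * p - 1) by rewrite mulr_ge0 ?powR_ge0//; lra.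
have K0 : 0 <= K by exact: addr_ge0.
pose d := ep / (K + 1); have d0 : 0 < d by rewrite divr_gt0//; lra.
have dK : K * d <= ep.
  by rewrite /d mulrA ler_pdivrMr; [rewrite mulrC ler_pM2l//; lra|lra].
(* [d ^ 2] is needed for [sqrt_modulus], as the square root is only Hölder continuous of order
   [1 / 2]. *)
have d2 : 0 < Num.min d (d ^+ 2) by rewrite lt_min d0 exprn_gt0.
have [q q0 Hq] := analytic_unif_cts af r0lt d2.
pose sg := Num.max (1 / 2) (1 - q / 2).
have sg0 : 1 / 2 <= sg by rewrite le_max lexx.
have sgq : 1 - q / 2 <= sg by rewrite le_max lexx orbT.
have sg1 : sg < 1 by rewrite gt_max; apply/andP; split; lra.
have sg01 : 0 <= sg <= 1 by apply/andP; split; lra.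
exists sg; first by apply/andP; split; lra.
have asg := analytic_dilation sg01 af; set g := (fun z : C => f (sg%:C%C * z)) in asg *.
have gB z : modulus z = r0 -> modulus (g z) <= B.
  move=> zr; apply: HB; rewrite modulusM modulusR ger0_norm ?zr; last lra.
  by rewrite ler_piMl//; lra.
have fg z : modulus z = r0 -> modulus (g z - f z) <= d /\ modulus (g z - f z) <= d ^+ 2.
  move=> zr; suff : modulus (g z - f z) <= Num.min d (d ^+ 2) by rewrite le_min => /andP.
  apply: Hq; first by rewrite zr.
  have -> : (sg%:C%C : C) * z - z = (sg - 1)%:C%C * z by rewrite rmorphB mulrBl mul1r.
  rewrite modulusM modulusR zr ler0_norm; last lra.
  have : - (sg - 1) * r0 <= - (sg - 1) by rewrite ler_piMr; lra.
  lra.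
have afg := analytic_add af asg; have afg' := analytic_sub af asg.
pose v z : R := modulus (f z + g z) / 2.
pose w z : R := 2^-1 * (sqrt_modulus f z + sqrt_modulus g z).
have hv : analytic_on_disk (fun z => (2^-1)%:C%C * (f z + g z)) := @analytic_scale _ _ _ afg.
have vE z : v z = modulus ((2^-1)%:C%C * (f z + g z) : C).
  by rewrite modulusM modulusR ger0_norm ?invr_ge0// mulrC.
have cv : disk_cts (fun z => v z `^ p).
  have := analytic_powR_cts p1 hv; congr disk_cts; apply/funext => z; by rewrite vE.
have sw := subharm_sqrt_modulus_add P1 af asg.
have cw : disk_cts (fun z => w z `^ (2 * p)) := sw.1.
have cf := analytic_powR_cts p1 af; have cg := analytic_powR_cts p1 asg.
have mv r : r0 <= r -> r < 1 -> L - 2 * ep <= cavg (fun z => v z `^ p) 0 r.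
  move=> rr r1; apply: (@le_trans _ _ (cavg (fun z => v z `^ p) 0 r0)); last first.
    have -> : (fun z => v z `^ p) = (fun z => modulus ((2^-1)%:C%C * (f z + g z) : C) `^ p).
      by apply/funext => z; rewrite vE.
    exact: (pmean_mono p1 hv r00 rr r1).
  have := @cavg_powR_near p B1 d r0 v (fun z => modulus (f z)) p1 r01 cv cf.
  move=> N; have {}N := N _; rewrite ler_norml in N.
  have /andP[N1 _] : - (p * B1 `^ (p - 1) * d) <=
      cavg (fun z => v z `^ p) 0 r0 - pmean p r0 f <= p * B1 `^ (p - 1) * d.
    apply: N => z zr; have := gB z zr; have := HB z; rewrite zr => /(_ (lexx _)) h1 h2.
    have f0 := modulus_ge0 (f z); have [h3 _] := fg z zr.
    have h4 := modulusD (f z) (g z); have h5 := modulus_ge0 (f z + g z).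
    split; [exact: (mid_bound h5 h4 h1 h2 BB1)|by rewrite f0 (le_trans h1)|].
    have := modulus_dist ((2^-1)%:C%C * (f z + g z) : C) (f z); rewrite -vE => /le_trans; apply.
    have -> : (2^-1)%:C%C * (f z + g z) - f z = (2^-1)%:C%C * (g z - f z).
      have h : ((2^-1)%:C%C + (2^-1)%:C%C : C) = 1.
        by rewrite -rmorphD /= (_ : 2^-1 + 2^-1 = 1 :> R)//; field.
      by move: ((2^-1)%:C%C : C) h => j h; rewrite -[X in _ - X = _](mul1r (f z)) -h; ring.
    by rewrite modulusM modulusR ger0_norm ?invr_ge0//; have := modulus_ge0 (g z - f z); lra.
  have : p * B1 `^ (p - 1) * d <= K * d by rewrite ler_wpM2r ?(ltW d0)// lerDl.
  by clear -N1 dK rL; lra.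
have mw r : r0 <= r -> r < 1 -> L - 2 * ep <= cavg (fun z => w z `^ (2 * p)) 0 r.
  move=> rr r1; apply: (@le_trans _ _ (cavg (fun z => w z `^ (2 * p)) 0 r0)); last first.
    exact: subharm_mono sw r00 rr r1.
  have cu : disk_cts (fun z => sqrt_modulus f z `^ (2 * p)).
    by have := cf; congr disk_cts; apply/funext => z; rewrite sqrt_modulus_powR.
  have := @cavg_powR_near (2 * p) B1 d r0 w (sqrt_modulus f) P1 r01 cw cu.
  move=> N; have {}N := N _; rewrite ler_norml in N.
  have /andP[N1 _] : - (2 * p * B1 `^ (2 * p - 1) * d) <= cavg (fun z => w z `^ (2 * p)) 0 r0 -
      cavg (fun z => sqrt_modulus f z `^ (2 * p)) 0 r0 <= 2 * p * B1 `^ (2 * p - 1) * d.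
    apply: N => z zr; have := gB z zr; have := HB z; rewrite zr => /(_ (lexx _)) h1 h2.
    have u0 := sqrt_modulus_ge0 f z; have v0 := sqrt_modulus_ge0 g z.
    have u1 : sqrt_modulus f z <= Num.sqrt B by exact: ler_wsqrtr.
    have v1 : sqrt_modulus g z <= Num.sqrt B by exact: ler_wsqrtr.
    have uv0 := addr_ge0 u0 v0.
    split; [by rewrite /w mulrC; exact: (mid_bound uv0 (lexx _) u1 v1 sBB1)|
      by rewrite u0 (le_trans u1)|].
    have [_ h3] := fg z zr.
    have : `|sqrt_modulus g z - sqrt_modulus f z| <= d.
      rewrite -ler_sqr ?nnegrE ?(ltW d0)//; apply: le_trans h3.
      apply: le_trans (sqrtr_dist (modulus_ge0 _) (modulus_ge0 _)) _; exact: modulus_dist.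
    by rewrite /w !ler_norml => /andP[? ?]; apply/andP; split; lra.
  have E : cavg (fun z => sqrt_modulus f z `^ (2 * p)) 0 r0 = pmean p r0 f.
    by apply: eq_cavg => z _; exact: sqrt_modulus_powR.
  have : 2 * p * B1 `^ (2 * p - 1) * d <= K * d by rewrite ler_wpM2r ?(ltW d0)// lerDr.
  by rewrite E in N1; clear -N1 dK rL; lra.
have big r : r0 <= r -> r < 1 -> pmean p r (fun z => f z - g z) <= e.
  move=> rr r1; have r01' : 0 <= r < 1 by rewrite (le_trans r00 rr).
  have cc (u : C -> R) : disk_cts u -> circle_cts u 0 r by move=> cu; exact: disk_cts_circle0.
  have cs := disk_ctsD cf cg.
  have c1 : disk_cts (fun z => (4 `^ p * k + 16 `^ p / k) * (modulus (f z) `^ p + modulus (g z) `^ p)).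
    exact: disk_ctsZ.
  have c2 := disk_ctsD cw cv.
  have c3 := @disk_ctsZ _ (- (16 `^ p / k)) _ c2.
  have : pmean p r (fun z => f z - g z) <= (4 `^ p * k + 16 `^ p / k) * (pmean p r f + pmean p r g) +
      - (16 `^ p / k) * (cavg (fun z => w z `^ (2 * p)) 0 r + cavg (fun z => v z `^ p) 0 r).
    rewrite /pmean -(cavgD (cc _ cf) (cc _ cg)) -(cavgZ _ (cc _ cs)).
    rewrite -(cavgD (cc _ cw) (cc _ cv)) -(cavgZ _ (cc _ c2)) -(cavgD (cc _ c1) (cc _ c3)).
    apply: cavg_le; [exact: pmean_cts|exact: cc (disk_ctsD c1 c3)|].
    move=> z _; apply: le_trans (powR_modulus_sub_le (f z) (g z) p1 k0) _.
    by rewrite -/(w z) -/(v z); lra.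
  have := HL r r01'.
  have : pmean p r g <= L.
    rewrite /g pmean_dilation; apply: HL; rewrite mulr_ge0//=; [|lra|by case/andP: r01'].
    by apply: le_lt_trans r1; rewrite ler_piMl//; [case/andP: r01'|lra].
  have := mv r rr r1; have := mw r rr r1.
  have F1 : 4 `^ p * k * (2 * L) <= e / 2.
    have -> : 4 `^ p * k * (2 * L) = e / 2 * (L / (L + 1)) by rewrite /k; field; rewrite !gt_eqF.
    by rewrite ler_piMr ?ler_pdivrMr//; clear -e0 L0 L1; lra.
  have F2 : 16 `^ p / k * (4 * ep) = e / 2 by rewrite /ep; field; rewrite !gt_eqF.
  have k16 : 0 < 16 `^ p / k by exact: divr_gt0.
  have k4 : 0 < 4 `^ p * k by exact: mulr_gt0.
  move: (16 `^ p / k) (4 `^ p * k) F1 F2 k16 k4 => x y F1 F2 x0 y0.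
  set m := pmean p r (fun z => f z - g z); set a := pmean p r f; set b := pmean p r g.
  set W := cavg (fun z => w z `^ (2 * p)) 0 r; set V := cavg (fun z => v z `^ p) 0 r.
  move: m a b W V => m a b W V.
  clear -F1 F2 x0 y0 => hw hv' hg hf hh; apply: le_trans hh _.
  have h1 : (y + x) * (a + b) <= (y + x) * (2 * L) by rewrite ler_wpM2l//; lra.
  have h2 : x * (2 * L - 4 * ep) <= x * (W + V) by rewrite ler_wpM2l//; lra.
  by lra.
move=> r /andP[r0' r1]; have [rr|rr] := lerP r0 r; first exact: big.
apply: (@le_trans _ _ (pmean p r0 (fun z => f z - g z))); last exact: big.
exact: (pmean_mono p1 afg' r0' (ltW rr) r0lt).
Qed.

End dilation.

(** * Uniform convexity and convergence in exponent [2 p] *)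

Section uniform_convexity.
Context {R : realType}.
Local Notation C := (R[i]^o).
Implicit Types (z w : C) (f g x y F : C -> C) (a b c d e r s t : R).

Lemma hardy_congr p c f g : (forall z, modulus z < 1 -> modulus (f z) = modulus (g z)) ->
  hardy_le p c f -> hardy_le p c g.
Proof.
move=> fg H r r01; apply: le_trans (H r r01); rewrite le_eqVlt; apply/orP; left; apply/eqP.
by apply: eq_cavg => z /(circle_lt1 r01)[_ z1]; rewrite fg.
Qed.

Lemma hardy_mid p a x y : 1 <= p -> analytic_on_disk x -> analytic_on_disk y ->
  hardy_le p a x -> hardy_le p a y -> hardy_le p a (fun z => (2^-1)%:C%C * (x z + y z)).
Proof.
move=> p1 ax ay hx hy; have h0 : 0 <= 2^-1 :> R by rewrite invr_ge0.
have am := @analytic_scale _ (2^-1)%:C%C _ (analytic_add ax ay).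
have -> : a = 2^-1 * a + 2^-1 * a by lra.
apply: (hardy_comb p1 p1 am ax ay h0 h0 _ hx hy) => z _.
rewrite modulusM modulusR ger0_norm// -mulrDr [2^-1 * (_ + _)]mulrC.
apply: le_trans (powR_midpoint p1 (modulus_ge0 _) (modulus_ge0 _)).
rewrite mulrC; apply: ge0_ler_powR; rewrite ?nnegrE ?mulr_ge0 ?addr_ge0 ?modulus_ge0//; first lra.
by rewrite ler_wpM2r// modulusD.
Qed.

Lemma pmean_scale p r a f : 1 <= p -> analytic_on_disk f -> 0 <= r < 1 -> 0 <= a ->
  pmean p r (fun z => a%:C%C * f z) = a `^ p * pmean p r f.
Proof.
move=> p1 af r01 a0; rewrite /pmean -(cavgZ _ (pmean_cts p1 af r01)).
by apply: eq_cavg => z _; rewrite modulusM modulusR ger0_norm// powRM// modulus_ge0.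
Qed.

Lemma not_hardy_le p c f : ~ hardy_le p c f -> exists2 r, 0 <= r < 1 & c < pmean p r f.
Proof.
move=> H; apply: contrapT => K; apply: H => r r01; rewrite leNgt; apply/negP => cr.
by apply: K; exists r.
Qed.

Lemma two_C : 2%:C%C = 1 + 1 :> C.
Proof. by rewrite -[2 in LHS]/(1 + 1) rmorphD /= rmorph1. Qed.

Lemma double_mid x y z : (2%:C%C : C) * ((2^-1)%:C%C * (x z + y z)) = x z + y z.
Proof. by rewrite mulrA -rmorphM /= mulfV// rmorph1 mul1r. Qed.

Variables (p : R).
Hypothesis p1 : 1 <= p.
Local Notation P := (2 * p).

Let P1 : 1 <= P. Proof. by have := p1; lra. Qed.

Let K0 : 0 < 2 `^ P :> R. Proof. by rewrite powR_gt0. Qed.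

Lemma near_double y r e : analytic_on_disk y -> 0 <= r < 1 -> 0 < e ->
  exists2 d, 0 < d & forall x, analytic_on_disk x ->
    (forall z, modulus z = r -> modulus (x z - y z) <= d) ->
    2 `^ P * (pmean P r y - e) <= pmean P r (fun z => x z + y z).
Proof.
move=> ay r01 e0; have a2 := @analytic_scale _ 2%:C%C _ ay.
have [d d0 H] := pmean_near P1 a2 r01 (mulr_gt0 K0 e0).
exists d => // x ax xy; have xy2 z : modulus z = r -> modulus (x z + y z - 2%:C%C * y z) <= d.
  move=> zr; have -> : x z + y z - 2%:C%C * y z = x z - y z.
    by rewrite two_C; ring.
  exact: xy.
have := H _ (analytic_add ax ay) xy2.
rewrite (pmean_scale P1 ay r01 (ler0n _ 2)) ler_norml => /andP[+ _].
by rewrite lerBrDr addrC mulrBr.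
Qed.

(* Clarkson's inequality shows that near-minimisers of the distance to [F] over the convex
   sets [Q m] are close together; as the [Q m] shrink to [F] locally uniformly, they are
   close to [F]. *)
Lemma mazur (Q : nat -> (C -> C) -> Prop) F c0 : analytic_on_disk F ->
  (forall m y, Q m y -> analytic_on_disk y) ->
  (forall m n y, (m <= n)%N -> Q n y -> Q m y) ->
  (forall m x y, Q m x -> Q m y -> Q m (fun z => (2^-1)%:C%C * (x z + y z))) ->
  (forall m, exists2 y, Q m y & hardy_le P c0 (fun z => y z - F z)) ->
  (forall r d, 0 <= r < 1 -> 0 < d -> exists m, forall y, Q m y ->
    forall z, modulus z = r -> modulus (y z - F z) <= d) ->
  forall e, 0 < e -> exists2 y, Q 0%N y & hardy_le P e (fun z => y z - F z).
Proof.
move=> aF Qa QS Qmid Qne Qloc e e0.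
(* [sup A] is the limit, in [2 p]-th powers, of the increasing distances from [F] to the shrinking
   sets [Q m]. *)
pose A := [set a : R | exists m, forall y a', Q m y -> hardy_le P a' (fun z => y z - F z) -> a <= a'].
have A0 : A 0.
  by exists 0%N => y a' /Qa ay; exact: hardy_le_ge0 P1 (analytic_sub ay aF).
have sA : has_sup A.
  split; first by exists 0.
  by exists c0 => a [m H]; have [y Qy hy] := Qne m; exact: H Qy hy.
set L := sup A; pose ep := e / (4 * 2 `^ P).
have ep0 : 0 < ep by rewrite divr_gt0// mulr_gt0.
have [a [m Ha] aL] := sup_adherent ep0 sA; rewrite -/L in aL.
have close n : exists2 y, Q n y & hardy_le P (L + ep) (fun z => y z - F z).
  apply: contrapT => H; have : A (L + ep).
    exists n => y a' Qy hy; rewrite leNgt; apply/negP => a'L.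
    by apply: H; exists y => //; exact: (hardy_le_trans hy (ltW a'L)).
  by move=> /(ub_le_sup sA.2); rewrite -/L; lra.
have [y Qy hy] := close m; have ay := Qa _ _ Qy; have ayF := analytic_sub ay aF.
exists y; first exact: QS (leq0n m) Qy.
move=> r r01; have e2 : 0 < e / 2 by lra.
have [d d0 Hd] := pmean_near P1 ayF r01 e2.
have [n0 Hn0] := Qloc r d r01 d0.
(* [y] is fixed before the circle [|z| = r], while [x] is chosen for it: there [x] is close to [F],
   so the mean of [y - F] is nearly that of [y - x], which Clarkson's inequality bounds. *)
have [x Qx hx] := close (maxn m n0).
have ax := Qa _ _ Qx; have axF := analytic_sub ax aF.
have Qxm := QS _ _ _ (leq_maxl m n0) Qx; have Qxn := QS _ _ _ (leq_maxr m n0) Qx.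
have Qm := Qmid _ _ _ Qy Qxm; have amF := analytic_sub (Qa _ _ Qm) aF.
have [r0 r001 hr0] : exists2 r0, 0 <= r0 < 1 &
    L - ep < pmean P r0 (fun z => (2^-1)%:C%C * (y z + x z) - F z).
  by apply: not_hardy_le => H; have := Ha _ _ Qm H; lra.
have two0 : 0 <= 2 :> R by [].
have CS : (L + ep - 2 * ep) * 2 `^ P <= pmean P r0 (fun z => (y z - F z) + (x z - F z)).
  have -> : (fun z => (y z - F z) + (x z - F z)) =
      (fun z => 2%:C%C * ((2^-1)%:C%C * (y z + x z) - F z)).
    apply/funext => z; rewrite mulrBr double_mid.
    by rewrite two_C; ring.
  by rewrite (pmean_scale P1 amF r001 two0) mulrC ler_pM2l//; lra.
have N : pmean P r (fun z => y z - F z - (x z - F z)) <= 2 `^ P * (2 * ep).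
  have h := clarkson_hardy p1 ayF axF hy hx r001 CS; exact: h r r01.
have xF z : modulus z = r -> modulus (y z - F z - (x z - F z) - (y z - F z)) <= d.
  move=> zr; have -> : y z - F z - (x z - F z) - (y z - F z) = - (x z - F z) by ring.
  by rewrite modulusN; exact: Hn0 Qxn z zr.
have eE : 2 `^ P * (2 * ep) = e / 2 by rewrite /ep; field; rewrite gt_eqF.
rewrite eE in N; have := Hd _ (analytic_sub ayF axF) xF; rewrite ler_norml => /andP[].
by move: N; set X := pmean P r _; set Y := pmean P r _; lra.
Qed.

Variables (M : R) (k phi : R -> C -> C).
Local Notation S t y := (fun z => k t z * y (phi t z)).
Hypothesis M1 : 1 <= M.
Hypothesis Sa : forall t y, 0 < t -> analytic_on_disk y -> analytic_on_disk (S t y).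
Hypothesis Sb : forall t y c, 0 < t <= 1 -> analytic_on_disk y ->
  hardy_le P c y -> hardy_le P (M * c) (S t y).
Hypothesis SD : forall t s y z, 0 < t -> 0 < s -> modulus z < 1 ->
  modulus (S (t + s) y z) = modulus (S t (S s y) z).
Hypothesis Sc : forall y, analytic_on_disk y -> forall r e, 0 <= r < 1 -> 0 < e ->
  exists2 d, 0 < d & forall t z, 0 < t < d -> modulus z <= r -> modulus (S t y z - y z) <= e.

(* At a time [s] where the norm of [S s F] is nearly the upper limit [L] of the norms along
   the orbit, later points of the orbit have no larger norm, so uniform convexity applies. *)
Lemma orbit_stable F c e s0 : analytic_on_disk F -> hardy_le P c F -> 0 < e -> 0 < s0 ->
  exists2 s, 0 < s < s0 & exists2 d, 0 < d &
    forall t, 0 < t < d -> hardy_le P e (fun z => S t (S s F) z - S s F z).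
Proof.
move=> aF hF e0 s00.
(* [inf A] is the upper limit, in [2 p]-th powers, of the norms of [S t F] as [t] tends to [0]. *)
pose A := [set a : R | exists2 d, 0 < d & forall t, 0 < t < d -> hardy_le P a (S t F)].
have iA : has_inf A.
  split; first by exists (M * c), 1 => // t /andP[t0 t1]; apply: Sb => //; rewrite t0 ltW.
  exists 0 => a [d d0 /(_ (d / 2)) H]; have d2 : 0 < d / 2 < d by apply/andP; split; lra.
  by apply: (hardy_le_ge0 P1 _ (H d2)); apply: Sa aF; lra.
set L := inf A; pose ep := e / (3 * 2 `^ P).
have ep0 : 0 < ep by rewrite divr_gt0// mulr_gt0.
have [a [d1 d10 Ha] aL] := inf_adherent ep0 iA; rewrite -/L in aL.
have hL t : 0 < t < d1 -> hardy_le P (L + ep) (S t F).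
  by move=> /Ha h; exact: hardy_le_trans h (ltW aL).
have m0 : 0 < Num.min s0 (d1 / 2) by rewrite lt_min s00; lra.
have [s s1 hs] : exists2 s, 0 < s < Num.min s0 (d1 / 2) & ~ hardy_le P (L - ep) (S s F).
  apply: contrapT => H; have : A (L - ep).
    by exists (Num.min s0 (d1 / 2)) => // t t1; apply: contrapT => K; apply: H; exists t.
  by move=> /(ge_inf iA.2); rewrite -/L; lra.
move: s1; rewrite lt_min => /and3P[s1 ss0 sd1].
exists s; first by rewrite s1.
have ay := Sa s1 aF; set y := S s F in ay hs *.
have [r0 r01 hr0] := not_hardy_le hs.
have [d2 d20 H2] := near_double ay r01 ep0.
have [d3 d30 H3] := Sc ay r01 d20.
exists (Num.min d3 (d1 / 2)) => [|t]; first by rewrite lt_min d30; lra.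
rewrite lt_min => /and3P[t0 t3 td1].
have hy : hardy_le P (L + ep) y by apply: hL; rewrite s1; lra.
have hty : hardy_le P (L + ep) (S t y).
  apply: (@hardy_congr _ _ (S (t + s) F)) => [z z1|]; first exact: (SD F t0 s1 z1).
  by apply: hL; apply/andP; split; lra.
(* The mean of [y] at [r0] exceeds [L - ep], and [near_double] loses another [ep]; relative to the
   upper bound [L + ep] the defect is [3 * ep], whence the choice of [ep]. *)
have CS : (L + ep - 3 * ep) * 2 `^ P <= pmean P r0 (fun z => S t y z + y z).
  apply: le_trans (H2 _ (Sa t0 ay) _).
    by rewrite mulrC ler_pM2l//; lra.
  by move=> z zr; apply: H3; rewrite ?t0// zr.
have -> : e = 2 `^ P * (3 * ep) by rewrite /ep; field; rewrite gt_eqF.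
exact: clarkson_hardy p1 (Sa t0 ay) ay hty hy r01 CS.
Qed.

(** [Q m] collects the functions that small [S t] move by at most [eta] and that are close to [F] on
    a disk growing with [m]. It contains some [S s F] by [orbit_stable], so [mazur] yields such a
    [y] near [F] in norm. Then [S t F - F] is [S t (F - y) + ((S t y - y) + (y - F))]; the constant
    [B] adds up the factors of two uses of [hardy_add]. *)
Lemma uniformly_convex_cvg F c e : analytic_on_disk F -> hardy_le P c F -> 0 < e ->
  exists2 d, 0 < d & forall t, 0 < t < d -> hardy_le P e (fun z => S t F z - F z).
Proof.
move=> aF hF e0; pose K : R := 2 `^ P; have K1 : 0 < K by exact: K0.
pose B := K * M + K * (K + K); have M0 : 0 < M := lt_le_trans ltr01 M1.
have B0 : 0 < B by rewrite addr_gt0 ?mulr_gt0 ?addr_gt0.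
pose eta := e / B; have eta0 : 0 < eta by exact: divr_gt0.
pose Q (m : nat) y := [/\ analytic_on_disk y,
  exists2 d, 0 < d & forall t, 0 < t < d -> hardy_le P eta (fun z => S t y z - y z) &
  forall z, modulus z <= 1 - m.+1%:R^-1 -> modulus (y z - F z) <= m.+1%:R^-1].
have i0 (m : nat) : 0 < m.+1%:R^-1 :> R by rewrite invr_gt0.
have i1 (m : nat) : m.+1%:R^-1 <= 1 :> R by rewrite invf_le1// ler1n.
have [|||||y [ay [d d0 hy] _] yF] := @mazur Q F (K * (M * c) + K * c) aF _ _ _ _ _ eta eta0.
- by move=> m y [].
- move=> m n y mn [ay hy yF]; split=> // z zm.
  have nm : n.+1%:R^-1 <= m.+1%:R^-1 :> R by rewrite lef_pV2 ?posrE// ler_nat.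
  have zn : modulus z <= 1 - n.+1%:R^-1 by apply: (le_trans zm); rewrite lerD2l lerN2; exact: nm.
  exact: le_trans (yF z zn) nm.
- move=> m x y [ax [d1 d10 hx] xF] [ay [d2 d20 hy] yF]; split.
  + exact: analytic_scale (analytic_add ax ay).
  + exists (Num.min d1 d2) => [|t]; first by rewrite lt_min d10.
    rewrite lt_min => /and3P[t0 t1 t2].
    have t01 : 0 < t < d1 by rewrite t0.
    have t02 : 0 < t < d2 by rewrite t0.
    have := hardy_mid P1 (analytic_sub (Sa t0 ax) ax) (analytic_sub (Sa t0 ay) ay) (hx t t01) (hy t t02).
    apply: hardy_congr => z _; congr modulus; ring.
  + move=> z zm; have := xF z zm; have := yF z zm.
    have -> : (2^-1)%:C%C * (x z + y z) - F z = (2^-1)%:C%C * ((x z - F z) + (y z - F z)).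
      have h : ((2^-1)%:C%C + (2^-1)%:C%C : C) = 1.
        by rewrite -rmorphD /= (_ : 2^-1 + 2^-1 = 1 :> R)//; field.
      by move: ((2^-1)%:C%C : C) h => j h; rewrite -[X in _ - X = _](mul1r (F z)) -h; ring.
    rewrite modulusM modulusR ger0_norm ?invr_ge0//.
    have := modulusD (x z - F z) (y z - F z); move: (m.+1%:R^-1 : R) => j h1 h2 h3.
    by rewrite ler_pdivrMl//; lra.
- move=> m; have r01 : 0 <= (1 - m.+1%:R^-1 : R) < 1.
    by apply/andP; split; [rewrite subr_ge0; exact: i1|rewrite ltrBlDr ltrDl; exact: i0].
  have [d d0 Hd] := Sc aF r01 (i0 m).
  have m0 : 0 < Num.min d 1 by rewrite lt_min d0 ltr01.
  have [s s1 hs] := orbit_stable aF hF eta0 m0; move: s1; rewrite lt_min => /and3P[s0 sd s1].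
  exists (S s F).
    by split; [exact: Sa s0 aF|exact: hs|move=> z; apply: Hd; rewrite s0].
  have s01 : 0 < s <= 1 by rewrite s0 ltW.
  have hN : hardy_le P c (fun z => - F z) by apply: hardy_congr hF => z _; rewrite modulusN.
  have aN : analytic_on_disk (fun z => - F z).
    have := @analytic_scale _ (-1) _ aF; congr analytic_on_disk; apply/funext => z; exact: mulN1r.
  exact: hardy_add P1 (Sa s0 aF) aN (Sb s01 aF hF) hN.
- move=> r d /andP[r0 r1] d0; have q0 : 0 < Num.min (1 - r) d by rewrite lt_min d0; lra.
  have [m mq] : exists m : nat, m.+1%:R^-1 < Num.min (1 - r) d.
    exists (Num.truncn (Num.min (1 - r) d)^-1); set q := Num.min _ _ in q0 *.
    by rewrite invf_plt ?posrE//; exact: truncnS_gt.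
  move: mq; rewrite lt_min => /andP[m1 m2]; exists m => y [_ _ yF] z zr.
  by apply: le_trans (yF z _) (ltW m2); rewrite zr lerBrDr addrC -lerBrDr ltW.
exists (Num.min d 1) => [|t]; first by rewrite lt_min d0 ltr01.
rewrite lt_min => /and3P[t0 td t1].
have t01 : 0 < t <= 1 by rewrite t0 ltW.
have t0d : 0 < t < d by rewrite t0.
have Fy : hardy_le P eta (fun z => F z - y z).
  by apply: hardy_congr yF => z _; rewrite modulusBC.
have aFy := analytic_sub aF ay.
have h1 := Sb t01 aFy Fy.
have h2 := hardy_add P1 (analytic_sub (Sa t0 ay) ay) (analytic_sub ay aF) (hy t t0d) yF.
have h3 := hardy_add P1 (Sa t0 aFy) (analytic_add (analytic_sub (Sa t0 ay) ay) (analytic_sub ay aF)) h1 h2.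
have -> : e = K * (M * eta) + K * (K * eta + K * eta) by rewrite /eta /B; field; rewrite gt_eqF.
by apply: hardy_congr h3 => z _; congr modulus; ring.
Qed.

End uniform_convexity.

(** * Strong continuity on H^p *)

Section hardy_semigroup.
Context {R : realType}.
Local Notation C := (R[i]^o).
Implicit Types (z w : C) (f g h x y F : C -> C) (a b c d e r s t : R).

Lemma hardy_sub p f g c d : 1 <= p -> analytic_on_disk f -> analytic_on_disk g ->
  hardy_le p c f -> hardy_le p d g -> hardy_le p (2 `^ p * c + 2 `^ p * d) (fun z => f z - g z).
Proof.
move=> p1 af ag hf hg.
have aN : analytic_on_disk (fun z => - g z).
  have := @analytic_scale _ (-1) _ ag; congr analytic_on_disk; apply/funext => z; exact: mulN1r.
apply: (hardy_add p1 af aN hf); apply: hardy_congr hg => z _; by rewrite modulusN.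
Qed.

Lemma hardy_bounded p f (B : R) : 1 <= p -> analytic_on_disk f ->
  (forall z, modulus z < 1 -> modulus (f z) <= B) -> hardy_le p (B `^ p) f.
Proof.
move=> p1 af fB r r01; rewrite -(cavg_cst (B `^ p) 0 r).
apply: cavg_le; [exact: pmean_cts|exact: circle_cts_cst|].
move=> z /(circle_lt1 r01)[_ z1]; have f0 := modulus_ge0 (f z); have fz := fB z z1.
apply: ge0_ler_powR; rewrite ?nnegrE//; first by apply: le_trans p1.
exact: le_trans f0 fz.
Qed.

Lemma hardy_sqr p c y g : (forall z, modulus z < 1 -> y z ^+ 2 = g z) ->
  hardy_le (2 * p) c y <-> hardy_le p c g.
Proof.
move=> yg; have E r : 0 <= r < 1 -> pmean (2 * p) r y = pmean p r g.
  move=> r01; apply: eq_cavg => z /(circle_lt1 r01)[_ z1].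
  by rewrite -yg// modulusX powR_sqr// modulus_ge0.
by split=> H r r01; [rewrite -E//|rewrite E//]; exact: H.
Qed.

(* [Re (k w)] has no zero where [k w ^ 2] is near [1], so its sign is constant on segments. *)
Lemma square_root_near1 (k g : C -> C) (rho eta : R) : analytic_on_disk k ->
  (forall z, modulus z < 1 -> k z ^+ 2 = g z) -> 0 <= complex.Re (k 0) -> 0 <= rho < 1 ->
  eta <= 1 / 2 -> (forall z, modulus z <= rho -> modulus (g z - 1) <= eta) ->
  forall z, modulus z <= rho -> modulus (k z - 1) <= eta.
Proof.
move=> ak k2 k0 /andP[r0 r1] eta2 H z zr.
have lt1 w : modulus w <= rho -> modulus w < 1 by move=> /le_lt_trans; exact.
have Rn w : modulus w <= rho -> complex.Re (k w) != 0.
  move=> wr; apply/eqP => E; have := H w wr; rewrite -k2 ?lt1// => h.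
  have := le_trans (Re_le_modulus _) h; have := Re_sqr (k w); rewrite E.
  have -> : complex.Re (k w ^+ 2 - 1) = complex.Re (k w ^+ 2) - 1 by case: (k w ^+ 2).
  rewrite ler_norml => -> /andP[]; have := sqr_ge0 (complex.Im (k w)); rewrite expr0n /=; lra.
have sz (s : R) : 0 <= s <= 1 -> modulus (s%:C%C * z) <= rho.
  move=> /andP[s0 s1]; rewrite modulusM modulusR ger0_norm//.
  by apply: le_trans zr; rewrite ler_piMl ?modulus_ge0.
have pos : 0 < complex.Re (k z).
  rewrite ltNge; apply/negP => kz.
  pose q (s : R) := complex.Re (k (s%:C%C * z)).
  have cq : {within `[0, 1], continuous q}.
    apply: continuous_in_subspaceT => s; rewrite inE /= in_itv /= => s01.
    have cp : {for s, continuous (fun s : R => s%:C%C * z : C)}.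
      apply: continuousRC => e e0; exists (e / (modulus z + 1)).
        by rewrite divr_gt0//; have := modulus_ge0 z; lra.
      move=> t; have m0 := modulus_ge0 z; rewrite ltr_pdivlMr; last lra.
      rewrite -mulrBl -rmorphB modulusM modulusR => h.
      by apply: le_lt_trans h; rewrite ler_wpM2l//; lra.
    have ck : {for (s%:C%C * z : C), continuous k}.
      by apply: analytic_disk_cts => //; apply: lt1; exact: sz.
    exact: (continuous_comp cp (continuous_comp ck (@Re_continuous R _))).
  have q0 : q 0 = complex.Re (k 0) by rewrite /q mul0r.
  have q1 : q 1 = complex.Re (k z) by rewrite /q mul1r.
  have [|s s01 qs] := @IVT R q 0 1 0 ler01 cq.
    by rewrite q0 q1 ge_min le_max k0 kz orbT.
  rewrite in_itv /= in s01.
  by have := Rn _ (sz s s01); rewrite -/(q s) qs eqxx.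
have := H z zr; rewrite -k2 ?lt1//.
have -> : k z ^+ 2 - 1 = (k z - 1) * (k z + 1) by rewrite -[X in _ - X](expr1n _ 2) subr_sqr.
rewrite modulusM; apply: le_trans; rewrite ler_peMr ?modulus_ge0//.
apply: le_trans (le_trans (ler_norm _) (Re_le_modulus _)).
by case: (k z) pos => u v /= u0; lra.
Qed.

Variables (p : R) (phi : R -> C -> C).
Hypothesis p1 : 1 <= p.
Hypothesis hphi : analytic_semigroup phi.
Hypothesis hT : forall t, 0 <= t -> bounded_on (Hardy p) (weighted_comp phi t).
Hypothesis hS : (ereal_sup [set operator_norm (Hardy p) (weighted_comp phi t)
                           | t in `[0%R, 1%R]] < +oo)%E.
Local Notation T t f := (weighted_comp phi t f).
Local Notation P := (2 * p).

Let p0 : 0 < p. Proof. exact: lt_le_trans ltr01 p1. Qed.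

Let P1 : 1 <= P. Proof. by have := p1; lra. Qed.

Lemma hardy_weighted_analytic t f c : 0 <= t -> analytic_on_disk f -> hardy_le p c f ->
  analytic_on_disk (T t f).
Proof.
move=> t0 af hf; have Xf : in_space (Hardy p) f by apply/(in_hardyP _ p1); split=> //; exists c.
by have [] := (hT t0).1 f Xf.
Qed.

Lemma hardy_weighted_bound : exists2 M : R, 1 <= M & forall t f c, 0 <= t <= 1 ->
  analytic_on_disk f -> hardy_le p c f -> hardy_le p (M * c) (T t f).
Proof.
have [M M1 HM] := operator_bound (hardy_homogeneous p1) hT hS.
have M0 : 0 <= M by apply: le_trans M1.
have Mp1 : 1 <= M `^ p by rewrite -(powRr0 M); apply: ler_powR => //; exact: ltW.
exists (M `^ p) => // t f c t01 af hf r r01; have /andP[t0 _] := t01.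
have Xf : in_space (Hardy p) f by apply/(in_hardyP _ p1); split=> //; exists c.
have aTf := hardy_weighted_analytic t0 af hf.
have c0 := hardy_le_ge0 p1 af hf.
(* [c] may be [0], whereas [operator_bound] asks for a positive bound; [c] is therefore enlarged by
   an arbitrarily small amount. *)
apply/ler_addgt0Pr => e e0.
have e1 : 0 < e / M `^ p by rewrite divr_gt0//; exact: lt_le_trans Mp1.
pose b := (c + e / M `^ p) `^ p^-1.
have ce : 0 < c + e / M `^ p by rewrite ltr_wpDl.
have b0 : 0 < b by exact: powR_gt0.
have bp : b `^ p = c + e / M `^ p by rewrite /b -powRrM mulVf ?gt_eqF// powRr1// ltW.
have Nf : (space_norm (Hardy p) f <= b%:E)%E.
  apply/(hardy_normP p1 af (ltW b0)); rewrite bp; apply: hardy_le_trans hf _.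
  by rewrite lerDl ltW.
have Mb : 0 <= M * b by rewrite mulr_ge0// ltW.
have := (hardy_normP p1 aTf Mb).1 (HM t f b t01 Xf b0 Nf) r r01.
rewrite powRM ?(ltW b0)// bp mulrDr mulrCA mulfV ?mulr1//.
by rewrite gt_eqF//; exact: lt_le_trans Mp1.
Qed.

(** [phi_t'] is [T_t 1], and boundedness of [T_t] on H^p includes analyticity of its values. *)
Lemma derive_analytic t : 0 <= t -> analytic_on_disk (fun z => derive1 (phi t) z).
Proof.
move=> t0; have a1 : analytic_on_disk (fun=> 1 : C) := @analytic_cst _ 1.
have h1 : hardy_le p (1 `^ p) (fun=> 1 : C).
  by apply: hardy_bounded => // z _; rewrite modulus1.
have := hardy_weighted_analytic t0 a1 h1; congr analytic_on_disk; apply/funext => z.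
exact: mulr1.
Qed.

(** At [t = 0] the value [1] is a genuine root of [phi_0'] on the disk, so [derive_sqrt_cvg] can
    include that time; for [t < 0] it is a default. *)
Definition derive_sqrt t : C -> C := if pselect (0 < t) is left t0 then
  sval (cid (analytic_square_root (derive_analytic (ltW t0)) (fun z => phi_derive_neq0 hphi (ltW t0))))
  else fun=> 1.

Lemma derive_sqrtP t : 0 < t -> [/\ analytic_on_disk (derive_sqrt t),
  forall z, modulus z < 1 -> derive_sqrt t z ^+ 2 = derive1 (phi t) z & 0 <= complex.Re (derive_sqrt t 0)].
Proof.
by move=> t0; rewrite /derive_sqrt; case: pselect => // t0'; case: cid.
Qed.

Lemma derive_sqrt_cvg (rho e : R) : rho < 1 -> 0 < e -> exists2 d, 0 < d &
  forall t z, 0 <= t < d -> modulus z <= rho -> modulus (derive_sqrt t z - 1) <= e.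
Proof.
move=> r1 e0; have [r0|r0] := ltP rho 0.
  by exists 1 => // t z _ zr; have := modulus_ge0 z; lra.
have e1 : 0 < Num.min e (1 / 2) by rewrite lt_min e0; lra.
have [d d0 H] := phi_derive_cvg hphi r1 e1; exists d => // t z td zr; have /andP[t0 _] := td.
have [->|tn] := eqVneq t 0.
  rewrite /derive_sqrt; case: pselect => [h|_]; first by exfalso; move: h; rewrite ltxx.
  by rewrite subrr modulus0 ltW.
have tp : 0 < t by rewrite lt_neqAle eq_sym tn.
have [ak k2 k0] := derive_sqrtP tp.
have r01 : 0 <= rho < 1 by rewrite r0.
have m2 : Num.min e (1 / 2) <= 1 / 2 by rewrite ge_min lexx orbT.
have := square_root_near1 ak k2 k0 r01 m2 (fun w => H t w td) zr.
by move=> /le_trans; apply; rewrite ge_min lexx.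
Qed.

Local Notation S t y := (fun z => derive_sqrt t z * y (phi t z)).

Lemma sqrt_semigroup_sqr t y g z : 0 < t -> modulus z < 1 ->
  (forall w, modulus w < 1 -> y w ^+ 2 = g w) -> S t y z ^+ 2 = T t g z.
Proof.
move=> t0 z1 yg; have [_ k2 _] := derive_sqrtP t0.
by rewrite exprMn k2// yg//; exact: (phi_lt1 hphi (ltW t0) z1).
Qed.

Lemma sqrt_semigroup_analytic t y : 0 < t -> analytic_on_disk y -> analytic_on_disk (S t y).
Proof.
move=> t0 ay; have [ak _ _] := derive_sqrtP t0; apply: (analytic_mul ak) => z z1.
apply/cderP; eexists; apply: (cder_comp (phi_cder hphi (ltW t0) z1)).
by apply: analytic_cder => //; exact: (phi_lt1 hphi (ltW t0) z1).
Qed.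

(** Both sides have the square [T_(t + s) (y ^ 2)] at [z], so they agree there up to sign. *)
Lemma sqrt_semigroupD t s y z : 0 < t -> 0 < s -> modulus z < 1 ->
  modulus (S (t + s) y z) = modulus (S t (S s y) z).
Proof.
move=> t0 s0 z1; have y2 w : modulus w < 1 -> y w ^+ 2 = (fun v => y v ^+ 2) w by [].
have E1 := sqrt_semigroup_sqr (addr_gt0 t0 s0) z1 y2.
have E2 := @sqrt_semigroup_sqr t (S s y) (T s (fun v => y v ^+ 2)) z t0 z1
  (fun w lt1 => sqrt_semigroup_sqr s0 lt1 y2).
have E3 := weighted_compD hphi (fun v => y v ^+ 2) (ltW t0) (ltW s0) z1.
have E : S (t + s) y z ^+ 2 = S t (S s y) z ^+ 2 := etrans E1 (etrans E3 (esym E2)).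
apply/eqP; rewrite -(eqrXn2 (n := 2)) ?modulus_ge0//; apply/eqP.
by rewrite -!modulusX E.
Qed.

Definition hardy_good f := forall e, 0 < e -> exists2 d, 0 < d &
  forall t, 0 < t < d -> hardy_le p e (fun z => T t f z - f z).

(** The difference of squares is [(S_t F - F) * (S_t F + F)]. The inequality
    [u * v <= k^-1 * v ^ 2 + k * u ^ 2] for the [p]-th powers of the moduli separates the factors:
    the sum is bounded in exponent [2 p], and the difference tends to [0]. *)
Lemma square_good F c : analytic_on_disk F -> hardy_le P c F -> hardy_good (fun z => F z ^+ 2).
Proof.
move=> aF hF e e0; have [M M1 HM] := hardy_weighted_bound.
have y2 (y : C -> C) w : modulus w < 1 -> y w ^+ 2 = (fun v => y v ^+ 2) w by [].
have a2 y : analytic_on_disk y -> analytic_on_disk (fun z => y z ^+ 2).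
  by move=> ay; exact: (analytic_mul ay ay).
have Sb t y b : 0 < t <= 1 -> analytic_on_disk y -> hardy_le P b y -> hardy_le P (M * b) (S t y).
  move=> /andP[t0 t1] ay hy; apply: (proj2 (@hardy_sqr p (M * b) (S t y) (T t (fun v => y v ^+ 2))
    (fun z lt1 => sqrt_semigroup_sqr t0 lt1 (y2 y)))).
  apply: HM; [by rewrite ltW|exact: a2|].
  exact: (proj1 (@hardy_sqr p b y (fun v => y v ^+ 2) (y2 y))).
have Sc y : analytic_on_disk y -> forall r e', 0 <= r < 1 -> 0 < e' -> exists2 d, 0 < d &
    forall t z, 0 < t < d -> modulus z <= r -> modulus (S t y z - y z) <= e'.
  move=> ay r e' r01 e'0; have [d d0 H] := mul_comp_cvg hphi ay derive_sqrt_cvg r01 e'0.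
  by exists d => // t z /andP[t0 td]; apply: H; rewrite ltW.
have c0 := hardy_le_ge0 P1 aF hF.
pose B := 2 `^ P * (M * c) + 2 `^ P * c.
have B0 : 0 <= B by rewrite addr_ge0// mulr_ge0 ?powR_ge0// mulr_ge0// (le_trans _ M1).
(* [k] is fixed first, so that the bounded factor costs [k * B <= e / 2]; the difference is then
   asked to be below [k * e / 2], which absorbs [k^-1]. *)
pose k := e / (2 * (B + 1)).
have B1 : 0 < B + 1 by exact: ltr_wpDl.
have k0 : 0 < k by rewrite divr_gt0// mulr_gt0.
have e1 : 0 < k * e / 2 by rewrite divr_gt0// mulr_gt0.
have [d d0 H] := uniformly_convex_cvg p1 M1 sqrt_semigroup_analytic Sb sqrt_semigroupD Sc aF hF e1.
exists (Num.min d 1) => [|t]; first by rewrite lt_min d0 ltr01.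
rewrite lt_min => /and3P[t0 td t1].
have t01 : 0 < t <= 1 by rewrite t0 ltW.
have t0d : 0 < t < d by rewrite t0.
have aS := sqrt_semigroup_analytic t0 aF.
have hm := H t t0d; have hp := hardy_add P1 aS aF (Sb t F c t01 aF hF) hF.
have hF2 := (hardy_sqr p c (y2 F)).1 hF.
have aD := analytic_sub (hardy_weighted_analytic (ltW t0) (a2 F aF) hF2) (a2 F aF).
have k1 : 0 <= k^-1 by rewrite invr_ge0 ltW.
have sqE a : 0 <= a -> a `^ P = (a `^ p) ^+ 2 by move=> a0; rewrite mulrC powRrM powR_mulrn ?powR_ge0.
have pw z : modulus z < 1 -> modulus (T t (fun z => F z ^+ 2) z - F z ^+ 2) `^ p <=
    k^-1 * modulus (S t F z - F z) `^ P + k * modulus (S t F z + F z) `^ P.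
  move=> z1; rewrite -(sqrt_semigroup_sqr t0 z1 (y2 F)) subr_sqr modulusM.
  rewrite powRM ?modulus_ge0// !sqE ?modulus_ge0//.
  have := powR_ge0 (modulus (S t F z - F z)) p; have := powR_ge0 (modulus (S t F z + F z)) p.
  move: (_ `^ p) (_ `^ p) => v u u0 v0.
  have E : k^-1 * (v - k * u) ^+ 2 = k^-1 * v ^+ 2 + k * u ^+ 2 - 2 * (v * u) by field; rewrite gt_eqF.
  have := mulr_ge0 k1 (sqr_ge0 (v - k * u)); rewrite E.
  have uv := mulr_ge0 v0 u0; have -> : 2 * (v * u) = v * u + v * u by ring.
  by rewrite subr_ge0 => h; apply: le_trans h; rewrite lerDl.
have := hardy_comb p1 P1 aD (analytic_sub aS aF) (analytic_add aS aF) k1 (ltW k0) pw hm hp.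
move=> /hardy_le_trans; apply.
have -> : k^-1 * (k * e / 2) = e / 2 by field; rewrite gt_eqF.
have kB : k * B <= e / 2.
  have -> : k * B = e / 2 * (B / (B + 1)) by rewrite /k; field; rewrite gt_eqF.
  by rewrite ler_piMr ?divr_ge0 ?(ltW e0)// ler_pdivrMr// mul1r lerDl.
by rewrite [leRHS]splitr lerD2l.
Qed.

(** Polarization: [f = ((f + 1) / 2) ^ 2 - ((f - 1) / 2) ^ 2], and for bounded [f] both bases are
    bounded, hence in H^(2p). *)
Lemma bounded_good f (B : R) : analytic_on_disk f ->
  (forall z, modulus z < 1 -> modulus (f z) <= B) -> hardy_good f.
Proof.
move=> af fB e e0.
have hC : (2^-1 : C) = (2^-1)%:C%C by rewrite fmorphV /= two_C.
have ha : analytic_on_disk (fun z => (2^-1)%:C%C * (f z + 1)).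
  exact: analytic_scale (analytic_add af (@analytic_cst _ 1)).
have hb : analytic_on_disk (fun z => (2^-1)%:C%C * (f z - 1)).
  exact: analytic_scale (analytic_sub af (@analytic_cst _ 1)).
have bd (s : C) : modulus s = 1 -> forall z, modulus z < 1 -> modulus ((2^-1)%:C%C * (f z + s)) <= B + 1.
  move=> s1 z z1; rewrite modulusM modulusR ger0_norm ?invr_ge0//.
  have := modulusD (f z) s; rewrite s1; have := fB z z1; have := modulus_ge0 (f z).
  have := modulus_ge0 (f z + s); lra.
have Ha := hardy_bounded P1 ha (bd 1 (@modulus1 R)).
have Hb := hardy_bounded P1 hb (bd (-1) (ltac:(by rewrite modulusN modulus1))).
have e4 : 0 < e / (2 `^ p * 2) by rewrite divr_gt0// mulr_gt0// powR_gt0.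
have [d1 d10 H1] := square_good ha Ha e4; have [d2 d20 H2] := square_good hb Hb e4.
set g1 := (fun z => ((2^-1)%:C%C * (f z + 1)) ^+ 2) in H1.
set g2 := (fun z => ((2^-1)%:C%C * (f z - 1)) ^+ 2) in H2.
have fE z : f z = g1 z - g2 z.
  have -> : g1 z - g2 z = (((2^-1)%:C%C + (2^-1)%:C%C) * ((2^-1)%:C%C + (2^-1)%:C%C)) * f z.
    by rewrite /g1 /g2; ring.
  have h : ((2^-1)%:C%C + (2^-1)%:C%C : C) = 1.
    by rewrite -rmorphD /= (_ : 2^-1 + 2^-1 = 1 :> R)//; field.
  by rewrite !h !mul1r.
have a1 : analytic_on_disk g1 := analytic_mul ha ha.
have a2 : analytic_on_disk g2 := analytic_mul hb hb.
have h1 := (hardy_sqr (g := g1) p _ (fun z _ => erefl)).1 Ha.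
have h2 := (hardy_sqr (g := g2) p _ (fun z _ => erefl)).1 Hb.
exists (Num.min d1 d2) => [|t]; first by rewrite lt_min d10.
rewrite lt_min => /and3P[t0 t1 t2].
have t01 : 0 < t < d1 by rewrite t0.
have t02 : 0 < t < d2 by rewrite t0.
have b1 := analytic_sub (hardy_weighted_analytic (ltW t0) a1 h1) a1.
have b2 := analytic_sub (hardy_weighted_analytic (ltW t0) a2 h2) a2.
have := hardy_sub p1 b1 b2 (H1 t t01) (H2 t t02).
have -> : 2 `^ p * (e / (2 `^ p * 2)) + 2 `^ p * (e / (2 `^ p * 2)) = e.
  by field; rewrite gt_eqF// powR_gt0.
apply: hardy_congr => z _; congr modulus.
by rewrite /weighted_comp !fE; ring.
Qed.

(** With [g] a dilate of [f], which is bounded on the disk, [T_t f - f] is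
    [T_t (f - g) + ((T_t g - g) - (f - g))]. The first term is where the uniform bound on the
    operators enters. *)
Lemma hardy_norm_cvg : norm_cvg (Hardy p) phi.
Proof.
move=> f /(in_hardyP _ p1)[af [c hf]] e e0; have [M M1 HM] := hardy_weighted_bound.
pose K : R := 2 `^ p; have K0 : 0 < K by exact: powR_gt0.
pose B := K * M + K * (K + K).
have M0 : 0 < M := lt_le_trans ltr01 M1.
have B0 : 0 < B by rewrite addr_gt0 ?mulr_gt0 ?addr_gt0.
have ep : 0 < e `^ p / B by rewrite divr_gt0// powR_gt0.
set eta := _ / B in ep.
have [sg /andP[sg0 sg1] Hsg] := hardy_dilation_cvg p1 af hf ep.
have sg01 : 0 <= sg <= 1 by rewrite !ltW.
have ag := analytic_dilation sg01 af; set g := (fun z => f (sg%:C%C * z)) in ag Hsg.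
have sgr : 0 <= sg < 1 by rewrite ltW.
have [D D0 HD] := analytic_circle_bound af sgr.
have gD z : modulus z < 1 -> modulus (g z) <= D.
  move=> z1; apply: HD; rewrite modulusM modulusR ger0_norm ?(ltW sg0)//.
  by rewrite ler_piMr ?(ltW sg0)// ltW.
have hg := hardy_bounded p1 ag gD.
have [d d0 Hd] := bounded_good ag gD ep.
exists (Num.min d 1) => [|t]; first by rewrite lt_min d0 ltr01.
rewrite lt_min => /and3P[t0 td t1].
have t01 : 0 <= t <= 1 by rewrite !ltW.
have t0d : 0 < t < d by rewrite t0.
have afg := analytic_sub af ag.
have aTfg := hardy_weighted_analytic (ltW t0) afg Hsg.
have agT := analytic_sub (hardy_weighted_analytic (ltW t0) ag hg) ag.
have afT := analytic_sub (hardy_weighted_analytic (ltW t0) af hf) af.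
apply/(hardy_normP p1 afT (ltW e0)).
have h2 := hardy_sub p1 agT afg (Hd t t0d) Hsg.
have := hardy_add p1 aTfg (analytic_sub agT afg) (HM t _ _ t01 afg Hsg) h2.
have -> : 2 `^ p * (M * eta) + 2 `^ p * (2 `^ p * eta + 2 `^ p * eta) = e `^ p.
  by rewrite -/K /eta /B; field; rewrite gt_eqF.
by apply: hardy_congr => z _; congr modulus; rewrite /weighted_comp; ring.
Qed.

End hardy_semigroup.

Theorem proposition8 (R : realType) (X : function_space R)
  (hX : admissible X)
  (phi : R -> R[i]^o -> R[i]^o)
  (hphi : analytic_semigroup phi)
  (hT : forall t : R, 0 <= t -> bounded_on X (weighted_comp phi t))
  (hsup : (ereal_sup [set operator_norm X (weighted_comp phi t)
                     | t in `[0%R, 1%R]] < +oo)%E) :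
  strongly_continuous_semigroup X (weighted_comp phi).
Proof.
apply: (norm_cvgP hphi hT).
case: X hX hT hsup => [p p1|p q al [p1 q1 al0]|p al [p1 al0]|p al [p1 _]] hT hsup.
- exact: (hardy_norm_cvg p1 hphi hT hsup).
- exact: (damped_cvg hphi (mixed_damped p1 q1 al0) hT hsup).
- exact: (damped_cvg hphi (little_damped p1 al0) hT hsup).
- exact: (damped_cvg hphi (bergman_damped al p1) hT hsup).
Qed.
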